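(* Let $k\ge 0$ be an integer and let $f\colon N\to M$ be a non-degenerate PL map between compact polyhedra. Then the space of topological embeddings $N\to M\times\mathbb{R}^k$ that lift $f$ is locally contractible.
   Context: A PL map is called non-degenerate if it has no point-inverses of dimension $>0$. A map $e\colon N\to M\times\mathbb{R}^k$ lifts $f$ if its composition with the projection $M\times\mathbb{R}^k\to M$ equals $f$. A topological embedding is a continuous map which is a homeomorphism onto its image. The space of embeddings carries the topology of uniform convergence (equivalently, since $N$ is compact, the compact-open topology). *)

(* Defs.v *)
From HB Require Import structures.
From mathcomp Require Import all_boot all_order all_algebra finmap.
From mathcomp Require Import all_classical all_reals all_analysis.

Set Implicit Arguments.
Unset Strict Implicit.
Unset Printing Implicit Defensive.

Import Order.TTheory GRing.Theory Num.Theory.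
Import numFieldNormedType.Exports.

Local Open Scope classical_set_scope.
Local Open Scope ring_scope.

Section Polyhedra.
Variables (R : realType) (n : nat).

(* A simplex of R^n is represented by its finite set of vertices. *)
Definition affinely_independent (s : {fset 'rV[R]_n}) : Prop :=
  forall w : 'rV[R]_n -> R,
    \sum_(v <- s) w v = 0 -> \sum_(v <- s) w v *: v = 0 ->
    forall v, v \in s -> w v = 0.

Definition simplex_vertices (s : {fset 'rV[R]_n}) : Prop :=
  s != fset0 /\ affinely_independent s.

(* Since the weights sum to 1, the hull of fset0 is empty. *)
Definition convex_hull (s : {fset 'rV[R]_n}) : set 'rV[R]_n :=
  [set x | exists w : 'rV[R]_n -> R,
    [/\ forall v, v \in s -> 0 <= w v,
        \sum_(v <- s) w v = 1 &
        x = \sum_(v <- s) w v *: v]].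

(* The last clause says that two simplices meet in a common face, or not at
   all when they share no vertex. *)
Definition simplicial_complex (K : {fset {fset 'rV[R]_n}}) : Prop :=
  [/\ forall s, s \in K -> simplex_vertices s,
      forall s t, s \in K -> t != fset0 -> (t `<=` s)%fset -> t \in K &
      forall s t, s \in K -> t \in K ->
        convex_hull s `&` convex_hull t = convex_hull (s `&` t)%fset].

Definition underlying_space (K : {fset {fset 'rV[R]_n}}) : set 'rV[R]_n :=
  [set x | exists2 s, s \in K & convex_hull s x].

Definition triangulates (K : {fset {fset 'rV[R]_n}}) (P : set 'rV[R]_n) : Prop :=
  simplicial_complex K /\ underlying_space K = P.

Definition compact_polyhedron (P : set 'rV[R]_n) : Prop :=
  exists K, triangulates K P.

(* Largest dimension of a simplex contained in X; it is -oo when X is empty. *)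
Definition pl_dim (X : set 'rV[R]_n) : \bar R :=
  ereal_sup [set ((#|` s|.-1)%:R)%:E | s in
    [set s : {fset 'rV[R]_n} | simplex_vertices s /\ convex_hull s `<=` X]].

End Polyhedra.

(* Here and below a set N is also the type of its points, with the subspace
   topology and uniformity. *)
Definition pl_map (R : realType) (n m : nat)
    (N : set 'rV[R]_n) (M : set 'rV[R]_m) (f : N -> M) : Prop :=
  exists2 K : {fset {fset 'rV[R]_n}}, triangulates K N &
    forall s, s \in K -> exists (A : 'M[R]_(n, m)) (b : 'rV[R]_m),
      forall x : N, convex_hull s (\val x) -> \val (f x) = \val x *m A + b.

Definition non_degenerate (R : realType) (n m : nat)
    (N : set 'rV[R]_n) (M : set 'rV[R]_m) (f : N -> M) : Prop :=
  forall y : M, ~ (0%E < pl_dim [set \val x | x in f @^-1` [set y]])%E.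

Section Topology.

Definition homeomorphism (X Y : topologicalType) (h : X -> Y) : Prop :=
  continuous h /\
  exists g : Y -> X, [/\ continuous g, cancel h g & cancel g h].

Definition corestriction (X Y : Type) (h : X -> Y) (x : X) : range h :=
  exist _ (h x) (mem_set (imageT h x)).

Definition topological_embedding (X Y : topologicalType) (h : X -> Y) : Prop :=
  continuous h /\ homeomorphism (corestriction h).

(* The inclusion of V into U is null-homotopic in U; only the values of H on
   [0, 1] x V are relevant. *)
Definition contractible_in (R : realType) (X : topologicalType)
    (V U : set X) : Prop :=
  exists (c : X) (H : R * X -> X),
    [/\ U c,
        {within [set t : R | 0 <= t <= 1] `*` V, continuous H},
        forall t x, 0 <= t <= 1 -> V x -> U (H (t, x)),
        forall x, V x -> H (0, x) = x &
        forall x, V x -> H (1, x) = c].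

Definition locally_contractible (R : realType) (X : topologicalType) : Prop :=
  forall (x : X) (U : set X), nbhs x U ->
    exists V : set X, [/\ nbhs x V, V `<=` U & contractible_in R V U].

End Topology.

Definition lifts (N M L : Type) (f : N -> M) (e : N -> M * L) : Prop :=
  fst \o e = f.

Definition lifting_embeddings (R : realType) (n m : nat)
    (N : set 'rV[R]_n) (M : set 'rV[R]_m) (f : N -> M) (k : nat) :
    set {uniform N -> (M * 'rV[R]_k)%type} :=
  [set e | topological_embedding (e : N -> (M * 'rV[R]_k)%type) /\ lifts f e].
Arguments lifting_embeddings {R n m N M} f k _.

(* Main.v *)
(** A lift of f is a map (f, g); as N is compact, it is an embedding iff g is
continuous and separates the points of every fibre of f.  The straight line
homotopy from g to a nearby g0 can fail to separate only points x, y of a fibre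
that are close to each other.  Such points lie in different sheets of the
triangulation of N and are close to a point where these sheets are glued.

For a triangulation of N on the simplices of which f is affine and injective,
let the signs of finitely many linear functionals cut out the images of the
simplices.  The flag coordinates for the resulting sign cells provide levels
1 = a_0 >= a_1 >= ... >= a_L = 0, constant on the fibres, and near the locus
a_(i+1) = 0 an apex map P_i, such that N is there locally a union of rays
issuing from P_i.  Given s in ]0, 1[, a map g can be deformed, first increasing
the slope t from 0 to s, to a map that is affine on the part of every such ray
where a_(i+1) <= t a_i; for small s, this keeps g separating and close to where
it was.  Doing so at all levels i makes g and g0 conical.  For conical maps, the
pairs x, y as above can be pushed away from each other along their common rays
without changing the direction of g x - g y, so that g x - g y and
g0 x - g0 y need only be compared for points x, y at a distance bounded below,
and the straight line homotopy from g to g0 remains among the lifts. *)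

Require Import Defs.
From mathcomp Require Import all_boot all_order all_algebra finmap.
From mathcomp Require Import all_classical all_reals all_analysis.
From mathcomp Require Import ring lra zify.

Set Implicit Arguments.
Unset Strict Implicit.
Unset Printing Implicit Defensive.

Import Order.TTheory GRing.Theory Num.Theory.
Import numFieldNormedType.Exports.

Local Open Scope classical_set_scope.
Local Open Scope ring_scope.

(** * Conical deformations *)

Section RayStructure.
Variables (R : realType) (V : normedModType R).

(** The obstacle is that a separating map has in general no positive lower bound for [|g x - g y|]
    over all pairs of a fibre, since sheets meet; so closeness to g0 alone controls nothing.
    Conicality, a linear condition on g, reduces separation to pairs that cannot be pushed any
    further. For these, compactness gives a bound depending only on g0 and the scales, which makes
    the smallness constants uniform in g. The levels are treated in increasing order: rays of
    different levels commute, so coning at level i keeps conicality at the lower levels, and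
    conicality there is what shows that coning at level i keeps g separating. The scale at level i
    depends on g0 as already coned at the lower levels. This argument sees N only through the
    properties collected in [ray_structure]; triangulations enter when such a structure is built.
    Since g0 is deformed as well, the contraction ends at the fully coned g0 and not at g0. *)

Definition ray (P : nat -> V -> V) (i : nat) (nu : R) (x : V) : V :=
  P i x + nu *: (x - P i x).

(* The levels of a point are a 0 >= a 1 >= ...; where a i.+1 < a i, the point P i x
   is the apex of the ray through x along which the levels beyond i are scaled. *)
Record ray_structure (N : set V) (sim : V -> V -> Prop) (L : nat)
    (a : nat -> V -> R) (P : nat -> V -> V) : Prop := RayStructure {
  lev0 : forall x, N x -> a 0%N x = 1;
  levL : forall l x, N x -> (L <= l)%N -> a l x = 0;
  lev_ge0 : forall l x, N x -> 0 <= a l x;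
  lev_mono : forall l x, N x -> a l.+1 x <= a l x;
  lev_cont : forall l x, N x -> a l y @[y --> within N (nbhs x)] --> a l x;
  lev_sim : forall l x y, sim x y -> a l x = a l y;
  simN : forall x y, sim x y -> N x /\ N y;
  simxx : forall x, N x -> sim x x;
  sim_compact : compact [set p : V * V | sim p.1 p.2];
  ray_in : forall i x nu, N x -> a i.+1 x < a i x ->
    0 <= nu -> nu * a i.+1 x < a i x ->
    [/\ N (ray P i nu x),
        forall l, (l <= i)%N -> a l (ray P i nu x) = a l x,
        forall l, (i < l)%N -> a l (ray P i nu x) = nu * a l x,
        forall l, (l <= i)%N -> a l.+1 x < a l x ->
          P l (ray P i nu x) = P l x &
        forall l, (i < l)%N -> a l.+1 x < a l x -> 0 < nu ->
          P l (ray P i nu x) = P i x + nu *: (P l x - P i x)];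
  ray_sim : forall i x y nu, sim x y -> a i.+1 x < a i x ->
    0 <= nu -> nu * a i.+1 x < a i x -> sim (ray P i nu x) (ray P i nu y);
  apex_cont : forall i x, N x -> a i.+1 x < a i x ->
    P i y @[y --> within N (nbhs x)] --> P i x;
  apex_dist : exists2 C : R, 0 < C & forall i x, N x -> a i.+1 x < a i x ->
    `|x - P i x| <= C * a i.+1 x;
  sheets_sep : forall c : R, 0 < c -> exists2 d : R, 0 < d &
    forall x y, sim x y -> x != y -> exists j, [/\ 0 < a j x,
      forall l, (l < j)%N -> a l.+1 x < a l x -> P l x = P l y &
      c <= a j x -> d <= `|x - y|] }.

End RayStructure.

Lemma ler_dist_min1 (R : realType) (x y : R) : `|Num.min 1 x - Num.min 1 y| <= `|x - y|.
Proof.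
have /andP[] : - `|x - y| <= x - y <= `|x - y| by rewrite -ler_norml.
by move: `|x - y| => n ? ?; rewrite ler_norml; case: (leP 1 x) => ?; case: (leP 1 y) => ?; lra.
Qed.

Lemma ler_dist_max0 (R : realType) (x y : R) : `|Num.max 0 x - Num.max 0 y| <= `|x - y|.
Proof.
have /andP[] : - `|x - y| <= x - y <= `|x - y| by rewrite -ler_norml.
by move: `|x - y| => n ? ?; rewrite ler_norml; case: (leP 0 x) => ?; case: (leP 0 y) => ?; lra.
Qed.

Section ConeOff.
Variables (R : realType) (V W : normedModType R).
Variables (N : set V) (sim : V -> V -> Prop) (L : nat).
Variables (a : nat -> V -> R) (P : nat -> V -> V).
Hypothesis RS : ray_structure N sim L a P.

Implicit Types (g h : V -> W) (s : R).

Local Notation ray := (ray P).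
(* Where a i.+1 < s * a i, the map cone_off i s g is the affine interpolation along
   the ray of its values at the apex and at the point with a i.+1 = s * a i. *)
Definition slope i s x := a i.+1 x / (s * a i x).
Definition top i s x := ray i (slope i s x)^-1 x.
Definition near_apex i s x := a i.+1 x < s * a i x.
Definition interp i s g x :=
  (1 - slope i s x) *: g (P i x) + slope i s x *: g (top i s x).
Definition cone_off i s g x := if near_apex i s x then interp i s g x else g x.
Definition conical i s g := forall x, N x -> near_apex i s x -> g x = interp i s g x.

Lemma ray0 i x : ray i 0 x = P i x.
Proof. by rewrite /ray scale0r addr0. Qed.

Lemma ray1 i x : ray i 1 x = x.
Proof. by rewrite /ray scale1r addrC subrK. Qed.

(** * Geometry of the conical zone of one level *)

Section Near.
Variables (i : nat) (s : R) (x : V).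
Hypotheses (s0 : 0 <= s) (s1 : s < 1) (Nx : N x) (nx : near_apex i s x).

Lemma near_lev_gt0 : 0 < a i x.
Proof using RS s0 s1 Nx nx.
rewrite lt_neqAle (lev_ge0 RS i Nx) andbT eq_sym; apply/eqP => h0; move: nx.
by rewrite /near_apex h0 mulr0 ltNge (lev_ge0 RS).
Qed.

Lemma near_s_gt0 : 0 < s.
Proof using RS s0 s1 Nx nx.
rewrite lt_neqAle s0 andbT; apply/eqP => h; move: nx.
by rewrite /near_apex -h mul0r ltNge (lev_ge0 RS).
Qed.

Lemma near_gap : a i.+1 x < a i x.
Proof using RS s0 s1 Nx nx.
apply: (lt_trans nx); rewrite -[ltRHS]mul1r ltr_pM2r //; exact: near_lev_gt0.
Qed.

Lemma near_sa : 0 < s * a i x.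
Proof using RS s0 s1 Nx nx. by rewrite mulr_gt0 ?near_s_gt0 ?near_lev_gt0. Qed.

Lemma slope_ge0 : 0 <= slope i s x.
Proof using RS s0 s1 Nx nx. by rewrite divr_ge0 ?(lev_ge0 RS) // ltW // near_sa. Qed.

Lemma slope_lt1 : slope i s x < 1.
Proof using RS s0 s1 Nx nx. by rewrite ltr_pdivrMr ?near_sa // mul1r. Qed.

(** This makes the ratio used in [top] admissible for [ray_in]. If [a i.+1 x = 0], the slope is 0
    and so is its inverse, by the convention [0^-1 = 0]; the top is then the apex. *)
Lemma slopeV_lt : (slope i s x)^-1 * a i.+1 x < a i x.
Proof using RS s0 s1 Nx nx.
rewrite /slope invf_div; have [h|h] := eqVneq (a i.+1 x) 0.
  by rewrite h mulr0 near_lev_gt0.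
rewrite divfK // -[ltRHS]mul1r ltr_pM2r //; exact: near_lev_gt0.
Qed.

Lemma top_in : [/\ N (top i s x),
        forall l, (l <= i)%N -> a l (top i s x) = a l x,
        forall l, (i < l)%N -> a l (top i s x) = (slope i s x)^-1 * a l x,
        forall l, (l <= i)%N -> a l.+1 x < a l x ->
          P l (top i s x) = P l x &
        forall l, (i < l)%N -> a l.+1 x < a l x -> 0 < slope i s x ->
          P l (top i s x) = P i x + (slope i s x)^-1 *: (P l x - P i x)].
Proof using RS s0 s1 Nx nx.
have [? ? ? ? h] := ray_in RS Nx near_gap (etrans (invr_ge0 _) slope_ge0) slopeV_lt.
by split => // l il gl sl; apply: h => //; rewrite invr_gt0.
Qed.

Lemma apex_in : [/\ N (P i x),
        forall l, (l <= i)%N -> a l (P i x) = a l x,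
        forall l, (i < l)%N -> a l (P i x) = 0 &
        forall l, (l <= i)%N -> a l.+1 x < a l x -> P l (P i x) = P l x].
Proof using RS s0 s1 Nx nx.
have := @ray_in _ _ _ _ _ _ _ RS i x 0 Nx near_gap.
rewrite ray0 lexx mul0r near_lev_gt0 => -[]// h1 h2 h3 h4 _; split => // l il.
by rewrite h3 // mul0r.
Qed.

Lemma top_far : 0 < slope i s x -> a i.+1 (top i s x) = s * a i x.
Proof using RS s0 s1 Nx nx.
move=> k0; have [_ _ /(_ i.+1) -> // _ _] := top_in; rewrite /slope invf_div divfK //.
by apply: contraTneq k0 => h; rewrite /slope h mul0r ltxx.
Qed.

End Near.

Lemma sim_slope i s x y : sim x y -> slope i s x = slope i s y.
Proof. by move=> xy; rewrite /slope !(lev_sim RS _ xy). Qed.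

Lemma sim_near i s x y : sim x y -> near_apex i s x = near_apex i s y.
Proof. by move=> xy; rewrite /near_apex !(lev_sim RS _ xy). Qed.

Lemma sim_top i s x y : 0 <= s -> s < 1 -> sim x y -> near_apex i s x ->
  sim (top i s x) (top i s y).
Proof.
move=> s0 s1 xy nx; have [Nx Ny] := simN RS xy.
rewrite /top -(sim_slope i s xy); apply: (ray_sim RS) => //.
- exact: near_gap nx.
- by rewrite invr_ge0 slope_ge0.
- exact: slopeV_lt.
Qed.

Lemma sim_apex i s x y : 0 <= s -> s < 1 -> sim x y -> near_apex i s x ->
  sim (P i x) (P i y).
Proof.
move=> s0 s1 xy nx; have [Nx Ny] := simN RS xy.
rewrite -(ray0 i x) -(ray0 i y); apply: (ray_sim RS) => //.
- exact: near_gap nx.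
- by rewrite mul0r; exact: near_lev_gt0 nx.
Qed.

Lemma cone_off_apex i s g x : 0 <= s -> s < 1 -> N x -> near_apex i s x ->
  cone_off i s g (P i x) = g (P i x).
Proof.
move=> s0 s1 Nx nx; rewrite /cone_off /interp.
case: ifP => // _; have [NP al ag Pl] := apex_in s0 s1 Nx nx.
rewrite /slope ag // mul0r scale0r addr0 subr0 scale1r Pl //.
exact: near_gap nx.
Qed.

(** A vanishing slope means [a i.+1 x = 0], and [apex_dist] bounds the distance to the apex by a
    multiple of this level. *)
Lemma slope0_apex i s x : 0 <= s -> s < 1 -> N x -> near_apex i s x ->
  slope i s x = 0 -> P i x = x.
Proof.
move=> s0 s1 Nx nx k0; have [C C0 /(_ i x Nx (near_gap s0 s1 Nx nx))] := apex_dist RS.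
have -> : a i.+1 x = 0.
  have := near_sa s0 s1 Nx nx; move: k0; rewrite /slope => /eqP.
  by rewrite mulf_eq0 invr_eq0 => /orP[/eqP//|/eqP->]; rewrite ltxx.
by rewrite mulr0 normr_le0 subr_eq0 => /eqP.
Qed.

Lemma cone_off_top i s g x : 0 <= s -> s < 1 -> N x -> near_apex i s x ->
  0 < slope i s x -> cone_off i s g (top i s x) = g (top i s x).
Proof.
move=> s0 s1 Nx nx k0; rewrite /cone_off /near_apex (top_far s0 s1) //.
by have [_ -> // _ _ _] := top_in s0 s1 Nx nx; rewrite ltxx.
Qed.

(** [cone_off] keeps the value at the apex, where the slope is 0, and at a top of positive slope,
    which lies outside the zone; hence [cone_off i s g] and [g] have the same interpolation. *)
Lemma conical_cone_off i s g : 0 <= s -> s < 1 -> conical i s (cone_off i s g).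
Proof.
move=> s0 s1 x Nx nx; rewrite {1}/cone_off nx /interp cone_off_apex //.
have := slope_ge0 s0 s1 Nx nx; rewrite le_eqVlt => /predU1P[<-|k0].
  by rewrite !scale0r.
by rewrite cone_off_top.
Qed.

(** [ray l nu] is the homothety of ratio [nu] centred at [P l x]; under the hypotheses it carries
    the ray of level [i] through [x] to the one through [ray l nu x]. *)
Lemma ray_comm l i (nu mu : R) x :
  P l (ray i mu x) = P l x -> P i (ray l nu x) = P l x + nu *: (P i x - P l x) ->
  ray l nu (ray i mu x) = ray i mu (ray l nu x).
Proof.
rewrite /ray => -> ->.
set p := P i x; set q := P l x.
have -> : q + nu *: (x - q) - (q + nu *: (p - q)) = nu *: (x - p).
  by rewrite opprD addrACA subrr add0r -scalerBr opprB addrA subrK.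
by rewrite addrAC scalerDr addrA !scalerA mulrC.
Qed.

Lemma near_apex_ray l i s x : (l < i)%N -> 0 <= s -> s < 1 -> N x ->
  near_apex l s x -> forall mu, N (ray i mu x) ->
  (forall j, (j <= i)%N -> a j (ray i mu x) = a j x) ->
  slope l s (ray i mu x) = slope l s x /\ near_apex l s (ray i mu x).
Proof.
by move=> li s0 s1 Nx nx mu _ al; rewrite /slope /near_apex !al // ltnW.
Qed.

(* Points in the conical zone of level l: the value at a ray point of a higher
   level splits through the common apex. *)
Lemma conical_ray l i s g x mu : (l < i)%N -> 0 <= s -> s < 1 -> conical l s g ->
  N x -> near_apex l s x -> a i.+1 x < a i x -> 0 <= mu -> mu * a i.+1 x < a i x ->
  g (ray i mu x) = (1 - slope l s x) *: g (P l x) +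
    slope l s x *: g (ray i mu (top l s x)).
Proof.
move=> li s0 s1 cg Nx nx gi mu0 mui.
have gl := near_gap s0 s1 Nx nx.
have [Nr al _ Pl _] := ray_in RS Nx gi mu0 mui.
have [sl nr] := near_apex_ray li s0 s1 Nx nx Nr al.
rewrite (cg _ Nr nr) /interp sl (Pl _ (ltnW li) gl) /top sl.
have := slope_ge0 s0 s1 Nx nx; rewrite le_eqVlt => /predU1P[<-|k0].
  by rewrite !scale0r.
rewrite ray_comm //; first exact: Pl (ltnW li) gl.
by have [_ _ _ _ ->] := top_in s0 s1 Nx nx.
Qed.

Lemma near_top l i s t x : (l < i)%N -> 0 <= s -> s < 1 -> N x -> near_apex l s x ->
  0 < slope l s x -> near_apex i t (top l s x) = near_apex i t x.
Proof.
move=> li s0 s1 Nx nx k0; have [_ _ ag _ _] := top_in s0 s1 Nx nx.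
by rewrite /near_apex !ag // ?leqW // mulrCA ltr_pM2l // invr_gt0.
Qed.

Lemma slope_top l i s t x : (l < i)%N -> 0 <= s -> s < 1 -> N x -> near_apex l s x ->
  0 < slope l s x -> slope i t (top l s x) = slope i t x.
Proof.
move=> li s0 s1 Nx nx k0; have [_ _ ag _ _] := top_in s0 s1 Nx nx.
rewrite {1}/slope !ag // ?leqW // [t * _]mulrCA -mulf_div divff ?mul1r //.
by rewrite invr_neq0 // gt_eqF.
Qed.

(** Both [g (P i x)] and [g (top i t x)] are values on a ray of level [i], so [conical_ray] splits
    each of them at the apex of level [l]. Scaling at level [l] multiplies [a i] and [a i.+1] by the
    same factor, hence keeps the slope at level [i], and it commutes with the rays of level [i]. *)
Lemma conical_cone_off_lt l i s t g : (l < i)%N -> 0 <= s -> s < 1 ->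
  0 <= t -> t < 1 -> conical l s g -> conical l s (cone_off i t g).
Proof.
move=> li s0 s1 t0 t1 cg x Nx nx.
have gl := near_gap s0 s1 Nx nx.
have [NP alP agP PlP] := apex_in s0 s1 Nx nx.
have cP : cone_off i t g (P l x) = g (P l x).
  by rewrite /cone_off /near_apex !agP // ?leqW // mulr0 ltxx.
rewrite /interp cP.
have := slope_ge0 s0 s1 Nx nx; rewrite le_eqVlt => /predU1P[k0|k0].
  by rewrite -k0 subr0 scale1r scale0r addr0 -cP (slope0_apex s0 s1 Nx nx).
rewrite /cone_off near_top //; case: ifP => ni; last first.
  by rewrite cg.
rewrite /interp slope_top // -!ray0 /top slope_top // -/(top l s x).
have gi := near_gap t0 t1 Nx ni.
have ai := near_lev_gt0 t0 t1 Nx ni.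
rewrite (conical_ray li s0 s1 cg Nx nx gi) ?mul0r //.
rewrite (conical_ray li s0 s1 cg Nx nx gi) ?invr_ge0 ?slope_ge0 //; last first.
  exact: slopeV_lt.
set k := slope l s x; set m := slope i t x.
rewrite !scalerDr !scalerA addrACA -scalerDl !ray0; congr (_ + _).
  by congr (_ *: _); ring.
by congr (_ *: _ + _ *: _); rewrite mulrC.
Qed.

(** * Separating maps and lower bounds from compactness *)

Definition sim_injective g := forall x y, sim x y -> x != y -> g x != g y.
Definition close (e : R) g h := forall x, N x -> `|g x - h x| <= e.
Definition cont_on g := {within N, continuous g}.

Lemma lev_le1 l x : N x -> a l x <= 1.
Proof.
move=> Nx; elim: l => [|l]; first by rewrite (lev0 RS).
exact: le_trans (lev_mono RS l Nx).
Qed.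

(** Levels are constant on fibres, so [x] and [y] have the same slope, and one homothety at the
    common apex carries both to their tops. *)
Lemma top_neq l s x y : 0 <= s -> s < 1 -> sim x y -> near_apex l s x ->
  P l x = P l y -> x != y -> 0 < slope l s x /\ top l s x != top l s y.
Proof.
move=> s0 s1 xy nx PE xNy; have [Nx Ny] := simN RS xy.
have ny : near_apex l s y by rewrite -(sim_near l s xy).
have k0 : 0 < slope l s x.
  rewrite lt_neqAle slope_ge0 // andbT eq_sym; apply: contraNneq xNy => k0.
  rewrite -(slope0_apex s0 s1 Nx nx k0) PE (slope0_apex s0 s1 Ny ny) //.
  by rewrite -(sim_slope l s xy).
split => //; apply: contraNneq xNy; rewrite /top -(sim_slope l s xy) /ray PE.
move=> /addrI /scalerI; rewrite invr_neq0 ?gt_eqF // => /(_ isT).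
by move=> /addIr ->.
Qed.

(* Scaling a pair of points up along the rays at their common apices, from the
   lowest level to the highest one, changes the difference of the values of a
   conical map by positive factors only. *)
Lemma conical_neq (s : nat -> R) i (Inv : V -> V -> Prop) h :
  (forall l, (l < i)%N -> 0 <= s l < 1) ->
  (forall l, (l < i)%N -> conical l (s l) h) ->
  (forall x y, Inv x y -> x != y) ->
  (forall l x y, (l < i)%N -> sim x y -> Inv x y -> near_apex l (s l) x ->
    P l x = P l y -> 0 < slope l (s l) x -> Inv (top l (s l) x) (top l (s l) y)) ->
  (forall x y, sim x y -> Inv x y ->
    (forall l, (l < i)%N -> near_apex l (s l) x -> P l x <> P l y) -> h x != h y) ->
  forall x y, sim x y -> Inv x y -> h x != h y.
Proof.
move=> s01 ch InvN InvS base x y xy Ixy.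
(* [l] counts the levels still to be treated; at those below [i - l] the pair is already outside the
   zone or has different apices. Moving to the tops at level [m] takes the pair out of the zone of
   [m] and changes neither levels nor apices below [m], so what has been achieved persists. *)
have main l : (l <= i)%N -> forall x y, sim x y -> Inv x y ->
    (forall l', (l' < i - l)%N -> near_apex l' (s l') x -> P l' x <> P l' y) ->
    h x != h y; last first.
  by apply: (main i) => // l'; rewrite subnn.
elim: l => [|l IH] li {}x {}y {}xy {}Ixy nrm.
  by apply: base => // l' l'i; apply: nrm; rewrite subn0.
set m := (i - l.+1)%N; have mi : (m < i)%N by rewrite /m; lia.
have mS : (i - l)%N = m.+1 by rewrite /m; lia.
have [nP|] := pselect (near_apex m (s m) x /\ P m x = P m y); last first.
  move=> nn; apply: IH => //; first exact: ltnW.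
  move=> l'; rewrite mS ltnS leq_eqVlt => /predU1P[->|l'm]; last exact: nrm.
  by move=> nx PE; apply: nn.
case: nP => nx PE; have /andP[s0 s1] := s01 _ mi.
have [Nx Ny] := simN RS xy.
have ny : near_apex m (s m) y by rewrite -(sim_near m _ xy).
have [k0 tN] := top_neq s0 s1 xy nx PE (InvN _ _ Ixy).
rewrite (ch _ mi x Nx nx) (ch _ mi y Ny ny) /interp PE -(sim_slope _ _ xy).
rewrite (inj_eq (addrI _)) (inj_eq (scalerI _)) ?gt_eqF //.
have [_ al _ Pl _] := top_in s0 s1 Nx nx.
have [_ _ _ Ply _] := top_in s0 s1 Ny ny.
apply: IH; rewrite ?(ltnW li) //; first exact: sim_top.
  exact: InvS.
move=> l'; rewrite mS ltnS leq_eqVlt => /predU1P[->|l'm].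
  by rewrite /near_apex top_far // al // ltxx.
have /andP[s0' s1'] := s01 _ (ltn_trans l'm mi).
rewrite /near_apex !al ?(ltnW l'm) // -/(near_apex l' (s l') x) => nx'.
have gx := near_gap s0' s1' Nx nx'.
rewrite Pl ?(ltnW l'm) // Ply ?(ltnW l'm) //; first exact: nrm.
by rewrite -!(lev_sim RS _ xy).
Qed.

Lemma cont_onP g : cont_on g <->
  forall x, N x -> forall e : R, 0 < e -> exists2 d : R, 0 < d &
    forall y, N y -> `|y - x| < d -> `|g y - g x| < e.
Proof.
rewrite /cont_on; split.
  move=> /subspace_continuousP cg x Nx e e0.
  have /cvgrPdist_lt/(_ e e0) := cg x Nx.
  move=> /nbhs_ballP[d /= d0 dg]; exists d => // y Ny yx.
  by rewrite distrC; apply: dg => //; rewrite -ball_normE /= distrC.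
move=> cg; apply/subspace_continuousP => x Nx; apply/cvgrPdist_lt => e e0.
have [d d0 dg] := cg x Nx e e0.
apply/nbhs_ballP; exists d => // y; rewrite -ball_normE /= distrC => yx Ny.
by rewrite distrC; apply: dg.
Qed.

Lemma sim_N_compact : compact N.
Proof.
have <- : fst @` [set p : V * V | sim p.1 p.2] = N.
  apply/seteqP; split => [_ [[x y] /= xy <-]|x Nx].
    by have [] := simN RS xy.
  by exists (x, x) => //=; exact: (simxx RS).
apply: continuous_compact; last exact: sim_compact RS.
by apply: continuous_subspaceT => p; exact: cvg_fst.
Qed.

Lemma cont_unif g : cont_on g -> forall e : R, 0 < e -> exists2 d : R, 0 < d &
  forall x y, N x -> N y -> `|x - y| < d -> `|g x - g y| < e.
Proof.
move=> /cont_onP cg e e0.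
have /compact_near_coveringP nc := sim_N_compact.
have := nc _ (0 : R)^'+ (fun d x => forall y z, N y -> N z ->
  `|y - x| < d -> `|z - x| < d + d -> `|g y - g z| < e) _.
have h : forall x, N x -> \forall x' \near x & i \near (0 : R)^'+,
    forall y z, N y -> N z -> `|y - x'| < i -> `|z - x'| < i + i -> `|g y - g z| < e.
  move=> x Nx; have [d d0 dg] := cg x Nx (e / 2) (divr_gt0 e0 (ltr0n _ 2)).
  have d3 : 0 < d / 3 by apply: divr_gt0.
  exists (ball x (d / 3), [set i | i < d / 3]) => /=.
    split; first exact: nbhsx_ballx.
    by exists (d / 3) => // i /=; rewrite sub0r normrN => /ltr_normlW.
  move=> [x' i] /= []; rewrite -ball_normE /= distrC => x'x id y z Ny Nz yx zx.
  have ty : `|y - x| < d.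
    have := ler_normD (y - x') (x' - x); rewrite addrA subrK; lra.
  have tz : `|z - x| < d.
    have := ler_normD (z - x') (x' - x); rewrite addrA subrK; lra.
  have := dg y Ny ty; have := dg z Nz tz.
  have := ler_normB (g y - g x) (g z - g x); rewrite opprB addrA subrK; lra.
move=> /(_ _ h) [d /= d0 dN]; exists (d / 2); first by apply: divr_gt0.
move=> x y Nx Ny xy; apply: (dN (d / 2)) => //=.
- rewrite sub0r normrN gtr0_norm; lra.
- lra.
- exact: Nx.
- by rewrite subrr normr0; lra.
- by rewrite distrC; lra.
Qed.

Lemma cont_bounded g : cont_on g -> exists2 M : R, 0 < M & forall x, N x -> `|g x| <= M.
Proof.
move=> cg; have /compact_bounded := continuous_compact cg sim_N_compact.
move=> [M [_ /(_ (`|M| + 1))]]; rewrite (le_lt_trans (ler_norm _)) ?ltrDl // => /(_ isT) b.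
exists (`|M| + 1); first by rewrite ltr_wpDl.
by move=> x Nx; apply: b; exists x.
Qed.

(** The pairs in question form a compact set, on which [|g x - g y|] attains a positive minimum
    unless the set is empty. *)
Lemma sim_bound_below g d : cont_on g -> sim_injective g -> 0 < d ->
  exists2 eta : R, 0 < eta &
    forall x y, sim x y -> d <= `|x - y| -> eta <= `|g x - g y|.
Proof.
move=> cg ig d0.
pose S := [set p : V * V | sim p.1 p.2] `&` [set p | d <= `|p.1 - p.2|].
have cS : compact S.
  apply: compact_closedI; first exact: sim_compact RS.
  rewrite (_ : [set _ | _] = (fun p : V * V => `|p.1 - p.2|) @^-1` [set r | d <= r]) //.
  apply: closed_comp => [p _|]; last exact: closed_ge.
  by apply: cvg_norm; apply: cvgB; [exact: cvg_fst|exact: cvg_snd].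
have [[p Sp]|S0] := pselect (S !=set0); last first.
  exists 1 => // x y xy dxy; exfalso; apply: S0; by exists (x, y).
have [] := @compact_EVT_min _ _ (fun p => `|g p.1 - g p.2|) S _ cS.
- by exists p.
- apply/subspace_continuousP => -[x y] [/= xy dxy]; have [Nx Ny] := simN RS xy.
  apply: cvg_norm; apply/cvgrPdist_lt => e e0.
  have [r r0 rg] := cont_unif cg (divr_gt0 e0 (ltr0n _ 2)).
  exists (ball x r, ball y r) => /=.
    by split; exact: nbhsx_ballx.
  move=> [x' y'] /= []; rewrite -!ball_normE /= => xx yy [x'y' _].
  have [Nx' Ny'] := simN RS x'y'.
  have h1 := rg _ _ Nx Nx' xx; have h2 := rg _ _ Ny Ny' yy.
  have := ler_normB (g x - g x') (g y - g y').
  rewrite (_ : g x - g x' - (g y - g y') = g x - g y - (g x' - g y')); first lra.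
  by rewrite !opprB addrACA [RHS]addrACA [- g x' + _]addrC.
- move=> [x y] /set_mem[/= xy dxy] mn; exists `|g x - g y|.
    rewrite normr_gt0 subr_eq0; apply: ig => //.
    by apply: contraTneq dxy => ->; rewrite subrr normr0 -ltNge.
  by move=> x' y' xy' dxy'; apply: (mn (x', y')); exact/mem_set.
Qed.

(** Let [j] be the level given by [sheets_sep]. Below [j] the apices of [x] and [y] agree, so by the
    last hypothesis [x] is outside the zones: [a l.+1 x >= s l * a l x] for [l < j]. Hence [a j x]
    is at least the product [c] of all scales, and [sheets_sep] keeps [x] and [y] apart. *)
Lemma normal_bound_below g (s : nat -> R) i : cont_on g -> sim_injective g ->
  (forall l, (l < i)%N -> 0 < s l < 1) ->
  exists2 eta : R, 0 < eta & forall x y, sim x y -> x != y ->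
    (forall j, 0 < a j x -> (j <= i)%N) ->
    (forall l, (l < i)%N -> near_apex l (s l) x -> P l x <> P l y) ->
    eta <= `|g x - g y|.
Proof.
move=> cg ig s01.
pose c := \prod_(l < i) s l.
have c0 : 0 < c by apply: prodr_gt0 => l _; case/andP: (s01 l (ltn_ord l)).
have [d d0 sep] := sheets_sep RS c0.
have [eta eta0 ge] := sim_bound_below cg ig d0.
exists eta => // x y xy xNy ji nrm; have [Nx Ny] := simN RS xy.
have [j [aj Pj cj]] := sep x y xy xNy.
apply: ge => //; apply: cj.
have le_ji := ji j aj.
have H m : (m <= j)%N -> \prod_(l < m) s l <= a m x.
  elim: m => [|m IH] mj; first by rewrite big_ord0 (lev0 RS).
  have /andP[sm0 sm1] := s01 m (leq_trans mj le_ji).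
  rewrite big_ord_recr /= mulrC; apply: (@le_trans _ _ (s m * a m x)).
    by rewrite ler_pM2l // IH // ltnW.
  rewrite leNgt; apply/negP => nx; have g' := near_gap (ltW sm0) sm1 Nx nx.
  exact: (nrm m (leq_trans mj le_ji) nx) (Pj m mj g').
apply: le_trans (H j (leqnn j)).
rewrite /c -(subnKC le_ji) big_split_ord /= -[leRHS]mulr1 ler_pM //.
- apply: prodr_ge0 => l _; have /andP[/ltW //] := s01 l (leq_trans (ltn_ord l) le_ji).
- apply: prodr_ge0 => l _; have /andP[/ltW //] : 0 < s (j + l)%N < 1.
  by apply: s01; have := ltn_ord l; lia.
- apply: (@le_trans _ _ (\prod_(l < i - j) 1)); last by rewrite big1_eq.
  apply: ler_prod => l _.
  have /andP[/ltW -> /ltW -> //] : 0 < s (j + l)%N < 1.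
  by apply: s01; have := ltn_ord l; lia.
Qed.

(** Dividing the bound [C * a i.+1 x] for the distance to the apex by the slope leaves
    [C * (t * a i x)], which therefore bounds the part of the ray that coning affects. *)
Lemma apex_top_dist : exists2 C : R, 0 < C & forall i t x, 0 <= t -> t < 1 -> N x ->
  near_apex i t x ->
  [/\ `|P i x - x| <= C * (t * a i x), `|top i t x - x| <= C * (t * a i x) &
      `|P i x - top i t x| <= C * (t * a i x)].
Proof.
have [C C0 CP] := apex_dist RS; exists C => // i t x t0 t1 Nx nx.
have gx := near_gap t0 t1 Nx nx.
have h : `|x - P i x| <= C * (t * a i x).
  by apply: le_trans (CP _ _ Nx gx) _; rewrite ler_pM2l // ltW.
have k0 := slope_ge0 t0 t1 Nx nx; have k1 := slope_lt1 t0 t1 Nx nx.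
have h' : (slope i t x)^-1 * `|x - P i x| <= C * (t * a i x).
  have [k00|kn0] := eqVneq (slope i t x) 0.
    rewrite k00 invr0 mul0r mulr_ge0 ?(ltW C0) //; exact: ltW (near_sa t0 t1 Nx nx).
  have kp : 0 < slope i t x by rewrite lt_neqAle eq_sym kn0.
  rewrite mulrC ler_pdivrMr //; apply: le_trans (CP _ _ Nx gx) _.
  rewrite -mulrA ler_pM2l // /slope mulrC divfK // gt_eqF //; exact: near_sa nx.
rewrite (distrC (P i x) x); split => //; rewrite /top /ray.
  have -> : P i x + (slope i t x)^-1 *: (x - P i x) - x =
      ((slope i t x)^-1 - 1) *: (x - P i x).
    by rewrite scalerBl scale1r opprB addrAC addrC addrA addrAC.
  have [k00|kn0] := eqVneq (slope i t x) 0.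
    by rewrite k00 invr0 sub0r normrZ normrN normr1 mul1r.
  have kp : 0 < slope i t x by rewrite lt_neqAle eq_sym kn0.
  rewrite normrZ ger0_norm ?subr_ge0 ?invf_ge1 ?(ltW k1) //.
  by apply: le_trans h'; rewrite ler_wpM2r // lerBlDr lerDl.
by rewrite opprD addrA subrr add0r normrN normrZ ger0_norm // invr_ge0.
Qed.

Lemma norm_conv (k : R) (u v : W) (e : R) : 0 <= k -> k <= 1 -> `|u| <= e -> `|v| <= e ->
  `|(1 - k) *: u + k *: v| <= e.
Proof.
move=> k0 k1 ue ve; apply: le_trans (ler_normD _ _) _.
rewrite !normrZ (ger0_norm k0) ger0_norm ?subr_ge0 //.
have -> : e = (1 - k) * e + k * e by ring.
by rewrite lerD // ler_wpM2l // subr_ge0.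
Qed.

Lemma convB (k k' : R) (u v u' v' : W) :
  (1 - k) *: u + k *: v - ((1 - k') *: u' + k' *: v') =
  (1 - k) *: (u - u') + k *: (v - v') + (k' - k) *: (u' - v').
Proof.
have -> : (1 - k') *: u' = (1 - k) *: u' - (k' - k) *: u'.
  by rewrite -scalerBl; congr (_ *: _); ring.
have -> : k' *: v' = k *: v' + (k' - k) *: v'.
  by rewrite -scalerDl; congr (_ *: _); ring.
rewrite !scalerBr opprD opprB opprD [in RHS](addrACA ((1 - k) *: u)) -[RHS]addrA.
by congr (_ + _); rewrite [RHS]addrACA (addrC ((k' - k) *: u')).
Qed.

Lemma interpB i t g h x : interp i t g x - interp i t h x =
  (1 - slope i t x) *: (g (P i x) - h (P i x)) +
  slope i t x *: (g (top i t x) - h (top i t x)).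
Proof. by rewrite /interp !scalerBr opprD addrACA. Qed.

Lemma interpBx i t g x : interp i t g x - g x =
  (1 - slope i t x) *: (g (P i x) - g x) + slope i t x *: (g (top i t x) - g x).
Proof.
by rewrite /interp !scalerBr addrACA -opprD -scalerDl subrK scale1r.
Qed.

Lemma cone_off_close i t g h e : 0 <= t -> t < 1 -> close e g h ->
  close e (cone_off i t g) (cone_off i t h).
Proof.
move=> t0 t1 gh x Nx; rewrite /cone_off; case: ifP => nx; last exact: gh.
rewrite interpB; apply: norm_conv.
- exact: slope_ge0 nx.
- exact/ltW/(slope_lt1 t0 t1 Nx nx).
- by apply: gh; have [] := apex_in t0 t1 Nx nx.
- by apply: gh; have [] := top_in t0 t1 Nx nx.
Qed.

(** Smallness is required of [t * a i x] and not of [t]: this also gives continuity of the coned map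
    at points with [a i x = 0], where no apex is available. *)
Lemma cone_off_small g : cont_on g -> forall e : R, 0 < e -> exists2 d : R, 0 < d &
  forall i t x, 0 <= t -> t < 1 -> N x -> t * a i x < d ->
    `|cone_off i t g x - g x| <= e.
Proof.
move=> cg e e0; have [C C0 CP] := apex_top_dist.
have [d d0 dg] := cont_unif cg e0; exists (d / C); first by apply: divr_gt0.
move=> i t x t0 t1 Nx; rewrite ltr_pdivlMr // mulrC => lt.
rewrite /cone_off; case: ifP => nx; last by rewrite subrr normr0 ltW.
have [h1 h2 _] := CP i t x t0 t1 Nx nx.
have [NP _ _ _] := apex_in t0 t1 Nx nx; have [Nt _ _ _ _] := top_in t0 t1 Nx nx.
rewrite interpBx; apply: norm_conv.
- exact: slope_ge0 nx.
- exact/ltW/(slope_lt1 t0 t1 Nx nx).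
- by apply/ltW/dg => //; exact: le_lt_trans lt.
- by apply/ltW/dg => //; exact: le_lt_trans lt.
Qed.

(** If the combination vanished, [p] would equal [k *: (p - q)], whose norm is at most [|p - q|]. *)
Lemma conv_neq0 (p q : W) (k : R) : 0 <= k -> k <= 1 -> `|p - q| < `|p| ->
  (1 - k) *: p + k *: q != 0.
Proof.
move=> k0 k1 pq; apply: contraTneq pq => h.
have E : p = k *: (p - q).
  apply/eqP; rewrite -subr_eq0 scalerBr opprB addrCA addrC -addrA addrA.
  by rewrite -[X in X - _]scale1r -scalerBl h.
by rewrite -leNgt {1}E normrZ ger0_norm // ler_piMl.
Qed.

(** With a common apex at level [i], the difference of values at [x] and [y] is a positive multiple
    of that at the tops. With different apices, conicality at the lower levels reduces the claim to
    normal pairs; there the apices have [g0]-values at least [eta] apart, and for small [t] the tops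
    are too close to the apices to undo this. Only [g0] enters the constants. *)
Lemma stage_injective g0 (s : nat -> R) i : cont_on g0 -> sim_injective g0 ->
  (forall l, (l < i)%N -> 0 < s l < 1) ->
  exists t0 eta : R, [/\ 0 < t0, t0 < 1, 0 < eta &
    forall g, sim_injective g -> (forall l, (l < i)%N -> conical l (s l) g) ->
      close eta g g0 -> forall t, 0 <= t -> t <= t0 -> sim_injective (cone_off i t g)].
Proof.
move=> cg0 ig0 s01.
have [eta eta0 bd] := normal_bound_below cg0 ig0 s01.
(* With tenths, the difference at the apices has norm at least [8 / 10 * eta], and that at the tops
   deviates from it by at most [6 / 10 * eta]. *)
have e10 : 0 < eta / 10 by apply: divr_gt0.
have [d d0 dg] := cont_unif cg0 e10.
have [C C0 CP] := apex_top_dist.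
(* The second bound yields [C * t < d], so that [g0] varies by less than [eta / 10] between apex and
   top. *)
exists (Num.min (1 / 2) (d / C / 2)), (eta / 10); split => //.
- by rewrite lt_min !divr_gt0.
- by rewrite gt_min; apply/orP; left; lra.
move=> g ig cg gg0 t t0; rewrite le_min => /andP[th td].
have t1 : t < 1 by lra.
have tC : C * t < d.
  by move: td; rewrite ler_pdivlMr // ler_pdivlMr //; lra.
move=> x y xy xNy; have [Nx Ny] := simN RS xy.
have [nx|nx] := boolP (near_apex i t x); last first.
  by rewrite /cone_off -(sim_near i t xy) (negPf nx) ig.
have [PE|/eqP PN] := eqVneq (P i x) (P i y).
  have [k0 tN] := top_neq t0 t1 xy nx PE xNy.
  rewrite /cone_off -(sim_near i t xy) nx /interp PE -(sim_slope i t xy).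
  rewrite (inj_eq (addrI _)) (inj_eq (scalerI _)) ?gt_eqF //.
  by apply: ig => //; exact: sim_top.
(* Pushing along rays of a lower level [l] must not leave the case at hand: at level [i] it rescales
   both apices from the common apex of level [l], hence keeps them different. *)
pose Inv x y := [/\ x != y, near_apex i t x & P i x <> P i y].
apply: (@conical_neq s i Inv) => //.
- by move=> l li; have /andP[/ltW -> ->] := s01 l li.
- move=> l li; have /andP[/ltW ? ?] := s01 l li.
  by apply: conical_cone_off_lt => //; exact: cg.
- by move=> ? ? [].
- move=> {x y xy xNy Nx Ny nx PN} l x y li xy [xNy nx PN] nl PlE k0.
  have [Nx Ny] := simN RS xy.
  have /andP[/ltW s0 s1] := s01 l li.
  have [_ tN] := top_neq s0 s1 xy nl PlE xNy.
  have gx := near_gap t0 t1 Nx nx.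
  split; [exact: tN|by rewrite near_top|].
  have [_ _ _ _ -> //] := top_in s0 s1 Nx nl.
  have nly : near_apex l (s l) y by rewrite -(sim_near l _ xy).
  have [_ _ _ _ -> //] := top_in s0 s1 Ny nly.
  - rewrite -(sim_slope l _ xy) PlE => /addrI /scalerI.
    rewrite invr_neq0 ?gt_eqF // => /(_ isT) /addIr; exact: PN.
  - by rewrite -!(lev_sim RS _ xy).
  - by rewrite -(sim_slope l _ xy).
move=> {x y xy xNy Nx Ny nx PN} x y xy [xNy nx PN] nrm; have [Nx Ny] := simN RS xy.
have ny : near_apex i t y by rewrite -(sim_near i t xy).
have [NPx alx agx Plx] := apex_in t0 t1 Nx nx.
have [NPy aly agy Ply] := apex_in t0 t1 Ny ny.
have [Ntx _ _ _ _] := top_in t0 t1 Nx nx.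
have [Nty _ _ _ _] := top_in t0 t1 Ny ny.
(* The pair of apices is normal as well: its levels beyond [i] vanish, and its levels and apices
   below [i] are those of [x] and [y]. *)
have low : eta <= `|g0 (P i x) - g0 (P i y)|.
  apply: bd; first exact: sim_apex t0 t1 xy nx.
  - by apply/eqP.
  - by move=> j; apply: contraTT; rewrite -ltnNge => ij; rewrite agx // ltxx.
  move=> l li; rewrite /near_apex !alx ?(ltnW li) // -/(near_apex l (s l) x) => nl.
  have /andP[/ltW s0 s1] := s01 l li; have gl := near_gap s0 s1 Nx nl.
  rewrite Plx ?(ltnW li) // Ply ?(ltnW li) //; first exact: nrm.
  by rewrite -!(lev_sim RS _ xy).
have far z : N z -> near_apex i t z -> `|g0 (P i z) - g0 (top i t z)| < eta / 10.
  move=> Nz nz; have [NP _ _ _] := apex_in t0 t1 Nz nz.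
  have [Nt _ _ _ _] := top_in t0 t1 Nz nz.
  apply: dg => //; apply: le_lt_trans tC.
  have [_ _ h] := CP i t z t0 t1 Nz nz; apply: le_trans h _.
  rewrite ler_pM2l // -[leRHS]mulr1 ler_wpM2l //; exact: lev_le1.
have dif (p q : V) (e : R) : N p -> N q -> `|g0 p - g0 q| <= e ->
    `|g p - g q| <= e + eta / 10 + eta / 10.
  move=> Np Nq pq; have := ler_distD (g0 p) (g p) (g q).
  have := ler_distD (g0 q) (g0 p) (g q).
  have := gg0 p Np; have := gg0 q Nq; rewrite (distrC (g q)); lra.
rewrite /cone_off nx ny /interp -(sim_slope i t xy).
rewrite -subr_eq0 opprD addrACA -!scalerBr.
apply: conv_neq0.
- exact: slope_ge0 nx.
- exact/ltW/(slope_lt1 t0 t1 Nx nx).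
have := dif _ _ _ NPx Ntx (ltW (far x Nx nx)).
have := dif _ _ _ NPy Nty (ltW (far y Ny ny)).
set p := g (P i x); set q := g (P i y).
set p' := g (top i t x); set q' := g (top i t y) => h1 h2.
have := ler_normB (p - p') (q - q').
rewrite (_ : p - p' - (q - q') = p - q - (p' - q')); last first.
  by rewrite !opprB addrACA [RHS]addrACA [- p' + _]addrC.
have := ler_distD p (g0 (P i x)) (g0 (P i y)).
have := ler_distD q p (g0 (P i y)).
have := gg0 _ NPx; have := gg0 _ NPy; rewrite (distrC (g (P i x)) (g0 (P i x))) -/p -/q.
by move: low; lra.
Qed.

(** * Continuity of coning in the scale and in the point *)

Lemma cone_off0 i g x : N x -> cone_off i 0 g x = g x.
Proof.
by move=> Nx; rewrite /cone_off /near_apex mul0r ltNge (lev_ge0 RS i.+1 Nx).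
Qed.

Lemma cone_off_fix i t g x : 0 <= t -> t < 1 -> N x -> a i.+1 x = 0 -> cone_off i t g x = g x.
Proof.
move=> t0 t1 Nx a0; rewrite /cone_off; case: ifP => // nx.
have k0 : slope i t x = 0 by rewrite /slope a0 mul0r.
by rewrite /interp k0 scale0r addr0 subr0 scale1r (slope0_apex t0 t1 Nx nx).
Qed.

(** Both values interpolate along the same ray from the same apex. The weights differ by at most
    [(t' - t) / t'], the outer points by at most [C * (t' - t)]. *)
Lemma cone_off_scale_diff i g (M e d C t t' : R) x :
  (forall x, N x -> `|g x| <= M) ->
  (forall x y, N x -> N y -> `|x - y| < d -> `|g x - g y| < e) ->
  (forall i x, N x -> a i.+1 x < a i x -> `|x - P i x| <= C * a i.+1 x) ->
  0 < C -> 0 < e -> 0 <= t -> t <= t' -> 0 < t' -> t' < 1 -> C * (t' - t) < d -> N x ->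
  `|cone_off i t g x - cone_off i t' g x| <= (t' - t) / t' * (M + M) + e.
Proof.
move=> bM dg CP C0 e0 t0 tt' t'0 t'1 Cd Nx.
have t1 : t < 1 by exact: le_lt_trans t'1.
have M0 : 0 <= M by exact: le_trans (bM x Nx).
have r0 : 0 <= (t' - t) / t' * (M + M) + e.
  by rewrite addr_ge0 ?(ltW e0) // mulr_ge0 ?addr_ge0 // divr_ge0 ?subr_ge0 // ltW.
have [nx'|nx'] := boolP (near_apex i t' x); last first.
  have nx : ~~ near_apex i t x.
    move: nx'; rewrite /near_apex -!leNgt => h; apply: le_trans h.
    by rewrite ler_wpM2r // (lev_ge0 RS i Nx).
  by rewrite /cone_off (negPf nx) (negPf nx') subrr normr0.
have A0 := near_lev_gt0 (ltW t'0) t'1 Nx nx'.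
have A1 := lev_le1 i Nx.
have gx := near_gap (ltW t'0) t'1 Nx nx'.
have := lev_ge0 RS i.+1 Nx; rewrite le_eqVlt => /predU1P[B0|B0].
  by rewrite !cone_off_fix // ?subrr ?normr0 // ltW.
have [NP _ _ _] := apex_in (ltW t'0) t'1 Nx nx'.
have [Nt' _ _ _ _] := top_in (ltW t'0) t'1 Nx nx'.
(* [q] is the slope for [t] inside the smaller zone and 1 outside it, where [ray i 1 x = x]; so one
   formula covers both cases. *)
have [q [q0 q1 qk qkV [DE Nq]]] : exists q : R, [/\ 0 < q, q <= 1,
    0 <= q - slope i t' x <= (t' - t) / t',
    0 <= (slope i t' x)^-1 - q^-1 <= (t' - t) / a i.+1 x &
    cone_off i t g x = (1 - q) *: g (P i x) + q *: g (ray i q^-1 x) /\ N (ray i q^-1 x)].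
  have [nx|nx] := boolP (near_apex i t x).
    have tp := near_s_gt0 t0 t1 Nx nx.
    exists (slope i t x); split.
    - by rewrite divr_gt0 // mulr_gt0.
    - exact/ltW/(slope_lt1 t0 t1 Nx nx).
    - have -> : slope i t x - slope i t' x = slope i t x * ((t' - t) / t').
        by rewrite /slope; field; rewrite !gt_eqF.
      have tt0 : 0 <= (t' - t) / t' by rewrite divr_ge0 ?subr_ge0 ?(ltW t'0).
      rewrite ler_piMl ?(ltW (slope_lt1 t0 t1 Nx nx)) // andbT.
      by apply: mulr_ge0 => //; exact: slope_ge0 nx.
    - have -> : (slope i t' x)^-1 - (slope i t x)^-1 = a i x * ((t' - t) / a i.+1 x).
        by rewrite /slope; field; rewrite !gt_eqF.
      rewrite mulr_ge0 ?divr_ge0 ?subr_ge0 ?(ltW B0) ?(ltW A0) //=.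
      by rewrite ler_piMl ?divr_ge0 ?subr_ge0 ?(ltW B0).
    - by rewrite /cone_off nx; split => //; have [] := top_in t0 t1 Nx nx.
  exists 1; split => //.
  - rewrite subr_ge0 (ltW (slope_lt1 (ltW t'0) t'1 Nx nx')) /=.
    rewrite /slope -subr_ge0.
    have -> : (t' - t) / t' - (1 - a i.+1 x / (t' * a i x)) =
        (a i.+1 x - t * a i x) / (t' * a i x) by field; rewrite !gt_eqF.
    by rewrite divr_ge0 ?mulr_ge0 ?(ltW A0) ?(ltW t'0) // subr_ge0 leNgt.
  - rewrite invr1 /slope invf_div.
    have -> : t' * a i x / a i.+1 x - 1 = (t' * a i x - a i.+1 x) / a i.+1 x.
      by field; rewrite gt_eqF.
    rewrite divr_ge0 ?(ltW B0) //= ?subr_ge0 ?(ltW nx') // ler_pM2r ?invr_gt0 //.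
    move: nx; rewrite /near_apex -leNgt => h.
    apply: (@le_trans _ _ ((t' - t) * a i x)); first by rewrite mulrBl; lra.
    by rewrite -[leRHS]mulr1 ler_wpM2l // subr_ge0.
  - by rewrite invr1 ray1 subrr scale0r add0r scale1r /cone_off (negPf nx).
have k'0 : 0 <= slope i t' x by exact: slope_ge0 (ltW t'0) t'1 Nx nx'.
have k'1 := slope_lt1 (ltW t'0) t'1 Nx nx'.
rewrite DE /cone_off nx' /interp.
move: qk qkV => /andP[qk0 qk1] /andP[qv0 qv1].
set k := slope i t' x in k'0 k'1 qk0 qk1 qv0 qv1 *.
have -> : (1 - q) *: g (P i x) + q *: g (ray i q^-1 x) -
    ((1 - k) *: g (P i x) + k *: g (top i t' x)) =
  (q - k) *: (g (ray i q^-1 x) - g (P i x)) + k *: (g (ray i q^-1 x) - g (top i t' x)).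
  set u := g (P i x); set v := g (ray _ _ _); set w := g (top _ _ _).
  rewrite !scalerBr opprD addrACA -scalerBl addrA.
  rewrite [1 - q - _](_ : _ = - (q - k)); last by ring.
  rewrite scaleNr [in RHS](addrC ((q - k) *: v)) -[RHS]addrA [X in _ = _ + X]addrA.
  by rewrite -scalerDl subrK addrA.
apply: (le_trans (ler_normD _ _)); apply: lerD; rewrite normrZ ger0_norm //.
  apply: ler_pM => //; apply: le_trans (ler_normB _ _) _.
  by apply: lerD; exact: bM.
rewrite -[leRHS]mul1r; apply: ler_pM => //; first exact: ltW.
apply/ltW/dg => //; apply: le_lt_trans Cd.
have -> : ray i q^-1 x - top i t' x = - ((k^-1 - q^-1) *: (x - P i x)).
  by rewrite /top /ray -/k opprD addrACA subrr add0r -scalerBl -scaleNr opprB.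
rewrite normrN normrZ ger0_norm //.
apply: (@le_trans _ _ ((t' - t) / a i.+1 x * (C * a i.+1 x))).
  by apply: ler_pM => //; exact: CP.
by rewrite mulrCA divfK // gt_eqF.
Qed.

(** The bound of [cone_off_scale_diff] is useless when the smaller scale is 0, since the quotient is
    then 1; at [t = 0] the estimate [cone_off_small] replaces it. *)
Lemma cone_off_cont_scale i g t1 : t1 < 1 -> cont_on g ->
  forall e : R, 0 < e -> forall t, 0 <= t -> t <= t1 -> exists2 d : R, 0 < d &
    forall t', 0 <= t' -> t' <= t1 -> `|t' - t| < d ->
      close e (cone_off i t' g) (cone_off i t g).
Proof.
move=> t11 cg e e0 t; rewrite le_eqVlt => /predU1P[<- _|t0 tt1].
  have [d d0 dg] := cone_off_small cg e0; exists d => // t' t'0 t't1.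
  rewrite subr0 ger0_norm // => t'd x Nx; rewrite cone_off0 //.
  apply: dg => //; first exact: le_lt_trans t11.
  by apply: le_lt_trans t'd; rewrite ler_piMr // lev_le1.
have [M M0 bM] := cont_bounded cg.
have [d d0 dg] := cont_unif cg (divr_gt0 e0 (ltr0n _ 2)).
have [C C0 CP] := apex_dist RS.
(* For a larger scale [s' >= t] the second bound makes [(s' - s) / s' * (M + M)] at most [e / 2];
   the first makes the outer points [d]-close. *)
exists (Num.min (d / C) (t * e / (4 * M))).
  by rewrite lt_min !divr_gt0 ?mulr_gt0.
have main (s s' : R) x : N x -> 0 <= s -> s <= s' -> t <= s' -> s' <= t1 -> `|s' - s| < d / C ->
    `|s' - s| < t * e / (4 * M) -> `|cone_off i s g x - cone_off i s' g x| <= e.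
  move=> Nx s0 ss' ts' s't1; rewrite ger0_norm ?subr_ge0 //.
  rewrite ltr_pdivlMr // ltr_pdivlMr ?mulr_gt0 // => h1 h2.
  have s'0 : 0 < s' by exact: lt_le_trans ts'.
  have := @cone_off_scale_diff i g M (e / 2) d C s s' x bM dg CP C0 _ s0 ss' s'0 _ _ Nx.
  rewrite (mulrC C) h1 divr_gt0 // (le_lt_trans s't1) // => /(_ isT isT isT) /le_trans; apply.
  rewrite mulrAC -lerBrDr ler_pdivrMr //.
  have : t * e <= s' * e by rewrite ler_pM2r.
  move: h2; set z := t * e; set z' := s' * e; rewrite (_ : (e - e / 2) * s' = z' / 2); last first.
    by rewrite /z'; field.
  rewrite (_ : (s' - s) * (4 * M) = 2 * ((s' - s) * (M + M))); last by ring.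
  lra.
move=> t' t'0 t't1; rewrite lt_min => /andP[h1 h2] x Nx.
have [tt'|/ltW t't] := leP t t'; last by apply: main => //; rewrite distrC.
by rewrite distrC; apply: main => //; exact: ltW.
Qed.

(** If [t * a i x] is small, coning hardly changes [g] near [x], whether or not the apices converge.
    If [t * a i x < a i.+1 x], it does not change [g] near [x]. Otherwise [a i.+1 x < a i x], so
    slope and apex are continuous at [x]; on the boundary of the zone the slope is 1 and the
    interpolation returns [g x]. *)
Lemma cone_off_cont i g t : 0 <= t -> t < 1 -> cont_on g -> cont_on (cone_off i t g).
Proof.
move=> t0 t1 cg; apply/cont_onP => x Nx e e0.
have e2 : 0 < e / 3 by apply: divr_gt0.
have [dg dg0 ug] := cont_unif cg e2.
have near_g : \forall y \near within N (nbhs x), `|g y - g x| < e / 3.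
  apply/nbhs_ballP; exists dg => // y; rewrite -ball_normE /= distrC => yx Ny.
  exact: ug.
have aC l : a l y @[y --> within N (nbhs x)] --> a l x by exact: (lev_cont RS).
have [d2 d20 sm] := cone_off_small cg e2.
suff : \forall y \near within N (nbhs x), `|cone_off i t g y - cone_off i t g x| < e.
  move=> /nbhs_ballP[d /= d0 dN]; exists d => // y Ny yx.
  by apply: dN => //; rewrite -ball_normE /= distrC.
have wN : \forall y \near within N (nbhs x), N y by exact: withinT.
have [small|big] := ltP (t * a i x) d2.
  have : \forall y \near within N (nbhs x), t * a i y < d2.
    have h : t * a i y @[y --> within N (nbhs x)] --> t * a i x.
      by apply: cvgM; [exact: cvg_cst|exact: aC].
    exact: (cvgr_lt _ h).
  move: (near_g) (wN); apply: filterS3 => y gy Ny sy.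
  have := sm i t y t0 t1 Ny sy; have := sm i t x t0 t1 Nx small.
  have := ler_distD (g y) (cone_off i t g y) (cone_off i t g x).
  have := ler_distD (g x) (g y) (cone_off i t g x).
  rewrite (distrC (g x) (cone_off i t g x)); lra.
have tA : 0 < t * a i x by exact: lt_le_trans big.
have tp : 0 < t by rewrite lt_neqAle t0 andbT; apply: contraTneq tA => <-; rewrite mul0r ltxx.
have A0 : 0 < a i x by rewrite -(pmulr_rgt0 _ tp).
have tAc : t * a i y @[y --> within N (nbhs x)] --> t * a i x.
  by apply: cvgM; [exact: cvg_cst|exact: aC].
have kc : slope i t y @[y --> within N (nbhs x)] --> slope i t x.
  by apply: cvgM; [exact: aC|apply: cvgV => //; rewrite gt_eqF].
have [far|nfar] := ltP (t * a i x) (a i.+1 x).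
  have h : a i.+1 y - t * a i y @[y --> within N (nbhs x)] --> a i.+1 x - t * a i x.
    by apply: cvgB => //; exact: aC.
  have : \forall y \near within N (nbhs x), 0 < a i.+1 y - t * a i y.
    by apply: (cvgr_gt _ h); rewrite subr_gt0.
  move: (near_g); apply: filterS2 => y gy; rewrite subr_gt0 => hy.
  have fz z : t * a i z < a i.+1 z -> near_apex i t z = false.
    by move=> hz; apply/negbTE; rewrite -leNgt ltW.
  rewrite /cone_off (fz x far) (fz y hy); lra.
have gx : a i.+1 x < a i x.
  apply: le_lt_trans nfar _; rewrite -[ltRHS]mul1r ltr_pM2r //.
have Pc := apex_cont RS Nx gx.
have k1 : slope i t x <= 1 by rewrite /slope ler_pdivrMr // mul1r.
have k0 : 0 <= slope i t x by rewrite divr_ge0 ?(ltW tA) // (lev_ge0 RS).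
have [NP _ _ _ _] := ray_in RS Nx gx (lexx 0) (etrans (congr1 (fun z => z < a i x) (mul0r _)) A0).
rewrite ray0 in NP.
have limE : cone_off i t g x = interp i t g x.
  rewrite /cone_off; case: ifP => // /negbT; rewrite /near_apex -leNgt => nn.
  have kk : slope i t x = 1.
    by rewrite /slope (@le_anti _ _ (a i.+1 x) (t * a i x)) ?nfar // divff ?gt_eqF.
  by rewrite /interp kk subrr scale0r add0r scale1r /top kk invr1 ray1.
have Nt : N (top i t x).
  have [/= nx|nn] := boolP (near_apex i t x).
    by have [] := top_in t0 t1 Nx nx.
  have kk : slope i t x = 1.
    rewrite /slope (@le_anti _ _ (a i.+1 x) (t * a i x)) ?nfar ?divff ?gt_eqF //.
    by move: nn; rewrite /near_apex -leNgt.
  by rewrite /top kk invr1 ray1.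
have gPc : \forall y \near within N (nbhs x), near_apex i t y -> `|g (P i y) - g (P i x)| < e / 3.
  have : \forall y \near within N (nbhs x), `|P i x - P i y| < dg.
    by move/cvgrPdist_lt : Pc; exact.
  move: (wN); apply: filterS2 => y Ny hy ny.
  have [NPy _ _ _] := apex_in t0 t1 Ny ny.
  by apply: ug => //; rewrite distrC.
have [M M0 bM] := cont_bounded cg.
have kcl (r : R) : 0 < r -> \forall y \near within N (nbhs x), `|slope i t x - slope i t y| < r.
  by move=> r0; move/cvgrPdist_lt : kc; exact.
(* At slope 0 the inverse slope is discontinuous and the tops need not converge, but their weight
   tends to 0 and [g] is bounded. *)
have key : \forall y \near within N (nbhs x), near_apex i t y ->
    `|slope i t y *: (g (top i t y) - g (top i t x))| < e / 3.
  have [kz|knz] := eqVneq (slope i t x) 0.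
    have := kcl (e / 3 / (M + M)) (divr_gt0 e2 (addr_gt0 M0 M0)).
    move: (wN); apply: filterS2 => y Ny; rewrite kz sub0r normrN => ky ny.
    rewrite normrZ; apply: (@le_lt_trans _ _ (`|slope i t y| * (M + M))).
      rewrite ler_wpM2l //; apply: le_trans (ler_normB _ _) _.
      by rewrite lerD // bM //; have [] := top_in t0 t1 Ny ny.
    by rewrite -ltr_pdivlMr // addr_gt0.
  have tc : top i t y @[y --> within N (nbhs x)] --> top i t x.
    apply: cvgD => //; apply: cvgZ; first exact: cvgV.
    by apply: cvgB => //; exact: cvg_within.
  have : \forall y \near within N (nbhs x), `|top i t x - top i t y| < dg.
    by move/cvgrPdist_lt : tc; exact.
  move: (wN); apply: filterS2 => y Ny hy ny.
  have [Nty _ _ _ _] := top_in t0 t1 Ny ny.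
  rewrite normrZ ger0_norm ?(slope_ge0 t0 t1 Ny ny) //.
  apply: le_lt_trans (ug _ _ Nty Nt _); last by rewrite distrC.
  by rewrite ler_piMl // ltW // slope_lt1.
have kd := kcl (e / 3 / (M + M)) (divr_gt0 e2 (addr_gt0 M0 M0)).
have stay : \forall y \near within N (nbhs x), near_apex i t x -> near_apex i t y.
  have [/= nx|_] := boolP (near_apex i t x); last exact: nearW.
  have h : t * a i y - a i.+1 y @[y --> within N (nbhs x)] --> t * a i x - a i.+1 x.
    by apply: cvgB => //; exact: aC.
  have : \forall y \near within N (nbhs x), 0 < t * a i y - a i.+1 y.
    by apply: (cvgr_gt _ h); rewrite subr_gt0.
  by apply: filterS => y; rewrite subr_gt0.
near=> y; have Ny : N y by near: y.
have [/= ny|nny] := boolP (near_apex i t y); last first.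
  have nx : ~~ near_apex i t x.
    by move: nny; apply: contra; near: y; exact: stay.
  rewrite /cone_off (negPf nx) (negPf nny); apply: (@lt_trans _ _ (e / 3)); last lra.
  by near: y.
rewrite limE /cone_off ny /interp.
have ky0 := slope_ge0 t0 t1 Ny ny; have ky1 := slope_lt1 t0 t1 Ny ny.
have gP : `|g (P i y) - g (P i x)| < e / 3 by move: ny; near: y.
have h2 : `|slope i t y *: (g (top i t y) - g (top i t x))| < e / 3 by move: ny; near: y.
have sd : `|slope i t x - slope i t y| < e / 3 / (M + M) by near: y.
set u := g (P i y) in gP *; set v := g (top i t y) in h2 *.
set u0 := g (P i x) in gP *; set v0 := g (top i t x) in h2 *.
rewrite convB.
have h1 : `|(1 - slope i t y) *: (u - u0)| < e / 3.
  rewrite normrZ ger0_norm ?subr_ge0 ?(ltW ky1) //.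
  apply: (@le_lt_trans _ _ `|u - u0|); last exact: gP.
  by rewrite ler_piMl // lerBlDr lerDl.
have h3 : `|(slope i t x - slope i t y) *: (u0 - v0)| < e / 3.
  rewrite normrZ; apply: (@le_lt_trans _ _ (`|slope i t x - slope i t y| * (M + M))).
    by rewrite ler_wpM2l //; apply: le_trans (ler_normB _ _) _; rewrite lerD // bM.
  by rewrite -ltr_pdivlMr ?addr_gt0.
apply: le_lt_trans (ler_normD _ _) _.
have := ler_normD ((1 - slope i t y) *: (u - u0)) (slope i t y *: (v - v0)).
lra.
Unshelve. all: by end_near.
Qed.

(** * Contraction of a neighbourhood, by induction on the levels *)

Definition good i (s : nat -> R) g :=
  [/\ cont_on g, sim_injective g & forall l, (l < i)%N -> conical l (s l) g].

Lemma conical_line l s g h (t : R) : conical l s g -> conical l s h ->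
  conical l s (fun x => (1 - t) *: g x + t *: h x).
Proof.
move=> cg ch x Nx nx; rewrite /interp (cg x Nx nx) (ch x Nx nx) /interp.
rewrite !scalerDr !scalerA addrACA; congr (_ + _ + (_ + _)); congr (_ *: _); ring.
Qed.

(** Maps conical at the same scales form a linear space, so the segment from [g] to [g0] consists of
    conical maps and [conical_neq] leaves only normal pairs. For these [g0] has the lower bound
    [eta], and the differences for [g] and [g0] are within [eta / 2] of each other. *)
Lemma contraction_base (s : nat -> R) g0 : (forall l, (l < L)%N -> 0 < s l < 1) ->
  good L s g0 -> forall e : R, 0 < e -> exists2 d : R, 0 < d & d <= e /\
    forall g t, good L s g -> close d g g0 -> 0 <= t <= 1 ->
      sim_injective (fun x => (1 - t) *: g x + t *: g0 x).
Proof.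
move=> s01 [cg0 ig0 kg0] e e0.
have [eta eta0 bd] := normal_bound_below cg0 ig0 s01.
exists (Num.min e (eta / 4)); first by rewrite lt_min e0 divr_gt0.
split; first by rewrite ge_min lexx.
move=> g t [cg ig kg] gg0 /andP[t0 t1] x y xy xNy.
have {}gg0 : close (eta / 4) g g0.
  by move=> z Nz; apply: le_trans (gg0 z Nz) _; rewrite ge_min lexx orbT.
apply: (@conical_neq s L (fun x y => x != y) (fun x => (1 - t) *: g x + t *: g0 x)) => //.
- by move=> l li; have /andP[/ltW -> ->] := s01 l li.
- by move=> l li; apply: conical_line; [exact: kg|exact: kg0].
- move=> {x y xy xNy} l x y li xy xNy nx PE k0.
  have /andP[/ltW s0 s1] := s01 l li.
  by have [] := top_neq s0 s1 xy nx PE xNy.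
move=> {x y xy xNy} x y xy xNy nrm; have [Nx Ny] := simN RS xy.
have low : eta <= `|g0 x - g0 y|.
  apply: bd => // j; rewrite leqNgt; apply: contraTN => /ltnW Lj.
  by rewrite (levL RS) // ltxx.
rewrite -subr_eq0 opprD addrACA -!scalerBr addrC.
rewrite -[X in X *: _ + _](_ : 1 - (1 - t) = t); last by ring.
apply: conv_neq0; rewrite ?subr_ge0 //; first by rewrite lerBlDr lerDl.
have := gg0 x Nx; have := gg0 y Ny.
have := ler_normB (g0 x - g x) (g0 y - g y).
rewrite (_ : g0 x - g x - (g0 y - g y) = g0 x - g0 y - (g x - g y)); last first.
  by rewrite !opprB addrACA [RHS]addrACA [- g x + _]addrC.
rewrite (distrC (g0 x) (g x)) (distrC (g0 y) (g y)); lra.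
Qed.

(** [k] levels remain to be coned. In its first half the homotopy raises the scale at level [i] from
    0 to [ts]; the second half is the contraction for the coned [g0]. Joint continuity is claimed at
    all continuous maps, good or not, so that it passes through the composition. *)
Lemma contraction k i (s : nat -> R) g0 : (i + k)%N = L ->
  (forall l, (l < i)%N -> 0 < s l < 1) -> good i s g0 ->
  forall e : R, 0 < e -> exists d : R, exists H : R -> (V -> W) -> V -> W,
  [/\ 0 < d,
      forall t g, 0 <= t <= 1 -> cont_on g -> cont_on (H t g),
      forall g x, N x -> H 0 g x = g x,
      forall t g, 0 <= t <= 1 -> cont_on g -> forall r : R, 0 < r ->
        exists2 q : R, 0 < q & forall t' g', 0 <= t' <= 1 -> cont_on g' ->
          `|t' - t| < q -> close q g' g -> close r (H t' g') (H t g) &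
      forall g, good i s g -> close d g g0 ->
        (forall t, 0 <= t <= 1 -> sim_injective (H t g) /\ close e (H t g) g0) /\
        (forall x, N x -> H 1 g x = H 1 g0 x)].
Proof.
elim: k i s g0 => [|k IH] i s g0.
  rewrite addn0 => -> s01 gg0 e e0; have [cg0 ig0 kg0] := gg0.
  have [d d0 [de inj]] := contraction_base s01 gg0 e0.
  exists d, (fun t g x => (1 - t) *: g x + t *: g0 x); split => //.
  - move=> t g _ /subspace_continuousP cg; apply/subspace_continuousP => x Nx.
    move/subspace_continuousP : cg0 => cg0.
    by apply: cvgD; apply: cvgZ; try (exact: cvg_cst); [exact: cg|exact: cg0].
  - by move=> g x _; rewrite subr0 scale1r scale0r addr0.
  - move=> t g /andP[t0 t1] cg r r0.
    have [M M0 bM] := cont_bounded cg; have [M' M'0 bM'] := cont_bounded cg0.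
    exists (Num.min (r / 3) (r / 3 / (M + M'))).
      by rewrite lt_min !divr_gt0 // addr_gt0.
    move=> t' g' /andP[t'0 t'1] cg'; rewrite lt_min => /andP[_ tt'] g'g x Nx.
    rewrite convB subrr scaler0 addr0.
    apply: (le_trans (ler_normD _ _)); rewrite !normrZ (distrC t) (distrC (g x)).
    have h1 : `|1 - t'| * `|g' x - g x| <= r / 3.
      rewrite ger0_norm ?subr_ge0 // -[leRHS]mul1r ler_pM ?subr_ge0 //.
        by rewrite lerBlDr lerDl.
      by apply: le_trans (g'g x Nx) _; rewrite ge_min lexx.
    have h2 : `|t' - t| * `|g0 x - g x| <= r / 3.
      apply: (@le_trans _ _ (`|t' - t| * (M + M'))).
        rewrite ler_wpM2l //; apply: le_trans (ler_normB _ _) _.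
        by rewrite addrC lerD // ?bM ?bM'.
      by rewrite -ler_pdivlMr ?addr_gt0 // ltW.
    lra.
  - move=> g gg cl; split; last first.
      by move=> x _; rewrite subrr !scale0r !add0r.
    move=> t t01; split; first exact: inj.
    move=> x Nx; have /andP[t0 t1] := t01.
    have -> : (1 - t) *: g x + t *: g0 x - g0 x = (1 - t) *: (g x - g0 x).
      by rewrite scalerBr -addrA -[X in _ + (_ - X)]scale1r -scalerBl -scaleNr opprB.
    rewrite normrZ ger0_norm ?subr_ge0 // -[leRHS]mul1r ler_pM ?subr_ge0 //.
      by rewrite lerBlDr lerDl.
    exact: le_trans (cl x Nx) de.
move=> ikL s01 gg0 e e0; have [cg0 ig0 kg0] := gg0.
have [t0 [eta [t00 t01 eta0 stage]]] := stage_injective cg0 ig0 s01.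
have e2 : 0 < e / 2 by apply: divr_gt0.
have [dsm dsm0 sm] := cone_off_small cg0 e2.
(* Up to [t0] coning keeps every good [g] near [g0] separating; below [dsm] it moves [g0] by at most
   [e / 2]. *)
pose ts := Num.min t0 (dsm / 2).
have ts0 : 0 < ts by rewrite lt_min t00 divr_gt0.
have tst0 : ts <= t0 by rewrite ge_min lexx.
have ts1 : ts < 1 by exact: le_lt_trans t01.
have tsd : ts < dsm.
  have : ts <= dsm / 2 by rewrite ge_min lexx orbT.
  lra.
pose s' l := if l == i then ts else s l.
have s'01 l : (l < i.+1)%N -> 0 < s' l < 1.
  rewrite /s' ltnS leq_eqVlt; case: eqP => [_ _|_ /= li]; first by rewrite ts0.
  exact: s01.
have good' g : good i s g -> close eta g g0 -> good i.+1 s' (cone_off i ts g).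
  move=> [cg ig kg] cl; split.
  - by apply: cone_off_cont => //; exact: ltW.
  - by apply: stage => //; exact: ltW.
  - move=> l; rewrite /s' ltnS leq_eqVlt; case: eqP => [-> _|_ /= li].
      by apply: conical_cone_off => //; exact: ltW.
    have /andP[/ltW sl0 sl1] := s01 l li.
    by apply: conical_cone_off_lt => //; [exact: ltW|exact: kg].
have cl0 : close eta g0 g0 by move=> x Nx; rewrite subrr normr0 ltW.
have [d' [H' [d'0 H'c H'0 H'j H'g]]] :=
  IH i.+1 s' (cone_off i ts g0) (etrans (addSnnS i k) ikL) s'01 (good' g0 gg0 cl0) _ e2.
(* The two halves are run by clamped parameters, both Lipschitz with constant 2, so continuity needs
   no gluing at [t = 1 / 2]. *)
pose u1 (t : R) := Num.min 1 (2 * t); pose u2 (t : R) := Num.max 0 (2 * t - 1).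
have u1P t : 0 <= t <= 1 -> 0 <= u1 t <= 1.
  by move=> /andP[? ?]; rewrite /u1 le_min ge_min lexx; lra.
have u2P t : 0 <= t <= 1 -> 0 <= u2 t <= 1.
  by move=> /andP[? ?]; rewrite /u2 le_max ge_max lexx ler01 /=; lra.
have u1L t t' : `|u1 t' - u1 t| <= 2 * `|t' - t|.
  by rewrite -[2 in leRHS]gtr0_norm // -normrM mulrBr; exact: ler_dist_min1.
have u2L t t' : `|u2 t' - u2 t| <= 2 * `|t' - t|.
  have -> : 2 * `|t' - t| = `|(2 * t' - 1) - (2 * t - 1)|.
    by rewrite opprB addrA subrK -mulrBr normrM gtr0_norm.
  exact: ler_dist_max0.
have tuP t : 0 <= t <= 1 -> 0 <= ts * u1 t <= ts.
  move=> /u1P/andP[? ?]; rewrite mulr_ge0 ?(ltW ts0) //=.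
  by rewrite ler_piMr // ltW.
exists (Num.min eta (Num.min d' (e / 2))), (fun t g => H' (u2 t) (cone_off i (ts * u1 t) g)).
split.
- by rewrite !lt_min eta0 d'0.
- move=> t g t01' cg; apply: H'c; first exact: u2P.
  have /andP[? h] := tuP t t01'; apply: cone_off_cont => //; exact: le_lt_trans ts1.
- move=> g x Nx; have -> : u2 0 = 0 by rewrite /u2; case: leP => //; lra.
  have -> : u1 0 = 0 by rewrite /u1; case: leP => //; lra.
  by rewrite mulr0 H'0 // cone_off0.
- move=> t g tt cg r r0; have /andP[v0 v1] := tuP t tt.
  have vv : ts * u1 t < 1 by exact: le_lt_trans ts1.
  have [q' q'0 hq'] := H'j (u2 t) _ (u2P t tt) (cone_off_cont (i := i) v0 vv cg) r r0.
  have q'2 : 0 < q' / 2 by apply: divr_gt0.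
  have [q2 q20 hq2] := cone_off_cont_scale i ts1 cg q'2 v0 v1.
  (* The halves absorb the Lipschitz constant 2 of [u2] and [u1]; [q' / 2] is also the share of
     [g' - g] in the triangle inequality below. *)
  exists (Num.min (q' / 2) (q2 / 2)); first by rewrite lt_min !divr_gt0.
  move=> t' g' tt' cg'; rewrite lt_min => /andP[h1 h2] cl.
  have /andP[v'0 v'1] := tuP t' tt'.
  have vv' : ts * u1 t' < 1 by exact: le_lt_trans ts1.
  apply: hq'; [exact: u2P|exact: cone_off_cont| |].
    by apply: le_lt_trans (u2L t t') _; lra.
  move=> x Nx; apply: le_trans (ler_distD (cone_off i (ts * u1 t') g x) _ _) _.
  have -> : q' = q' / 2 + q' / 2 by lra.
  apply: lerD.
    have cl2 : close (q' / 2) g' g.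
      by move=> z Nz; apply: le_trans (cl z Nz) _; rewrite ge_min lexx.
    exact: (@cone_off_close i _ g' g _ v'0 vv' cl2 x Nx).
  apply: (hq2 _ v'0 v'1) => //.
  rewrite -mulrBr normrM (gtr0_norm ts0).
  apply: (@le_lt_trans _ _ (`|u1 t' - u1 t|)); first by rewrite ler_piMl // ltW.
  by apply: le_lt_trans (u1L t t') _; lra.
- move=> g gg cl; have [cg ig kg] := gg.
  have cle : close eta g g0.
    by move=> x Nx; apply: le_trans (cl x Nx) _; rewrite ge_min lexx.
  have cld : close d' g g0.
    by move=> x Nx; apply: le_trans (cl x Nx) _; rewrite !ge_min lexx orbT.
  have clh : close (e / 2) g g0.
    by move=> x Nx; apply: le_trans (cl x Nx) _; rewrite !ge_min lexx !orbT.
  have u11 : u1 1 = 1 by rewrite /u1; case: leP => //; lra.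
  have u21 : u2 1 = 1 by rewrite /u2; case: leP => //; lra.
  have cld' : close d' (cone_off i ts g) (cone_off i ts g0).
    by apply: cone_off_close => //; exact: ltW.
  have [H'1 H'2] := H'g _ (good' g gg cle) cld'.
  have smts v x : 0 <= v -> v <= ts -> N x -> `|cone_off i v g0 x - g0 x| <= e / 2.
    move=> v0 vts Nx; apply: sm => //; first exact: le_lt_trans ts1.
    apply: le_lt_trans tsd; apply: le_trans vts.
    by rewrite ler_piMr // lev_le1.
  split; last first.
    by move=> x Nx; rewrite u11 u21 mulr1 H'2.
  move=> t tt; have /andP[v0 v1] := tuP t tt.
  have vv : ts * u1 t < 1 by exact: le_lt_trans ts1.
  have [th|th] := leP t (1 / 2).
    have -> : u2 t = 0 by rewrite /u2; case: leP => // ?; lra.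
    split.
      move=> x y xy xNy; have [Nx Ny] := simN RS xy; rewrite !H'0 //.
      by apply: stage => //; exact: le_trans tst0.
    move=> x Nx; rewrite H'0 //.
    apply: le_trans (ler_distD (cone_off i (ts * u1 t) g0 x) _ _) _.
    have -> : e = e / 2 + e / 2 by lra.
    by apply: lerD; [exact: (@cone_off_close i _ g g0 _ v0 vv clh x Nx)|exact: smts].
  have -> : u1 t = 1 by rewrite /u1; case: leP => // ?; lra.
  rewrite mulr1; have [h1 h2] := H'1 (u2 t) (u2P t tt); split => // x Nx.
  apply: le_trans (ler_distD (cone_off i ts g0 x) _ _) _.
  have -> : e = e / 2 + e / 2 by lra.
  by apply: lerD; [exact: h2|apply: smts => //; exact: ltW].
Qed.

End ConeOff.

(** * Flag coordinates of sign cells *)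

Section BigContinuous.
Variables (R : realType) (Z : topologicalType).

Lemma continuous_bigsum (W : normedModType R) (I : Type) (s : seq I) (p : pred I)
    (F : I -> Z -> W) :
  (forall i, continuous (F i)) -> continuous (fun z => \sum_(i <- s | p i) F i z).
Proof.
move=> cF; elim: s => [|i s IH].
  under eq_fun do rewrite big_nil; move=> z; exact: cvg_cst.
under eq_fun do rewrite big_cons.
by case: (p i) => // z; apply: cvgD; [exact: cF|exact: IH].
Qed.

Lemma continuous_bigmin (I : Type) (s : seq I) (p : pred I) (G : Z -> R) (F : I -> Z -> R) :
  continuous G -> (forall i, continuous (F i)) ->
  continuous (fun z => \big[Num.min/G z]_(i <- s | p i) F i z).
Proof.
move=> cG cF; elim: s => [|i s IH].
  by under eq_fun do rewrite big_nil.
under eq_fun do rewrite big_cons.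
by case: (p i) => // z; apply: continuous_min; [exact: cF|exact: IH].
Qed.

End BigContinuous.

(** The face order of sign vectors: [y] lies in the closed sign cell of [w]. *)
Definition below (R : realType) (Z : Type) (r : nat) (c : 'I_r -> Z -> R) (y w : Z) :=
  forall q, c q y = 0 \/ 0 < c q y * c q w.

(* The points of X are cut out by the signs of the linear functionals c. *)
Record flag_data (R : realType) (Z : normedModType R) (r : nat)
    (c : 'I_r -> Z -> R) (lam : Z -> R) (X : set Z) : Prop := FlagData {
  fun_lin : forall q k x y, c q (k *: x + y) = k * c q x + c q y;
  lam_lin : forall k x y, lam (k *: x + y) = k * lam x + lam y;
  fun_cont : forall q, continuous (c q);
  lam_cont : continuous lam;
  fun_inj : forall z, (forall q, c q z = 0) -> z = 0;
  lam1 : forall z, X z -> lam z = 1;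
  face_closed : forall z y, X z -> below c y z -> lam y = 1 -> X y;
  face_pos : forall z y, X z -> below c y z -> y != 0 -> 0 < lam y }.

Section Flags.
Variables (R : realType) (Z : normedModType R) (r : nat).
Variables (c : 'I_r -> Z -> R) (lam : Z -> R) (X : set Z).
Hypothesis FD : flag_data c lam X.

Local Notation below := (below c).
Let cL := fun_lin FD.
Let lamL := lam_lin FD.
Let cC := fun_cont FD.
Let lamC := lam_cont FD.
Let cI := fun_inj FD.
Let X_lam := lam1 FD.
Let X_below := face_closed FD.
Let X_pos := face_pos FD.

Lemma c0 q : c q 0 = 0.
Proof. by have := cL q 1 0 0; rewrite scaler0 addr0 mul1r; lra. Qed.
Lemma cZ q k x : c q (k *: x) = k * c q x.
Proof. by rewrite -[k *: x]addr0 cL c0 addr0. Qed.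
Lemma cD q x y : c q (x + y) = c q x + c q y.
Proof. by rewrite -[x]scale1r cL mul1r scale1r. Qed.
Lemma cB q x y : c q (x - y) = c q x - c q y.
Proof. by rewrite cD -scaleN1r cZ mulN1r. Qed.
Lemma lam0 : lam 0 = 0.
Proof. by have := lamL 1 0 0; rewrite scaler0 addr0 mul1r; lra. Qed.
Lemma lamZ k x : lam (k *: x) = k * lam x.
Proof. by rewrite -[k *: x]addr0 lamL lam0 addr0. Qed.
Lemma lamD x y : lam (x + y) = lam x + lam y.
Proof. by rewrite -[x]scale1r lamL mul1r scale1r. Qed.
Lemma lamB x y : lam (x - y) = lam x - lam y.
Proof. by rewrite lamD -scaleN1r lamZ mulN1r. Qed.

(** Signs are pairs of booleans, so that sign vectors form a finite type and sums can run over all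
    of them, whether or not their cells are empty. *)
Definition sgn z := [ffun q => (0 < c q z, c q z < 0)].
Definition supp (e : {ffun 'I_r -> bool * bool}) := [set q | (e q).1 || (e q).2]%SET.
Definition rank e := #|supp e|.
(* A base point of the cell of sign vector e, or 0 if that cell is empty. *)
Definition bpt e := xget 0 [set z | X z /\ sgn z = e].
Definition ratio e z q := c q z / c q (bpt e).
(* The largest k such that z - k *: bpt e is in the closed cell e, if z is in the
   closed cell e; the initial value of the minimum bounds every ratio, hence it
   matters only for an empty support. *)
Definition tau e z :=
  Num.max 0 (\big[Num.min/(\sum_q `|ratio e z q|)]_(q in supp e) ratio e z q).
(* A point of a cell of rank l, which is a cone, is moved in the direction opposite to
   the base point until it leaves the cell; points of lower rank are fixed.  The sign
   vectors of fr 0 z, ..., fr r z form a flag: this gives the coordinates of z in a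
   derived subdivision of X without constructing the subdivision. *)
Definition peel l z := z - \sum_(e | rank e == l) tau e z *: bpt e.
Fixpoint frn k z := if k is k'.+1 then peel (r - k')%N (frn k' z) else z.
Definition fr l z := frn (r - l) z.
(** As [lam] is 1 at the base points, [lam (fr l z)] is the total of the flag coordinates of rank at
    most [l], and the level is what remains beyond rank [l]. *)
Definition lev l z := 1 - lam (fr l z).
Definition bv l z := bpt (sgn (fr l.+1 z)).
(** The coordinates up to rank [l] are kept and all the remaining mass is put on the flag vertex of
    rank [l.+1]. *)
Definition piv l z := fr l z + lev l z *: bv l z.

(** * Sign vectors and closed cells *)

Lemma in_supp_sgn z q : (q \in supp (sgn z)) = (c q z != 0).
Proof. by rewrite inE ffunE /= neq_lt orbC. Qed.

Lemma sgn_eqP y w : sgn y = sgn w <->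
  forall q, (0 < c q y) = (0 < c q w) /\ (c q y < 0) = (c q w < 0).
Proof.
split => [/ffunP h q|h]; first by have := h q; rewrite !ffunE => -[].
by apply/ffunP => q; have [h1 h2] := h q; rewrite !ffunE h1 h2.
Qed.

Lemma sgn_eq_mul y w : sgn y = sgn w -> forall q, c q w != 0 -> 0 < c q y * c q w.
Proof.
move=> /sgn_eqP h q; have [h1 h2] := h q; rewrite neq_lt => /orP[wl|wg].
  by rewrite nmulr_lgt0 // h2.
by rewrite pmulr_lgt0 // h1.
Qed.

Lemma below_refl z : below z z.
Proof.
move=> q; have [->|h] := eqVneq (c q z) 0; first by left.
by right; rewrite -expr2 exprn_even_gt0.
Qed.

Lemma below_sgn y w : sgn y = sgn w -> below y w.
Proof.
move=> h q; have [h0|h0] := eqVneq (c q w) 0; last by right; exact: sgn_eq_mul.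
left; move/sgn_eqP : h => /(_ q)[]; rewrite h0 ltxx => h1 h2.
by apply/eqP; rewrite eq_le !leNgt h1 h2.
Qed.

Lemma below_trans y x z : below x y -> below y z -> below x z.
Proof.
move=> xy yz q; have [->|h] := xy q; first by left.
right; have [h'|h'] := yz q; first by move: h; rewrite h' mulr0 ltxx.
have yn : c q y != 0 by apply: contraTneq h => ->; rewrite mulr0 ltxx.
have y2 : 0 < c q y * c q y by rewrite -expr2 exprn_even_gt0.
rewrite -(pmulr_lgt0 _ y2).
have -> : c q x * c q z * (c q y * c q y) = (c q x * c q y) * (c q y * c q z) by ring.
exact: mulr_gt0.
Qed.

Lemma belowD x y w : below x w -> below y w -> below (x + y) w.
Proof.
move=> xw yw q; rewrite cD; have [->|h] := xw q; first by rewrite add0r; exact: yw.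
have [->|h'] := yw q; first by rewrite addr0; right.
by right; rewrite mulrDl addr_gt0.
Qed.

Lemma belowZ k x w : 0 <= k -> below x w -> below (k *: x) w.
Proof.
rewrite le_eqVlt => /predU1P[<-|k0] xw q; first by left; rewrite cZ mul0r.
have [h|h] := xw q; first by left; rewrite cZ h mulr0.
by right; rewrite cZ -mulrA mulr_gt0.
Qed.

Lemma below0 w : below 0 w.
Proof. by move=> q; left; rewrite c0. Qed.

(** The remainders [fr l z] leave X because [lam] drops below 1, but they stay in the closed cell of
    a point of X. *)
Definition adm z := exists2 x, X x & below z x.

Lemma X_adm z : X z -> adm z.
Proof. by exists z => //; exact: below_refl. Qed.

Lemma adm_below z y : adm z -> below y z -> adm y.
Proof. by move=> [x Xx zx] yz; exists x => //; exact: below_trans zx. Qed.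

(** The cell is not empty: dividing [z] by [lam z] gives a point of X with the same signs. *)
Lemma bptP z : adm z -> z != 0 -> X (bpt (sgn z)) /\ sgn (bpt (sgn z)) = sgn z.
Proof.
move=> [x Xx zx] z0; have l0 := X_pos Xx zx z0.
apply: (@xgetPex _ 0 [set y | X y /\ sgn y = sgn z]).
exists ((lam z)^-1 *: z); split.
  apply: (X_below Xx); last by rewrite lamZ mulVf // gt_eqF.
  by apply: belowZ => //; rewrite invr_ge0 ltW.
by apply/sgn_eqP => q; rewrite cZ pmulr_rgt0 ?invr_gt0 // pmulr_rlt0 ?invr_gt0.
Qed.

Lemma tau_ge0 e z : 0 <= tau e z.
Proof. by rewrite le_max lexx. Qed.

(** If all ratios on the support of [e] were positive, this support would lie in that of [z], hence
    equal it by the bound on the rank, and the signs would agree. Thus the sum over cells in [peel]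
    is a continuous formula for a map defined cell by cell. *)
Lemma tau_other e z : (rank (sgn z) <= rank e)%N -> (0 < rank e)%N -> sgn z <> e ->
  tau e z = 0.
Proof.
move=> rz re ne; apply/eqP; rewrite eq_le tau_ge0 andbT ge_max lexx /=.
have [/existsP[q /andP[qs qr]]|] := boolP [exists q, (q \in supp e) && (ratio e z q <= 0)].
  exact: (bigmin_inf q _ _ _ qs qr).
move=> /existsPn h; exfalso; apply: ne.
have {}h q : q \in supp e -> 0 < ratio e z q.
  by move=> qs; have := h q; rewrite qs /= -ltNge.
move: re => /card_gt0P[q0 q0s].
have [[y [Xy sy]]|nx] := pselect (exists y, X y /\ sgn y = e); last first.
  have := h _ q0s; rewrite /ratio /bpt.
  case: xgetP => [y _ hy|_]; first by exfalso; apply: nx; exists y.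
  by rewrite c0 invr0 mulr0 ltxx.
have [_ sb] : X (bpt e) /\ sgn (bpt e) = e.
  by apply: (@xgetPex _ 0 [set y | X y /\ sgn y = e]); exists y.
have hz q : q \in supp e -> 0 < c q z * c q (bpt e).
  move=> qs; have := h q qs; rewrite /ratio => hr.
  have bn : c q (bpt e) != 0 by apply: contraTneq hr => ->; rewrite invr0 mulr0 ltxx.
  have b2 : 0 < c q (bpt e) * c q (bpt e) by rewrite -expr2 exprn_even_gt0.
  by have := mulr_gt0 hr b2; rewrite mulrA divfK.
have sub : supp e \subset supp (sgn z).
  apply/fintype.subsetP => q qs; rewrite in_supp_sgn; apply: contraTneq (hz q qs) => ->.
  by rewrite mul0r ltxx.
have E : supp e = supp (sgn z) by apply/eqP; rewrite eqEcard sub.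
rewrite -sb; apply/sgn_eqP => q.
have [qs|qs] := boolP (q \in supp e).
  have := hz q qs; have [b0|b0|->] := ltrgt0P (c q (bpt e)).
  - by rewrite pmulr_lgt0 // => z0; rewrite z0 [X in _ /\ X = _]ltNge (ltW z0).
  - by rewrite nmulr_lgt0 // => z0; rewrite z0 ltNge (ltW z0).
  - by rewrite mulr0 ltxx.
have bq : c q (bpt e) = 0.
  by apply/eqP; move: qs; rewrite -{1}sb in_supp_sgn negbK.
have zq : c q z = 0.
  by apply/eqP; move: qs; rewrite E in_supp_sgn negbK.
by rewrite bq zq.
Qed.

Definition drop_of y w := below y w /\ exists2 q, c q w != 0 & c q y = 0.

(** The ratios of [y] are nonnegative and one of them is 0; adding [k] times the base point raises
    all of them by [k]. *)
Lemma tau_comb w y k : adm w -> w != 0 -> drop_of y w -> 0 <= k ->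
  tau (sgn w) (y + k *: bpt (sgn w)) = k.
Proof.
move=> aw w0 [yw [q0 q0w q0y]] k0; have [Xb sb] := bptP aw w0.
set b := bpt (sgn w).
have bn q : q \in supp (sgn w) -> c q b != 0 by rewrite -sb in_supp_sgn.
have rE q : q \in supp (sgn w) -> ratio (sgn w) (y + k *: b) q = c q y / c q b + k.
  by move=> qs; rewrite /ratio cD cZ -/b mulrDl mulfK ?bn.
have r0 q : q \in supp (sgn w) -> 0 <= c q y / c q b.
  move=> qs; have [->|h] := yw q; first by rewrite mul0r.
  have h' := sgn_eq_mul sb; have wn : c q w != 0 by rewrite -in_supp_sgn.
  have {h'} := h' q wn; rewrite -/b => h'.
  have w2 : 0 < c q w * c q w by rewrite -expr2 exprn_even_gt0.
  have : 0 < (c q y * c q b) * (c q w * c q w).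
    rewrite (_ : _ * _ = (c q y * c q w) * (c q b * c q w)); last by ring.
    exact: mulr_gt0.
  rewrite (pmulr_lgt0 _ w2) => h2.
  have b2 : 0 < c q b * c q b by rewrite -expr2 exprn_even_gt0 //= bn.
  by rewrite -(pmulr_lge0 _ b2) mulrA divfK ?bn // ltW.
have q0s : q0 \in supp (sgn w) by rewrite in_supp_sgn.
rewrite /tau; set m := \big[_/_]_(q in _) _.
have -> : m = k.
  apply: le_anti; apply/andP; split.
    by apply: (bigmin_inf q0) => //; rewrite rE // q0y mul0r add0r.
  apply/bigmin_geP; split => [|q qs]; last by rewrite rE // lerDr r0.
  rewrite (bigD1 q0) //= rE // q0y mul0r add0r ger0_norm // lerDl.
  by apply: sumr_ge0 => q _.
by rewrite max_r.
Qed.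

Lemma sgn_comb w y k : adm w -> w != 0 -> below y w -> 0 < k ->
  sgn (y + k *: bpt (sgn w)) = sgn w.
Proof.
move=> aw w0 yw k0; have [_ sb] := bptP aw w0.
apply/sgn_eqP => q; rewrite cD cZ; have [<- <-] := (sgn_eqP _ _).1 sb q.
set b := bpt _; have kb : (0 < k * c q b) = (0 < c q b) by rewrite pmulr_rgt0.
have kb' : (k * c q b < 0) = (c q b < 0) by rewrite pmulr_rlt0.
have [->|h] := yw q; first by rewrite add0r kb kb'.
have wn : c q w != 0 by apply: contraTneq h => ->; rewrite mulr0 ltxx.
have := sgn_eq_mul sb wn; rewrite -/b; move: h.
have [w_|w_|w_] := ltrgt0P (c q w); last by rewrite w_ !mulr0 ltxx.
- rewrite !pmulr_lgt0 // => y0 b0; rewrite b0; have := mulr_gt0 k0 b0 => kb0.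
  by rewrite addr_gt0 // !ltNge (ltW b0) ltW // addr_gt0.
- rewrite !nmulr_lgt0 // => y0 b0; rewrite b0; have : k * c q b < 0 by rewrite kb'.
  by move=> kb0; rewrite !ltNge (ltW b0); split; lra.
Qed.

(** * Peeling off one rank *)

Lemma peel_low l z : (rank (sgn z) < l)%N -> peel l z = z.
Proof.
move=> rl; rewrite /peel big1 ?subr0 // => e /eqP re.
rewrite tau_other ?scale0r ?re //; first exact: ltnW.
  exact: leq_trans rl.
by move=> h; move: rl; rewrite h re ltnn.
Qed.

Lemma peel_eq l z : (0 < l)%N -> rank (sgn z) = l ->
  peel l z = z - tau (sgn z) z *: bpt (sgn z).
Proof.
move=> l0 rl; rewrite /peel (bigD1 (sgn z)) ?rl //= big1 ?addr0 // => e /andP[/eqP re /eqP ne].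
by rewrite tau_other ?scale0r ?re ?rl // => h; apply: ne.
Qed.

Lemma rank_gt0 z : z != 0 -> (0 < rank (sgn z))%N.
Proof.
move=> z0; apply/card_gt0P.
have [/existsP[q qz]|/existsPn h] := boolP [exists q, c q z != 0].
  by exists q; rewrite in_supp_sgn.
move: z0; rewrite (cI (z := z)) ?eqxx // => q.
by apply/eqP; have := h q; rewrite negbK.
Qed.

Lemma rank_eq0 z : rank (sgn z) = 0%N -> z = 0.
Proof. by move=> h; apply/eqP; apply: contraPT h => /rank_gt0 /gtn_eqF/eqP. Qed.

(** After the subtraction, the functional with the least ratio vanishes and every other one vanishes
    or keeps its sign. *)
Lemma peel_drop z : adm z -> z != 0 ->
  0 < tau (sgn z) z /\ drop_of (z - tau (sgn z) z *: bpt (sgn z)) z.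
Proof.
move=> az z0; have [Xb sb] := bptP az z0; set b := bpt _ in sb *.
have bz := sgn_eq_mul sb.
have bn q : q \in supp (sgn z) -> c q b != 0 by rewrite -sb in_supp_sgn.
have rp q : q \in supp (sgn z) -> 0 < ratio (sgn z) z q.
  move=> qs; rewrite /ratio -/b; have := bz q; rewrite -in_supp_sgn => /(_ qs).
  have b2 : 0 < c q b * c q b by rewrite -expr2 exprn_even_gt0 //= bn.
  by move=> h; rewrite -(pmulr_lgt0 _ b2) mulrA divfK ?bn // mulrC.
have /card_gt0P[q1 q1s] := rank_gt0 z0.
have idx q : q \in supp (sgn z) -> ratio (sgn z) z q <= \sum_q `|ratio (sgn z) z q|.
  move=> qs; rewrite (bigD1 q) //= ger0_norm; last exact/ltW/rp.
  by rewrite lerDl; apply: sumr_ge0.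
have [q0 q0s E] := eq_bigmin q1 _ _ q1s idx.
have tE : tau (sgn z) z = ratio (sgn z) z q0.
  by rewrite /tau E max_r // ltW // rp.
have tle q : q \in supp (sgn z) -> tau (sgn z) z <= ratio (sgn z) z q.
  by move=> qs; rewrite tE -E; apply: bigmin_le_cond.
split; first by rewrite tE rp.
split; last first.
  exists q0; first by rewrite -in_supp_sgn.
  by rewrite cB cZ tE /ratio -/b divfK ?bn // subrr.
move=> q; rewrite cB cZ.
have [qs|qs] := boolP (q \in supp (sgn z)); last first.
  have /eqP z_ : c q z == 0 by move: qs; rewrite in_supp_sgn negbK.
  have /eqP b_ : c q b == 0 by move: qs; rewrite -sb in_supp_sgn negbK.
  by left; rewrite z_ b_ mulr0 subrr.
have := tle q qs; rewrite le_eqVlt => /predU1P[->|lt].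
  by left; rewrite /ratio -/b divfK ?bn // subrr.
right; have -> : c q z - tau (sgn z) z * c q b = (ratio (sgn z) z q - tau (sgn z) z) * c q b.
  by rewrite mulrBl /ratio -/b divfK ?bn.
by rewrite -mulrA mulr_gt0 ?subr_gt0 // bz // -in_supp_sgn.
Qed.

Lemma drop_rank y w : drop_of y w -> (rank (sgn y) < rank (sgn w))%N.
Proof.
move=> [yw [q qw qy]]; apply: proper_card; apply/fintype.properP; split.
  apply/fintype.subsetP => p; rewrite !in_supp_sgn; apply: contraNneq => wp.
  by have [->//|] := yw p; rewrite wp mulr0 ltxx.
by exists q; rewrite in_supp_sgn // qy eqxx.
Qed.

Lemma frr l z : (r <= l)%N -> fr l z = z.
Proof. by rewrite /fr -subn_eq0 => /eqP ->. Qed.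

Lemma fr_peel l z : (l < r)%N -> fr l z = peel l.+1 (fr l.+1 z).
Proof.
move=> lr; rewrite /fr; have -> : (r - l)%N = (r - l.+1).+1 by lia.
by rewrite /=; congr (peel _ _); lia.
Qed.

Lemma rank_le z : (rank (sgn z) <= r)%N.
Proof. by rewrite -[X in (_ <= X)%N]card_ord; exact: max_card. Qed.

(** * The flag of a point of X *)

Section Point.
Variables (z : Z).
Hypothesis Xz : X z.

Lemma fr_adm l : below (fr l z) z /\ (rank (sgn (fr l z)) <= l)%N.
Proof.
have [rl|] := leqP r l.
  by rewrite frr //; split; [exact: below_refl|exact: leq_trans (rank_le z) rl].
move=> /ltnW lr; rewrite -(subKn lr); elim: (r - l)%N (leq_subr l r) => {l lr} [|k IH] kr.
  by rewrite subn0 frr //; split; [exact: below_refl|exact: rank_le].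
set l := (r - k.+1)%N; have lE : (r - k)%N = l.+1 by rewrite /l; lia.
have lr : (l < r)%N by rewrite /l; lia.
have [] := IH (ltnW kr); rewrite lE => bz rk; rewrite fr_peel //.
move: rk; rewrite leq_eqVlt ltnS => /predU1P[rk|rk]; last by rewrite peel_low.
have w0 : fr l.+1 z != 0.
  apply/eqP => h; move: rk; rewrite h => /eqP; rewrite eqn_leq => /andP[_].
  rewrite leqNgt => /negP; apply; rewrite ltnS.
  rewrite /rank (_ : supp _ = finset.set0) ?cards0 //.
  by apply/setP => q; rewrite in_supp_sgn c0 eqxx inE.
have aw := adm_below (X_adm Xz) bz.
have [t0 dr] := peel_drop aw w0.
rewrite peel_eq //; split; first exact: below_trans dr.1 bz.
by have := drop_rank dr; rewrite rk ltnS.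
Qed.

Lemma fr0 : fr 0 z = 0.
Proof. by have [_] := fr_adm 0; rewrite leqn0 => /eqP /rank_eq0. Qed.

Lemma fr_step l : (fr l z = fr l.+1 z /\ (rank (sgn (fr l.+1 z)) <= l)%N) \/
  [/\ (l < r)%N, fr l.+1 z != 0, rank (sgn (fr l.+1 z)) = l.+1,
      fr l.+1 z = fr l z + tau (sgn (fr l.+1 z)) (fr l.+1 z) *: bv l z &
      0 < tau (sgn (fr l.+1 z)) (fr l.+1 z) /\ drop_of (fr l z) (fr l.+1 z)].
Proof.
have [rl|lr] := leqP r l.
  left; rewrite !frr ?(leqW rl) //; split => //; exact: leq_trans (rank_le z) rl.
have [bz rk] := fr_adm l.+1.
rewrite fr_peel //; move: rk; rewrite leq_eqVlt ltnS => /predU1P[rk|rk]; last first.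
  by left; rewrite peel_low.
right; have w0 : fr l.+1 z != 0.
  apply/eqP => h; move: rk; rewrite h => /eqP; rewrite eqn_leq => /andP[_].
  rewrite leqNgt => /negP; apply; rewrite ltnS.
  rewrite /rank (_ : supp _ = finset.set0) ?cards0 //.
  by apply/setP => q; rewrite in_supp_sgn c0 eqxx inE.
have [t0 dr] := peel_drop (adm_below (X_adm Xz) bz) w0.
by rewrite peel_eq //; split => //; rewrite subrK.
Qed.

(** Since [lam] is 1 at base points, the flag coordinate at rank [l.+1] is the drop of the level; it
    is 0 when nothing is peeled off. *)
Lemma levS l : 0 <= lev l z - lev l.+1 z /\
  fr l.+1 z = fr l z + (lev l z - lev l.+1 z) *: bv l z.
Proof.
rewrite /lev (_ : 1 - _ - _ = lam (fr l.+1 z) - lam (fr l z)); last by ring.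
have [[-> _]|[lr w0 rk E [t0 dr]]] := fr_step l.
  by rewrite subrr scale0r addr0.
have [Xb _] := bptP (adm_below (X_adm Xz) (fr_adm l.+1).1) w0.
have -> : lam (fr l.+1 z) - lam (fr l z) = tau (sgn (fr l.+1 z)) (fr l.+1 z).
  by rewrite [in LHS]E lamD lamZ (X_lam Xb); ring.
by split; [exact: ltW|exact: E].
Qed.

Lemma gap_step l : lev l.+1 z < lev l z ->
  [/\ (l < r)%N, fr l.+1 z != 0, rank (sgn (fr l.+1 z)) = l.+1,
      lev l z - lev l.+1 z = tau (sgn (fr l.+1 z)) (fr l.+1 z) &
      [/\ X (bv l z), sgn (bv l z) = sgn (fr l.+1 z) & drop_of (fr l z) (fr l.+1 z)]].
Proof.
move=> gp; have [[h _]|[lr w0 rk E [t0 dr]]] := fr_step l.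
  by move: gp; rewrite /lev h ltxx.
have [Xb sb] := bptP (adm_below (X_adm Xz) (fr_adm l.+1).1) w0.
split => //; rewrite /lev.
rewrite (_ : 1 - _ - _ = lam (fr l.+1 z) - lam (fr l z)); last by ring.
by rewrite [in LHS]E lamD lamZ (X_lam Xb); ring.
Qed.

Lemma lev_first : lev 0 z = 1.
Proof. by rewrite /lev fr0 lam0 subr0. Qed.

Lemma lev_last l : (r <= l)%N -> lev l z = 0.
Proof. by move=> rl; rewrite /lev frr // X_lam // subrr. Qed.

Lemma lev_decr l : lev l.+1 z <= lev l z.
Proof. by rewrite -subr_ge0; have [] := levS l. Qed.

Lemma lev_nneg l : 0 <= lev l z.
Proof.
have [rl|lr] := leqP r l; first by rewrite lev_last.
have main k : 0 <= lev (r - k) z.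
  elim: k => [|k IH]; first by rewrite subn0 lev_last.
  have [rk|kr] := leqP r k; first by rewrite (_ : (r - k.+1 = r - k)%N) //; lia.
  apply: le_trans IH _; rewrite (_ : (r - k = (r - k.+1).+1)%N) ?lev_decr //; lia.
by rewrite -(subKn (ltnW lr)).
Qed.

Lemma fr_below l m : (l <= m)%N -> below (fr l z) (fr m z).
Proof.
move=> /subnK <-; elim: (m - l)%N => [|k IH]; first exact: below_refl.
apply: below_trans IH _; rewrite addSn.
have [[-> _]|[_ _ _ _ [_ []]]] := fr_step (k + l); [exact: below_refl|by []].
Qed.

Lemma fr_diff_below l m : (l <= m)%N -> below (fr m z - fr l z) (fr m z).
Proof.
move=> /subnK <-; elim: (m - l)%N => [|k IH]; first by rewrite subrr; exact: below0.
rewrite addSn; have [t0 E] := levS (k + l).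
rewrite {1}E addrAC; apply: belowD.
  by apply: below_trans IH _; exact: fr_below.
move: t0; rewrite le_eqVlt => /predU1P[<-|t0]; first by rewrite scale0r; exact: below0.
have [|_ _ _ _ [_ sb _]] := @gap_step (k + l); first by rewrite -subr_gt0.
by apply: belowZ; [exact: ltW|exact: below_sgn].
Qed.

Lemma piv_below l : lev l.+1 z < lev l z -> below (piv l z) (fr l.+1 z).
Proof.
move=> gp; have [_ _ _ _ [_ sb [h _]]] := gap_step gp.
by apply: belowD => //; apply: belowZ; [exact: lev_nneg|exact: below_sgn].
Qed.

Lemma lam_piv l : lev l.+1 z < lev l z -> lam (piv l z) = 1.
Proof.
move=> gp; have [_ _ _ _ [Xb _ _]] := gap_step gp.
by rewrite /piv lamD lamZ (X_lam Xb) mulr1 /lev; ring.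
Qed.

(** * Rays in flag coordinates *)

Section Ray.
Variables (i : nat) (nu : R).
Hypotheses (gi : lev i.+1 z < lev i z) (nu0 : 0 <= nu) (nui : nu * lev i.+1 z < lev i z).

Definition rayv (u : Z) := piv i z + nu *: (u - piv i z).

Let k := lev i z - nu * lev i.+1 z.

Let k0 : 0 < k. Proof. by rewrite subr_gt0. Qed.

(** Along the ray the coordinates up to rank [i] are constant, those beyond rank [i.+1] are
    multiplied by [nu], and the vertex of rank [i.+1] takes the rest [k], which is positive by the
    bound on [nu]. *)
Lemma rayvE m : rayv (fr m z) =
  fr i z + k *: bv i z + nu *: (fr m z - fr i.+1 z).
Proof.
have [_ E] := levS i.
have fE : fr i.+1 z = piv i z - lev i.+1 z *: bv i z.
  by rewrite E /piv scalerBl addrA.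
have -> : fr i z + k *: bv i z = piv i z - (nu * lev i.+1 z) *: bv i z.
  by rewrite /k scalerBl addrA.
by rewrite fE opprB addrCA scalerDr scalerA addrA subrK.
Qed.

Lemma below_c0 y w q : below y w -> c q w = 0 -> c q y = 0.
Proof. by move=> /(_ q)[//|]; move=> + w0; rewrite w0 mulr0 ltxx. Qed.

Lemma below_rank y w : below y w -> (rank (sgn y) <= rank (sgn w))%N.
Proof.
move=> yw; apply/subset_leq_card/fintype.subsetP => q; rewrite !in_supp_sgn.
by apply: contraNneq => /(below_c0 yw) ->.
Qed.

Lemma peel_comb l y w t : adm w -> w != 0 -> rank (sgn w) = l.+1 -> drop_of y w -> 0 <= t ->
  peel l.+1 (y + t *: bpt (sgn w)) = y.
Proof.
move=> aw w0 rw dr; rewrite le_eqVlt => /predU1P[<-|t0].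
  by rewrite scale0r addr0 peel_low // -rw; exact: drop_rank.
have sE := sgn_comb aw w0 dr.1 t0.
by rewrite peel_eq ?sE // tau_comb ?(ltW t0) // addrK.
Qed.

Lemma rayv_below m : (i < m)%N -> below (rayv (fr m z)) (fr m z).
Proof.
move=> im; rewrite rayvE; have [_ _ _ _ [_ sb _]] := gap_step gi.
apply: belowD; last by apply: belowZ => //; exact: fr_diff_below.
apply: belowD; first exact: fr_below (ltnW im).
apply: belowZ; first exact: ltW.
by apply: below_trans (below_sgn sb) _; exact: fr_below.
Qed.

Lemma lam_rayv u : lam (rayv u) = 1 + nu * (lam u - 1).
Proof. by rewrite /rayv lamD lamZ lamB (lam_piv gi). Qed.

Lemma rayv_below_self : below (rayv z) z.
Proof.
have [ir _ _ _ _] := gap_step gi.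
by have := rayv_below ir; rewrite frr.
Qed.

Lemma X_ray : X (rayv z).
Proof.
apply: (X_below Xz); first exact: rayv_below_self.
by rewrite lam_rayv (X_lam Xz) subrr mulr0 addr0.
Qed.

(** Downward induction on the rank: [rayv (fr l.+1 z)] is [rayv (fr l z)], a point of a proper face,
    plus a multiple of the base point of the cell, and peeling removes exactly this multiple. *)
Lemma fr_ray_gt m : (i < m)%N -> fr m (rayv z) = rayv (fr m z).
Proof.
move=> im; have [rm|mr] := leqP r m; first by rewrite !frr.
have main j : (i < r - j)%N -> fr (r - j) (rayv z) = rayv (fr (r - j) z).
  elim: j => [|j IH] ij; first by rewrite subn0 !frr.
  have [rj|jr] := leqP r j; first by move: ij; rewrite (_ : r - j.+1 = 0)%N //; lia.
  have jE : (r - j = (r - j.+1).+1)%N by lia.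
  set l := (r - j.+1)%N in ij jE *; have lr : (l < r)%N by rewrite /l; lia.
  have := IH _; rewrite jE => {}IH; rewrite fr_peel // IH; last exact: ltnW.
  have [[E rk]|[_ w0 rk E [t0 dr]]] := fr_step l.
    rewrite peel_low -?E // ltnS; apply: leq_trans (below_rank (rayv_below ij)) _.
    by rewrite E.
  have -> : rayv (fr l.+1 z) = rayv (fr l z) +
      (nu * tau (sgn (fr l.+1 z)) (fr l.+1 z)) *: bpt (sgn (fr l.+1 z)).
    by rewrite [in LHS]E /rayv [fr l z + _ - _]addrAC scalerDr addrA scalerA.
  apply: peel_comb => //; [exact: (adm_below (X_adm Xz) (fr_adm l.+1).1)| |].
    have bl := rayv_below ij; split; first exact: below_trans dr.1.
    have [q qw qf] := dr.2; exists q => //; exact: below_c0 bl qf.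
  by apply: mulr_ge0 => //; exact: ltW.
by rewrite -(subKn (ltnW mr)) main // subKn // ltnW.
Qed.

Lemma fr_ray_le m : (m <= i)%N -> fr m (rayv z) = fr m z.
Proof.
move=> mi; rewrite -(subKn mi); elim: (i - m)%N (leq_subr m i) => {m mi} [|j IH] ji.
  have [ir w0 rk _ [_ _ dr]] := gap_step gi.
  rewrite subn0 fr_peel // fr_ray_gt // rayvE subrr scaler0 addr0.
  by apply: peel_comb => //; [exact: (adm_below (X_adm Xz) (fr_adm i.+1).1)|exact: ltW].
have [ir _ _ _ _] := gap_step gi.
have E : (i - j = (i - j.+1).+1)%N by lia.
set l := (i - j.+1)%N in E *; have lr : (l < r)%N by rewrite /l; lia.
by rewrite fr_peel // -E (IH (ltnW ji)) E -fr_peel.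
Qed.

Lemma lev_ray_le l : (l <= i)%N -> lev l (rayv z) = lev l z.
Proof. by move=> li; rewrite /lev fr_ray_le. Qed.

Lemma lev_ray_gt l : (i < l)%N -> lev l (rayv z) = nu * lev l z.
Proof. by move=> li; rewrite /lev fr_ray_gt // lam_rayv; ring. Qed.

Lemma sgn_ray_le l : (l <= i)%N -> sgn (fr l.+1 (rayv z)) = sgn (fr l.+1 z).
Proof.
rewrite leq_eqVlt => /predU1P[->|li]; last by rewrite fr_ray_le.
have [ir w0 rk _ [_ _ dr]] := gap_step gi.
rewrite fr_ray_gt // rayvE subrr scaler0 addr0.
by apply: sgn_comb => //; [exact: (adm_below (X_adm Xz) (fr_adm i.+1).1)|exact: dr.1].
Qed.

Lemma piv_ray_le l : (l <= i)%N -> piv l (rayv z) = piv l z.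
Proof. by move=> li; rewrite /piv /bv lev_ray_le // fr_ray_le // sgn_ray_le. Qed.

Lemma sgn_ray_gt l : (i < l)%N -> 0 < nu -> lev l.+1 z < lev l z ->
  sgn (fr l.+1 (rayv z)) = sgn (fr l.+1 z).
Proof.
move=> il nup gl; have [lr w0 rk _ [_ _ dr]] := gap_step gl.
have [t0 E] := levS l.
rewrite fr_ray_gt ?(leqW il) //.
have -> : rayv (fr l.+1 z) = rayv (fr l z) + (nu * (lev l z - lev l.+1 z)) *: bpt (sgn (fr l.+1 z)).
  by rewrite [in LHS]E /rayv [fr l z + _ - _]addrAC scalerDr addrA scalerA.
apply: sgn_comb => //; first exact: (adm_below (X_adm Xz) (fr_adm l.+1).1).
  by apply: below_trans (rayv_below il) _; exact: dr.1.
by apply: mulr_gt0 => //; rewrite subr_gt0.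
Qed.

Lemma piv_ray_gt l : (i < l)%N -> 0 < nu -> lev l.+1 z < lev l z ->
  piv l (rayv z) = rayv (piv l z).
Proof.
move=> il nup gl; rewrite {1}/piv /bv sgn_ray_gt // lev_ray_gt // fr_ray_gt //.
have -> : rayv (piv l z) = rayv (fr l z + lev l z *: bv l z) by [].
by rewrite /rayv [fr l z + _ - _]addrAC [in RHS]scalerDr addrA scalerA.
Qed.

End Ray.
End Point.

(** * Continuity of the flag coordinates *)

Lemma tau_cont e : continuous (tau e).
Proof.
move=> z; apply: (@continuous_max R Z (fun=> 0)); first exact: cvg_cst.
have rc q : continuous (fun z => ratio e z q).
  by move=> z'; apply: cvgMl; exact: cC.
apply: (@continuous_bigmin R Z 'I_r) => // z'.
apply: continuous_bigsum => q z''; apply: cvg_norm; exact: rc.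
Qed.

Lemma peel_cont l : continuous (peel l).
Proof.
move=> z; apply: cvgB; first exact: cvg_id.
apply: continuous_bigsum => e z'; apply: cvgZ; [exact: tau_cont|exact: cvg_cst].
Qed.

Lemma fr_cont l : continuous (fr l).
Proof.
rewrite /fr; elim: (r - l)%N => [|k IH] z; first exact: cvg_id.
by apply: (@continuous_comp _ _ _ (frn k)); [exact: IH|exact: peel_cont].
Qed.

Lemma lev_continuous l : continuous (lev l).
Proof.
move=> z; apply: cvgB; first exact: cvg_cst.
by apply: (@continuous_comp _ _ _ (fr l)); [exact: fr_cont|exact: lamC].
Qed.

(** The coordinate at the cell [e] of [fr l.+1 z] is positive at [z], hence nearby; by [tau_other]
    this is possible only for points whose remainder lies in the cell [e]. *)
Lemma bv_locally_constant l z : X z -> lev l.+1 z < lev l z ->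
  \forall y \near within X (nbhs z), bv l y = bv l z.
Proof.
move=> Xz gl; have [lr w0 rk tE _] := gap_step Xz gl.
set e := sgn (fr l.+1 z) in rk tE.
have tc : tau e (fr l.+1 y) @[y --> z] --> tau e (fr l.+1 z).
  by apply: (@continuous_comp _ _ _ (fr l.+1)); [exact: fr_cont|exact: tau_cont].
have : \forall y \near z, 0 < tau e (fr l.+1 y).
  by apply: (cvgr_gt _ tc); rewrite -tE subr_gt0.
apply: filterS => y t0 Xy; have [_ ry] := fr_adm Xy l.+1.
have [E|ne] := pselect (sgn (fr l.+1 y) = e); first by rewrite /bv E.
by move: t0; rewrite tau_other ?ltxx // rk.
Qed.

Lemma piv_cont l z : X z -> lev l.+1 z < lev l z ->
  piv l y @[y --> within X (nbhs z)] --> piv l z.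
Proof.
move=> Xz gl; rewrite /piv; apply: cvgD.
  by apply: cvg_within_filter; exact: fr_cont.
have h : lev l y *: bv l z @[y --> within X (nbhs z)] --> lev l z *: bv l z.
  apply: cvgZ; last exact: cvg_cst.
  by apply: cvg_within_filter; exact: lev_continuous.
apply: cvg_trans h; apply: near_eq_cvg.
by have := bv_locally_constant Xz gl; apply: filterS => y ->.
Qed.

(* Total mass of the flag coordinates at the vertices selected by B. *)
Definition mass (B : {ffun 'I_r -> bool * bool} -> bool) z :=
  \sum_(l < r) \sum_(e | (rank e == l.+1) && B e) tau e (fr l.+1 z).

Lemma mass_cont B : continuous (mass B).
Proof.
apply: continuous_bigsum => l; apply: continuous_bigsum => e z.
by apply: (@continuous_comp _ _ _ (fr l.+1)); [exact: fr_cont|exact: tau_cont].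
Qed.

(** [mass] sums over all cells and so is visibly continuous; at a point of X at most one cell of
    each rank contributes, by [tau_other]. *)
Lemma massE B z : X z ->
  mass B z = \sum_(l < r | B (sgn (fr l.+1 z))) (lev l z - lev l.+1 z).
Proof.
move=> Xz; rewrite /mass [RHS]big_mkcond; apply: eq_bigr => l _.
have [[E rk]|[_ w0 rk E [t0 dr]]] := fr_step Xz l.
  rewrite big1 => [|e /andP[/eqP re _]].
    by rewrite /lev E subrr if_same.
  rewrite tau_other ?re //; first exact: leqW.
  by move=> h; move: rk; rewrite h re ltnn.
have tE : lev l z - lev l.+1 z = tau (sgn (fr l.+1 z)) (fr l.+1 z).
  have [|_ _ _ -> _] // := @gap_step z Xz l.
  have [Xb _] := bptP (adm_below (X_adm Xz) (fr_adm Xz l.+1).1) w0.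
  rewrite /lev -subr_gt0 [in X in _ < X](_ : 1 - _ - _ = lam (fr l.+1 z) - lam (fr l z)); last by ring.
  by rewrite [in X in X - _]E lamD lamZ (X_lam Xb) mulr1 addrAC subrr add0r.
have oth e : rank e = l.+1 -> e != sgn (fr l.+1 z) -> tau e (fr l.+1 z) = 0.
  by move=> re ne; rewrite tau_other ?re ?rk //; apply/eqP; rewrite eq_sym.
case: ifP => Bs.
  rewrite (bigD1 (sgn (fr l.+1 z))) ?rk ?eqxx //= big1 ?addr0 // => e /andP[/andP[/eqP re _] ne].
  exact: oth.
rewrite big1 // => e /andP[/eqP re Be]; apply: oth => //.
by apply: contraTneq Be => ->; rewrite Bs.
Qed.

End Flags.

(** * Sheets over a union of sign cells *)

Lemma compact_preimage_within (T U : topologicalType) (A : set T) (f : T -> U) (D : set U) :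
  compact A -> {within A, continuous f} -> closed D -> compact (A `&` f @^-1` D).
Proof.
move=> cA /subspace_continuousP cf cD G PG GA.
have [p [Ap cp]] := cA G PG (filterS (@subIsetl _ _ _) GA).
exists p; split => //; split => //; apply: cD => O Op.
have := cp _ _ GA (cf p Ap O Op).
by move=> [y [[Ay Dy] Oy]]; exists (f y); split => //; exact: Oy.
Qed.

Lemma bigcup_compact (T : topologicalType) (I : eqType) (S : seq I) (F : I -> set T) :
  (forall i, compact (F i)) -> compact [set x | exists2 i, i \in S & F i x].
Proof.
move=> cF; elim: S => [|i S IH].
  by rewrite (_ : [set _ | _] = set0); [exact: compact0|apply/seteqP; split => x // -[]].
rewrite (_ : [set _ | _] = F i `|` [set x | exists2 i, i \in S & F i x]).
  exact: compactU.
apply/seteqP; split => x.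
  by move=> [j]; rewrite inE => /predU1P[->|jS] Fj; [left|right; exists j].
by move=> [Fi|[j jS Fj]]; [exists i; rewrite ?mem_head|exists j => //; rewrite inE jS orbT].
Qed.

Lemma compact_dist_gt0 (R : realType) (V : normedModType R) (Q : set (V * V)) :
  compact Q -> (forall p, Q p -> p.1 <> p.2) ->
  exists2 d : R, 0 < d & forall p, Q p -> d <= `|p.1 - p.2|.
Proof.
move=> cQ Qn; have [[p Qp]|Q0] := pselect (Q !=set0); last first.
  by exists 1 => // p Qp; exfalso; apply: Q0; exists p.
have [] := @compact_EVT_min _ _ (fun p : V * V => `|p.1 - p.2|) Q _ cQ.
- by exists p.
- apply: continuous_subspaceT => q.
  by apply: cvg_norm; apply: cvgB; [exact: cvg_fst|exact: cvg_snd].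
- move=> q /set_mem Qq mn; exists `|q.1 - q.2|.
    by rewrite normr_gt0 subr_eq0; apply/eqP; exact: Qn.
  by move=> p' Qp'; apply: mn; exact/mem_set.
Qed.

(* N is a finite union of sheets H s, each of which F maps injectively to X; the
   linear map B s restricts to the inverse of F on H s. *)
Record sheeted (R : realType) (V Z : normedModType R) (r : nat)
    (c : 'I_r -> Z -> R) (lam : Z -> R) (X : set Z) (N : set V) (F : V -> Z)
    (I : finType) (H : I -> set V) (B : I -> Z -> V) : Prop := Sheeted {
  sheet_cover : forall x, N x <-> exists s, H s x;
  sheet_compact : forall s, compact (H s);
  base_in : forall x, N x -> X (F x);
  base_cont : forall x, N x -> F y @[y --> within N (nbhs x)] --> F x;
  lift_lin : forall s k x y, B s (k *: x + y) = k *: B s x + B s y;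
  lift_cont : forall s, continuous (B s);
  liftK : forall s x, H s x -> B s (F x) = x;
  lift_in : forall s x z, H s x -> below c z (F x) -> lam z = 1 -> H s (B s z);
  liftF : forall s x z, H s x -> below c z (F x) -> lam z = 1 -> F (B s z) = z;
  lift_eq : forall s t x z, H s x -> H t x -> below c z (F x) -> B s z = B t z }.

Section Sheets.
Variables (R : realType) (V Z : normedModType R) (r : nat).
Variables (c : 'I_r -> Z -> R) (lam : Z -> R) (X : set Z) (N : set V) (F : V -> Z).
Variables (I : finType) (H : I -> set V) (B : I -> Z -> V).
Hypothesis FD : flag_data c lam X.
Hypothesis SH : sheeted c lam X N F H B.

Local Notation fr := (fr c X).
Local Notation lev := (lev c lam X).
Local Notation bv := (bv c X).
Local Notation piv := (piv c lam X).
Local Notation rayv := (rayv c lam X).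
Local Notation below := (below c).

Definition sheet_lev l x := lev l (F x).
(** Any sheet through [x] may be used where the level drops: the pivot then lies in the closed cell
    of [F x], on which the lifts agree by [lift_eq]. *)
Definition sheet_apex l x := xget 0 [set B s (piv l (F x)) | s in [set s | H s x]].
Definition same_fibre x y := [/\ N x, N y & F x = F y].

Let XF x (Nx : N x) : X (F x) := base_in SH Nx.
Let BL := lift_lin SH.

Let B0 s : B s 0 = 0.
Proof. by have := BL s (- 1) 0 0; rewrite !scaleN1r oppr0 addr0 addNr. Qed.
Let BZ s k x : B s (k *: x) = k *: B s x.
Proof. by rewrite -[k *: x]addr0 BL B0 addr0. Qed.
Let BD s x y : B s (x + y) = B s x + B s y.
Proof. by rewrite -[x]scale1r BL !scale1r. Qed.
Let BB s x y : B s (x - y) = B s x - B s y.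
Proof. by rewrite BD -scaleN1r BZ scaleN1r. Qed.

Let HN s x : H s x -> N x.
Proof. by move=> Hx; apply/(sheet_cover SH); exists s. Qed.

Lemma N_compact : compact N.
Proof.
rewrite (_ : N = [set x | exists2 s, s \in enum I & H s x]).
  by apply: bigcup_compact => s; exact: (sheet_compact SH).
apply/seteqP; split => [x /(sheet_cover SH)[s Hx]|x [s _]]; last exact: HN.
by exists s; rewrite ?mem_enum.
Qed.

Lemma apexE x l s : H s x -> lev l.+1 (F x) < lev l (F x) -> sheet_apex l x = B s (piv l (F x)).
Proof.
move=> Hx gp; have Xx := XF (HN Hx).
have bp : below (piv l (F x)) (F x).
  by apply: below_trans (piv_below FD Xx gp) _; exact: (fr_adm FD Xx _).1.
rewrite /sheet_apex; case: xgetP => [_ -> [t Ht <-]|/(_ (B s (piv l (F x))))].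
  exact: (lift_eq SH Ht Hx).
by case; exists s.
Qed.

Lemma sheet_rayE x i nu s : H s x -> lev i.+1 (F x) < lev i (F x) ->
  ray sheet_apex i nu x = B s (rayv (F x) i nu (F x)).
Proof.
by move=> Hx gp; rewrite /ray (apexE Hx gp) /rayv BD BZ BB (liftK SH Hx).
Qed.

Section Ray.
Variables (x : V) (i : nat) (nu : R) (s : I).
Hypotheses (Hx : H s x) (gp : lev i.+1 (F x) < lev i (F x)).
Hypotheses (nu0 : 0 <= nu) (nui : nu * lev i.+1 (F x) < lev i (F x)).

Lemma ray_lift : H s (ray sheet_apex i nu x) /\ F (ray sheet_apex i nu x) = rayv (F x) i nu (F x).
Proof.
have Xx := XF (HN Hx); rewrite (sheet_rayE nu Hx gp).
have br := rayv_below_self FD Xx gp nu0 nui.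
have l1 := lam1 FD (X_ray FD Xx gp nu0 nui).
by split; [exact: (lift_in SH Hx)|exact: (liftF SH Hx)].
Qed.

End Ray.

Lemma sheet_ray i x nu : N x -> sheet_lev i.+1 x < sheet_lev i x ->
    0 <= nu -> nu * sheet_lev i.+1 x < sheet_lev i x ->
    [/\ N (ray sheet_apex i nu x),
        forall l, (l <= i)%N -> sheet_lev l (ray sheet_apex i nu x) = sheet_lev l x,
        forall l, (i < l)%N -> sheet_lev l (ray sheet_apex i nu x) = nu * sheet_lev l x,
        forall l, (l <= i)%N -> sheet_lev l.+1 x < sheet_lev l x ->
          sheet_apex l (ray sheet_apex i nu x) = sheet_apex l x &
        forall l, (i < l)%N -> sheet_lev l.+1 x < sheet_lev l x -> 0 < nu ->
          sheet_apex l (ray sheet_apex i nu x) =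
            sheet_apex i x + nu *: (sheet_apex l x - sheet_apex i x)].
Proof.
move=> Nx gp nu0 nui; have /(sheet_cover SH) [s Hx] := Nx.
have [Hy Fy] := ray_lift Hx gp nu0 nui; set y := ray _ _ _ _ in Hy Fy *.
have le l : (l <= i)%N -> sheet_lev l y = sheet_lev l x.
  by move=> li; rewrite /sheet_lev Fy; exact: (lev_ray_le FD (XF Nx) gp nu0 nui).
have gt l : (i < l)%N -> sheet_lev l y = nu * sheet_lev l x.
  by move=> li; rewrite /sheet_lev Fy; exact: (lev_ray_gt FD (XF Nx) gp nu0 nui).
split => // [|l li gl|l li gl nup]; first exact: HN Hy.
  have gy : sheet_lev l.+1 y < sheet_lev l y.
    rewrite (le l) //; move: li; rewrite leq_eqVlt => /predU1P[->|li]; first by rewrite gt.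
    by rewrite le.
  rewrite (apexE Hy gy) (apexE Hx gl) Fy.
  by rewrite (piv_ray_le FD (XF Nx) gp nu0 nui).
have gy : sheet_lev l.+1 y < sheet_lev l y by rewrite !gt ?leqW // ltr_pM2l.
rewrite (apexE Hy gy) (apexE Hx gl) (apexE Hx gp) Fy.
by rewrite (piv_ray_gt FD (XF Nx) gp nu0 nui) // BD BZ BB.
Qed.

Lemma sheet_ray_fibre i x y nu : same_fibre x y -> sheet_lev i.+1 x < sheet_lev i x ->
  0 <= nu -> nu * sheet_lev i.+1 x < sheet_lev i x ->
  same_fibre (ray sheet_apex i nu x) (ray sheet_apex i nu y).
Proof.
move=> [Nx Ny xy] gp nu0 nui.
have /(sheet_cover SH) [s Hx] := Nx; have /(sheet_cover SH) [t Ht] := Ny.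
have [Hx' Fx] := ray_lift Hx gp nu0 nui.
have [] := @ray_lift y i nu t Ht; rewrite -?xy // => Hy' Fy.
by split; [exact: HN Hx'|exact: HN Hy'|rewrite Fx Fy].
Qed.

Lemma base_within x : N x -> F y @[y --> within N (nbhs x)] --> within X (nbhs (F x)).
Proof.
move=> Nx A hA; have wN : \forall y \near within N (nbhs x), N y by exact: withinT.
have := base_cont SH Nx hA; move: wN; apply: filterS2 => y Ny /=; apply.
exact: XF.
Qed.

(** There are finitely many sheets and each is closed. *)
Lemma near_sheets x : N x ->
  \forall y \near within N (nbhs x), forall s, H s y -> H s x.
Proof.
move=> Nx; apply: filter_forall => s.
have [xs|nxs] := pselect (H s x); first exact: nearW.
have cl : closed (H s).
  by apply: compact_closed; [exact: norm_hausdorff|exact: (sheet_compact SH)].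
have : \forall y \near x, ~ H s y.
  by have := closed_openC cl; rewrite openE; apply.
by apply: filterS => y ny Ny ys; case: (ny ys).
Qed.

Lemma base_comp (U : topologicalType) (g : Z -> U) x : N x ->
  {for F x, continuous g} -> g (F y) @[y --> within N (nbhs x)] --> g (F x).
Proof. by move=> Nx; apply: cvg_comp; exact: (base_cont SH). Qed.

(** The apex of a nearby point can be computed in a sheet that also contains [x], and there it is a
    linear lift of the continuous pivot. *)
Lemma sheet_apex_cont i x : N x -> sheet_lev i.+1 x < sheet_lev i x ->
  sheet_apex i y @[y --> within N (nbhs x)] --> sheet_apex i x.
Proof.
move=> Nx gp; apply/cvgrPdist_lt => e e0.
have pc : piv i (F y) @[y --> within N (nbhs x)] --> piv i (F x).
  exact: (cvg_comp _ _ (base_within Nx) (piv_cont FD (XF Nx) gp)).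
have lc : sheet_lev i y - sheet_lev i.+1 y @[y --> within N (nbhs x)] -->
    sheet_lev i x - sheet_lev i.+1 x.
  have h l : sheet_lev l y @[y --> within N (nbhs x)] --> sheet_lev l x.
    by apply: (@base_comp _ (lev l)) => //; exact: (lev_continuous FD).
  exact: (cvgB (h i) (h i.+1)).
have gn : \forall y \near within N (nbhs x), sheet_lev i.+1 y < sheet_lev i y.
  have := cvgr_gt _ lc 0; rewrite subr_gt0 => /(_ _ gp); apply: filterS => y.
  by rewrite subr_gt0.
have h : \forall y \near within N (nbhs x), forall s, H s x ->
    `|sheet_apex i x - B s (piv i (F y))| < e.
  apply: filter_forall => s; have [Hx|nHx] := pselect (H s x); last exact: nearW.
  have := cvg_comp _ _ pc (@lift_cont _ _ _ _ _ _ _ _ _ _ _ _ SH s (piv i (F x))).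
  move/cvgrPdist_lt => /(_ e e0); rewrite -(apexE Hx gp).
  by apply: filterS => y h _.
have := near_sheets Nx; have wN : \forall y \near within N (nbhs x), N y by exact: withinT.
move=> h2; have {}h2 : \forall y \near within N (nbhs x), N y /\ forall s, H s y -> H s x.
  by move: wN h2; apply: filterS2.
move: gn h h2; apply: filterS3 => y gy hy [/(sheet_cover SH) [s Hy] /(_ s Hy) Hx].
by rewrite (apexE Hy gy); exact: hy.
Qed.

Lemma below_bv x l : N x -> sheet_lev l.+1 x < sheet_lev l x -> below (bv l (F x)) (F x).
Proof.
move=> Nx gp; have [_ _ _ _ [_ sb _]] := gap_step FD (XF Nx) gp.
by apply: below_trans (below_sgn sb) _; exact: (fr_adm FD (XF Nx) _).1.
Qed.

Lemma lift_bv x l s : H s x -> sheet_lev l.+1 x < sheet_lev l x ->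
  H s (B s (bv l (F x))) /\ F (B s (bv l (F x))) = bv l (F x).
Proof.
move=> Hx gp; have bb := below_bv (HN Hx) gp.
have [_ _ _ _ [Xb _ _]] := gap_step FD (XF (HN Hx)) gp.
have l1 := lam1 FD Xb.
by split; [exact: (lift_in SH Hx)|exact: (liftF SH Hx)].
Qed.

(** [x] and its apex share the flag coordinates up to rank [i] and differ in where the mass
    [lev i.+1 (F x)] sits: on the later flag vertices or on the one of rank [i.+1]. The lifted
    vertices lie in N and are bounded by [D], whence the constant [D + D]. *)
Lemma sheet_apex_dist : exists2 C : R, 0 < C & forall i x, N x ->
    sheet_lev i.+1 x < sheet_lev i x ->
    `|x - sheet_apex i x| <= C * sheet_lev i.+1 x.
Proof.
have [M [_ /(_ (`|M| + 1))]] := compact_bounded N_compact.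
rewrite (le_lt_trans (ler_norm _)) ?ltrDl // => /(_ isT) b.
set D := `|M| + 1 in b; have D0 : 0 < D by rewrite ltr_wpDl.
exists (D + D); first exact: addr_gt0.
move=> i x Nx gp; have /(sheet_cover SH) [s Hx] := Nx.
have bb l : sheet_lev l.+1 x < sheet_lev l x -> `|B s (bv l (F x))| <= D.
  by move=> gl; apply: b; exact: HN (lift_bv Hx gl).1.
have step m k : `|B s (fr (k + m) (F x)) - B s (fr m (F x))| <=
      D * (sheet_lev m x - sheet_lev (k + m) x).
  elim: k => [|k IH]; first by rewrite !subrr normr0 mulr0.
  rewrite addSn; have [t0 E] := levS FD (XF Nx) (k + m); rewrite E BD BZ addrAC.
  apply: le_trans (ler_normD _ _) _.
  have -> : sheet_lev m x - sheet_lev (k + m).+1 x =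
    (sheet_lev m x - sheet_lev (k + m) x) + (sheet_lev (k + m) x - sheet_lev (k + m).+1 x) by ring.
  rewrite mulrDr lerD // normrZ (ger0_norm t0) mulrC.
  move: t0; rewrite le_eqVlt => /predU1P[<-|t0]; first by rewrite /sheet_lev !mulr0.
  by rewrite ler_pM2r //; apply: bb; rewrite -subr_gt0.
have [t0 E] := levS FD (XF Nx) i.
have -> : x - sheet_apex i x = (B s (fr (r + i.+1) (F x)) - B s (fr i.+1 (F x)))
    - sheet_lev i.+1 x *: B s (bv i (F x)).
  rewrite (apexE Hx gp) frr ?leq_addr // (liftK SH Hx) -addrA; congr (_ + _).
  by rewrite E /piv !BD !BZ -opprD -addrA -scalerDl subrK.
apply: le_trans (ler_normB _ _) _; rewrite mulrDl lerD //.
  apply: le_trans (step i.+1 r) _; rewrite ler_pM2l //.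
  by rewrite /sheet_lev [X in _ - X](lev_last FD (XF Nx)) ?subr0 // leq_addr.
have a0 : 0 <= sheet_lev i.+1 x by exact: (lev_nneg FD (XF Nx) _).
rewrite normrZ ger0_norm // mulrC; apply: ler_wpM2r => //; exact: bb.
Qed.

Lemma base_fst (A : set (V * V)) (p : V * V) : A `<=` N `*` N -> A p ->
  F q.1 @[q --> within A (nbhs p)] --> F p.1.
Proof.
move=> AN Ap O /(base_cont SH (AN _ Ap).1) h.
have : \forall q \near p, N q.1 -> O (F q.1) by exact: (cvg_fst (F := nbhs p.1) (G := nbhs p.2) h).
by apply: filterS => q hq Aq; apply: hq; exact: (AN _ Aq).1.
Qed.

Lemma base_snd (A : set (V * V)) (p : V * V) : A `<=` N `*` N -> A p ->
  F q.2 @[q --> within A (nbhs p)] --> F p.2.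
Proof.
move=> AN Ap O /(base_cont SH (AN _ Ap).2) h.
have : \forall q \near p, N q.2 -> O (F q.2) by exact: (cvg_snd (F := nbhs p.1) (G := nbhs p.2) h).
by apply: filterS => q hq Aq; apply: hq; exact: (AN _ Aq).2.
Qed.

Lemma fibre_compact (A : set (V * V)) : A `<=` N `*` N -> compact A ->
  compact (A `&` [set p | F p.1 = F p.2]).
Proof.
move=> AN cA.
rewrite (_ : [set p | _] = (fun p : V * V => F p.1 - F p.2) @^-1` [set 0]).
  apply: compact_preimage_within => //.
    apply/subspace_continuousP => p Ap.
    exact: (cvgB (base_fst AN Ap) (base_snd AN Ap)).
  exact: accessible_closed_set1 (hausdorff_accessible (@norm_hausdorff _ _)) _.
by apply/seteqP; split => p /=; [move=> ->; rewrite subrr|move/eqP; rewrite subr_eq0 => /eqP].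
Qed.

Lemma same_fibre_compact : compact [set p : V * V | same_fibre p.1 p.2].
Proof.
rewrite (_ : [set _ | _] = (N `*` N) `&` [set p | F p.1 = F p.2]).
  by apply: fibre_compact => //; apply: compact_setX; exact: N_compact.
by apply/seteqP; split => p /=; [move=> [? ? ?]|move=> [[? ?] ?]].
Qed.

(** For sheets [s], [t], the mass at base points with different lifts is continuous and vanishes if
    [x = y]. So pairs of a fibre with mass at least [e] form a compact set off the diagonal. From
    the first level [j] with different lifts on, all flag vertices have different lifts, so this
    mass is at least the level at [j]. *)
Lemma sheets_separated (e : R) : 0 < e -> exists2 d : R, 0 < d &
  forall x y, same_fibre x y -> x != y -> exists j, [/\ 0 < sheet_lev j x,
      forall l, (l < j)%N -> sheet_lev l.+1 x < sheet_lev l x -> sheet_apex l x = sheet_apex l y &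
      e <= sheet_lev j x -> d <= `|x - y|].
Proof.
move=> e0; pose Bd s t eps := B s (bpt c X eps) != B t (bpt c X eps).
pose Q s t := (((H s `*` H t) `&` [set p : V * V | F p.1 = F p.2]) `&`
  [set p | e <= mass c X (Bd s t) (F p.1)]).
have HHN s t : H s `*` H t `<=` N `*` N by move=> p [/HN ? /HN ?].
have Qc s t : compact (Q s t).
  rewrite /Q; set A := _ `&` [set _ | F _ = _].
  have AN : A `<=` N `*` N by move=> p [/HHN].
  rewrite (_ : [set p | _] = (fun p : V * V => mass c X (Bd s t) (F p.1)) @^-1` [set u | e <= u]) //.
  apply: compact_preimage_within; last exact: closed_ge.
    by apply: fibre_compact => //; apply: compact_setX; exact: (sheet_compact SH).
  apply/subspace_continuousP => p Ap.
  apply: (@cvg_comp _ _ _ (fun q : V * V => F q.1) (mass c X (Bd s t))).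
    exact: base_fst AN Ap.
  exact: (mass_cont FD).
have Qn s t p : Q s t p -> p.1 <> p.2.
  move=> [[[/= Hs Ht] _] me] p12; move: me; rewrite -p12 in Ht *.
  have Nx := HN Hs.
  rewrite (massE FD _ (XF Nx)) big1 ?leNgt ?e0 // => l Bl.
  have [t0 _] := levS FD (XF Nx) l; move: t0; rewrite le_eqVlt => /predU1P[//|].
  rewrite subr_gt0 => gl; exfalso; move: Bl; rewrite /Bd => /eqP; apply.
  exact: (lift_eq SH Hs Ht (below_bv Nx gl)).
(* One [d] for the finitely many pairs of sheets, found by intersecting right neighbourhoods of
   0. *)
have [d d0 dQ] : exists2 d : R, 0 < d & forall s t p, Q s t p -> d <= `|p.1 - p.2|.
  have Qst s t : \forall d \near (0 : R)^'+, forall p, Q s t p -> d <= `|p.1 - p.2|.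
    have [d d0 dQ] := compact_dist_gt0 (Qc s t) (@Qn s t).
    have := nbhs_right_lt d0; apply: filterS => d' d'd p Qp.
    by apply: le_trans (dQ p Qp); exact: ltW.
  have h := filter_forall _ (fun s => filter_forall _ (Qst s)).
  have := filterI (nbhs_right_gt (0 : R)) (h _ _).
  by move=> /(_ _ _ _)/filter_ex[d [? ?]]; exists d.
exists d => // x y [Nx Ny xy] nxy.
have /(sheet_cover SH) [s Hs] := Nx; have /(sheet_cover SH) [t Ht] := Ny.
(* [j] will be the least such level; up to it the lifts of the remainders [fr l (F x)] through both
   sheets agree. *)
pose sep l := (sheet_lev l.+1 x < sheet_lev l x) && (B s (bv l (F x)) != B t (bv l (F x))).
have frE l : (forall l', (l' < l)%N -> ~~ sep l') -> B s (fr l (F x)) = B t (fr l (F x)).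
  elim: l => [|l IH] h; first by rewrite (fr0 FD (XF Nx)) !B0.
  have [t0 E] := levS FD (XF Nx) l; rewrite E !BD !BZ IH => [|l' l'l]; last by apply: h; exact: leqW.
  congr (_ + _); move: t0; rewrite le_eqVlt => /predU1P[<-|t0]; first by rewrite !scale0r.
  by have := h l (leqnn _); rewrite /sep -subr_gt0 t0 /= negbK => /eqP ->.
have exs : exists l, sep l.
  apply: contrapT => ns; move/eqP: nxy; apply.
  rewrite -(liftK SH Hs) -(liftK SH Ht) -xy -(frr c X (F x) (leqnn r)).
  by apply: frE => l _; apply/negP => sl; apply: ns; exists l.
case: (ex_minnP exs) => j /andP[gj Bj] mj; exists j.
have agree l : (l <= j)%N -> B s (fr l (F x)) = B t (fr l (F x)).
  by move=> lj; apply: frE => l' l'l; apply: contraL lj => /mj jl';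
    rewrite -ltnNge; exact: leq_ltn_trans l'l.
split.
- by apply: le_lt_trans gj; exact: (lev_nneg FD (XF Nx) _).
- move=> l lj gl; rewrite (apexE Hs gl).
  rewrite (_ : sheet_apex l y = B t (piv l (F y))); last by apply: apexE => //; rewrite -xy.
  rewrite -xy /piv !BD !BZ agree; last exact: ltnW.
  congr (_ + _ *: _); apply/eqP; have : ~~ sep l by apply: contraL lj => /mj; rewrite -leqNgt.
  by rewrite /sep -/(sheet_lev _ _) -/(sheet_lev _ _) gl /= negbK.
move=> ej; apply: (dQ s t (x, y)); split; first by split.
apply: le_trans ej _; rewrite /= (massE FD _ (XF Nx)).
have [jr _ _ _ [Xbj sbj _]] := gap_step FD (XF Nx) gj.
(* Were the lifts of a later flag vertex equal, they would be a common point of both sheets, and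
   [lift_eq] at this point would identify the lifts of the vertex at level [j], which lies in its
   closed cell. *)
have tel k : (j + k <= r)%N -> sheet_lev j x - sheet_lev (j + k) x <=
    \sum_(l < j + k | Bd s t (sgn c (fr l.+1 (F x)))) (sheet_lev l x - sheet_lev l.+1 x).
  elim: k => [|k IH] jkr.
    rewrite addn0 subrr sumr_ge0 // => l _.
    by have [] := levS FD (XF Nx) l.
  rewrite addnS big_mkcond big_ord_recr /= -big_mkcond /=.
  have -> : sheet_lev j x - sheet_lev (j + k).+1 x =
    (sheet_lev j x - sheet_lev (j + k) x) + (sheet_lev (j + k) x - sheet_lev (j + k).+1 x) by ring.
  apply: lerD; first by apply: IH; rewrite addnS in jkr; exact: ltnW.
  case: ifPn => // /negPn/eqP Bjk.
  have [t0 _] := levS FD (XF Nx) (j + k); move: t0; rewrite le_eqVlt => /predU1P[<-//|].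
  rewrite subr_gt0 => gl; exfalso; move/eqP: Bj; apply.
  have [Hs' Fs'] := lift_bv Hs gl.
  have [|Ht' _] := @lift_bv y (j + k) t Ht; first by rewrite /sheet_lev -xy.
  rewrite -xy in Ht'.
  apply: (lift_eq SH Hs' (t := t)); first by rewrite /bv Bjk.
  rewrite Fs'; have [_ _ _ _ [_ sb _]] := gap_step FD (XF Nx) gl.
  apply: below_trans (below_sgn sbj) _.
  have h := fr_below FD (XF Nx) (leq_addr k j : (j.+1 <= (j + k).+1)%N).
  by apply: below_trans h _; exact: below_sgn.
have := tel (r - j)%N; rewrite subnKC ?leqnn; last exact: ltnW.
by move=> /(_ isT); rewrite /sheet_lev (lev_last FD (XF Nx) (leqnn r)) subr0.
Qed.

Lemma sheeted_ray_structure : ray_structure N same_fibre r sheet_lev sheet_apex.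
Proof.
split.
- by move=> x Nx; exact: (lev_first FD (XF Nx)).
- by move=> l x Nx rl; exact: (lev_last FD (XF Nx)).
- by move=> l x Nx; exact: (lev_nneg FD (XF Nx) _).
- by move=> l x Nx; exact: (lev_decr FD (XF Nx) _).
- by move=> l x Nx; apply: (@base_comp _ (lev l)) => //; exact: (lev_continuous FD).
- by move=> l x y [_ _ xy]; rewrite /sheet_lev xy.
- by move=> x y [].
- by move=> x Nx; split.
- exact: same_fibre_compact.
- by move=> i x nu Nx gp nu0 nui; exact: sheet_ray.
- by move=> i x y nu xy gp nu0 nui; exact: sheet_ray_fibre.
- exact: sheet_apex_cont.
- exact: sheet_apex_dist.
- by move=> e e0; exact: sheets_separated.
Qed.

End Sheets.

(** * Simplicial maps *)

Lemma continuous_mulmx (R : realType) (p q : nat) (B : 'M[R]_(p, q)) :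
  continuous (fun z : 'rV[R]_p => z *m B).
Proof.
under eq_fun do rewrite mulmx_sum_row.
apply: continuous_bigsum => i z.
have h : continuous (fun x : 'rV[R]_p => x 0 i) := @coord_continuous _ _ _ 0 i.
exact: (cvgZ (h z) (cvg_cst _)).
Qed.

(** * Homogeneous coordinates *)

Section Hom.
Variables (R : realType) (m : nat).

(* The homogeneous coordinates (y, 1) of a point y. *)
Definition hom (y : 'rV[R]_m) : 'rV[R]_(m + 1) :=
  y *m row_mx 1%:M 0 + row_mx 0 1%:M.
Definition hlam (z : 'rV[R]_(m + 1)) : R := (z *m col_mx 0 1%:M) ord0 (ord0 : 'I_1).

Lemma hlam_hom y : hlam (hom y) = 1.
Proof.
rewrite /hlam /hom mulmxDl -mulmxA !mul_row_col !(mulmx0, mul0mx, mulmx1, add0r, addr0).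
by rewrite mxE eqxx.
Qed.

Lemma hom_inj : injective hom.
Proof.
move=> x y /addIr /(congr1 (fun z => z *m (col_mx 1%:M 0 : 'M[R]_(m + 1, m)))).
by rewrite -!mulmxA mul_row_col mulmx0 addr0 mulmx1 !mulmx1.
Qed.

Lemma hom_comb (I : Type) (s : seq I) (w : I -> R) (F : I -> 'rV_m) :
  \sum_(v <- s) w v = 1 ->
  hom (\sum_(v <- s) w v *: F v) = \sum_(v <- s) w v *: hom (F v).
Proof.
move=> w1; rewrite /hom mulmx_suml; under [RHS]eq_bigr do rewrite scalerDr.
rewrite big_split /= -scaler_suml w1 scale1r; congr (_ + _).
by apply: eq_bigr => v _; rewrite scalemxAl.
Qed.

Lemma hlamL k x y : hlam (k *: x + y) = k * hlam x + hlam y.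
Proof. by rewrite /hlam mulmxDl -scalemxAl !mxE. Qed.

Lemma hlam_sum (I : Type) (s : seq I) (w : I -> R) (F : I -> 'rV_m) :
  hlam (\sum_(v <- s) w v *: hom (F v)) = \sum_(v <- s) w v.
Proof.
elim: s => [|v s IH]; last by rewrite !big_cons hlamL hlam_hom mulr1 IH.
by rewrite !big_nil /hlam mul0mx mxE.
Qed.

Lemma hlam_cont : continuous hlam.
Proof.
move=> z; apply: (@continuous_comp _ _ _ (fun z : 'rV[R]_(m + 1) => z *m col_mx 0 1%:M)
  (fun z : 'rV[R]_1 => z ord0 ord0)); [exact: continuous_mulmx|exact: coord_continuous].
Qed.

Lemma hom_cont : continuous hom.
Proof. by move=> y; exact: (cvgD (@continuous_mulmx R m (m + 1) _ y) (cvg_cst _)). Qed.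

End Hom.

(** * Simplices of N as sheets over the cones on their images *)

Section Simplices.
Variables (R : realType) (n m : nat) (K : {fset {fset 'rV[R]_n}}) (N : set 'rV[R]_n).
Variable fe : 'rV[R]_n -> 'rV[R]_m.
Hypothesis KS : simplicial_complex K.
Hypothesis KN : underlying_space K = N.
Hypothesis aff : forall s, s \in K -> exists (A : 'M[R]_(n, m)) (b : 'rV[R]_m),
  forall x, convex_hull s x -> fe x = x *m A + b.
Hypothesis inj : forall s, s \in K -> forall x y, convex_hull s x -> convex_hull s y ->
  fe x = fe y -> x = y.

Definition Fh x := hom (fe x).
(** Working with the cone over the image of a simplex allows its faces to be cut out by linear
    functionals, without constant terms. *)
Definition kone (s : {fset 'rV[R]_n}) (z : 'rV[R]_(m + 1)) := exists w : 'rV[R]_n -> R,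
  (forall v, v \in s -> 0 <= w v) /\ z = \sum_(v <- s) w v *: Fh v.

Lemma hull_vertex (s : {fset 'rV[R]_n}) v : v \in s -> convex_hull s v.
Proof.
move=> vs; exists (fun u => (u == v)%:R); split.
- by move=> u _; exact: ler0n.
- by rewrite (big_fsetD1 v vs) /= eqxx big_seq big1 ?addr0 // => u;
    rewrite !inE => /andP[/negPf -> _].
- rewrite (big_fsetD1 v vs) /= eqxx scale1r big_seq big1 ?addr0 // => u.
  by rewrite !inE => /andP[/negPf -> _]; rewrite scale0r.
Qed.

Lemma fe_comb (s : {fset 'rV[R]_n}) w : s \in K -> (forall v, v \in s -> 0 <= w v) ->
  \sum_(v <- s) w v = 1 ->
  fe (\sum_(v <- s) w v *: v) = \sum_(v <- s) w v *: fe v.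
Proof.
move=> sK w0 w1; have [A [b Ab]] := aff sK.
rewrite Ab; last by exists w.
have -> : \sum_(v <- s) w v *: fe v = \sum_(v <- s) (w v *: (v *m A) + w v *: b).
  by apply: eq_big_seq => v vs; rewrite Ab ?scalerDr //; exact: hull_vertex.
rewrite big_split /= -scaler_suml w1 scale1r mulmx_suml; congr (_ + _).
by apply: eq_bigr => v _; rewrite scalemxAl.
Qed.

Lemma Fh_comb (s : {fset 'rV[R]_n}) w : s \in K -> (forall v, v \in s -> 0 <= w v) ->
  \sum_(v <- s) w v = 1 ->
  Fh (\sum_(v <- s) w v *: v) = \sum_(v <- s) w v *: Fh v.
Proof. by move=> sK w0 w1; rewrite /Fh fe_comb // hom_comb. Qed.

(** A linear relation among the homogeneous images allows the barycentre to be moved inside the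
    simplex without changing its image; by injectivity it does not move, and affine independence
    kills the relation. *)
Lemma Fh_indep (s : {fset 'rV[R]_n}) w : s \in K -> \sum_(v <- s) w v *: Fh v = 0 ->
  forall v, v \in s -> w v = 0.
Proof.
move=> sK w0; have [KS1 _ _] := KS; have [sn sa] := KS1 s sK.
have sw : \sum_(v <- s) w v = 0.
  by rewrite -(hlam_sum s w fe) w0 /hlam mul0mx mxE.
have p0 : 0 < (#|` s|)%:R :> R by rewrite ltr0n cardfs_gt0.
set p : R := (#|` s|)%:R in p0.
have pE : \sum_(v <- s) p^-1 = 1.
  by rewrite big_const_seq count_predT iter_addr addr0 -mulr_natl mulfV // gt_eqF.
pose M := 1 + \sum_(v <- s) `|w v|.
have M0 : 0 < M by rewrite ltr_pwDl // sumr_ge0.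
(* Small enough for the perturbed weights [p^-1 + dl * w v] to stay nonnegative. *)
pose dl := (p * M)^-1.
have dl0 : 0 < dl by rewrite invr_gt0 mulr_gt0.
pose u v := p^-1 + dl * w v.
have u0 v : v \in s -> 0 <= u v.
  move=> vs; rewrite /u /dl invfM -mulrA -{1}[p^-1]mulr1 -mulrDr mulr_ge0 ?invr_ge0 ?(ltW p0) //.
  have : - `|w v| <= w v by rewrite lerNl -normrN ler_norm.
  have : `|w v| <= M.
    rewrite /M (big_fsetD1 v vs) /= addrCA lerDl addr_ge0 //; exact: sumr_ge0.
  move=> h1 h2; rewrite -(ler_pM2l M0) mulr0 mulrDr mulr1 mulrA mulfV ?gt_eqF // mul1r.
  lra.
have u1 : \sum_(v <- s) u v = 1.
  by rewrite big_split /= pE -mulr_sumr sw mulr0 addr0.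
have eqx : \sum_(v <- s) p^-1 *: v = \sum_(v <- s) u v *: v.
  apply: (inj sK).
  - by exists (fun=> p^-1); split => // v _; rewrite invr_ge0 ltW.
  - by exists u.
  rewrite !fe_comb //; last by move=> v _; rewrite invr_ge0 ltW.
  apply: (@hom_inj R m).
  have hc (w' : 'rV[R]_n -> R) := @hom_comb R m _ s w' fe.
  rewrite !hc //; under [RHS]eq_bigr do rewrite scalerDl -scalerA.
  rewrite big_split /= [X in _ + X](_ : _ = 0) ?addr0 //.
  have E : \sum_(i <- s) w i *: hom (fe i) = 0 by exact: w0.
  by rewrite -scaler_sumr E scaler0.
apply: (sa w sw); move: eqx; under [RHS]eq_bigr do rewrite scalerDl -scalerA.
rewrite big_split /= => /eqP; rewrite -subr_eq0 opprD addrA subrr add0r oppr_eq0.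
by rewrite -scaler_sumr scaler_eq0 gt_eqF //= => /eqP.
Qed.

(** [D] is a right inverse of the matrix [A] of vertex images. Its columns read off the weights, and
    those of [E = 1 - D *m A] vanish exactly on the span of the images; nonnegative weights and
    membership in the span describe the cone. [D] followed by the vertices inverts the map. *)
Lemma simplex_coords (s : {fset 'rV[R]_n}) : s \in K ->
  exists (L : seq 'cV[R]_(m + 1)) (B : 'M[R]_(m + 1, n)),
    (forall z z', kone s z ->
      (forall l, l \in L -> (z' *m l) 0 0 = 0 \/ 0 < (z' *m l) 0 0 * (z *m l) 0 0) ->
      kone s z') /\
    (forall w, (\sum_(v <- s) w v *: Fh v) *m B = \sum_(v <- s) w v *: v).
Proof.
move=> sK; set p := size s.
pose A : 'M[R]_(p, m + 1) := \matrix_(i < p) Fh (nth 0 s i).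
pose Vs : 'M[R]_(p, n) := \matrix_(i < p) (nth 0 s i).
have sumA w : \sum_(v <- s) w v *: Fh v = (\row_i w (nth 0 s i)) *m A.
  rewrite mulmx_sum_row (big_nth 0) big_mkord; apply: eq_bigr => i _.
  by rewrite mxE rowK.
have sumV w : \sum_(v <- s) w v *: v = (\row_i w (nth 0 s i)) *m Vs.
  rewrite mulmx_sum_row (big_nth 0) big_mkord; apply: eq_bigr => i _.
  by rewrite mxE rowK.
pose ofrow (u : 'rV[R]_p) v := \sum_(i < p | nth 0 s i == v) u 0 i.
have ofrowE u (i : 'I_p) : ofrow u (nth 0 s i) = u 0 i.
  rewrite /ofrow (big_pred1 i) // => j; rewrite nth_uniq ?fset_uniq //.
have ofrowR u : \row_i ofrow u (nth 0 s i) = u.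
  by apply/rowP => i; rewrite mxE ofrowE.
have Afree : row_free A.
  apply: inj_row_free => u uA; apply/rowP => i.
  rewrite -ofrowE mxE; apply: (Fh_indep sK); last by apply: mem_nth; exact: ltn_ord.
  by rewrite sumA ofrowR.
pose D := pinvmx A; have AD : A *m D = 1%:M by exact: mulmxVp.
pose E := 1%:M - D *m A.
exists ([seq col i D | i <- enum 'I_p] ++ [seq col i E | i <- enum 'I_(m + 1)]), (D *m Vs).
have colE q (Q : 'M[R]_(m + 1, q)) (z : 'rV_(m + 1)) i : (z *m col i Q) 0 0 = (z *m Q) 0 i.
  by rewrite !mxE; apply: eq_bigr => j _; rewrite mxE.
split; last first.
  by move=> w; rewrite sumA sumV mulmxA -(mulmxA _ A D) AD mulmx1.
move=> z z' [w [w0 zE]] h.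
have zD : z *m D = \row_i w (nth 0 s i) by rewrite zE sumA -mulmxA AD mulmx1.
have zE0 : z *m E = 0.
  by rewrite /E mulmxBr mulmx1 mulmxA zD -sumA -zE subrr.
have z'E : z' *m E = 0.
  apply/rowP => i; rewrite [RHS]mxE; have := h (col i E); rewrite !colE => -[].
  - by rewrite mem_cat; apply/orP; right; apply/mapP; exists i => //; rewrite mem_enum.
  - by [].
  - by rewrite zE0 [X in _ * X]mxE mulr0 ltxx.
exists (ofrow (z' *m D)); split.
  move=> v vs; have /nthP - /(_ 0)[i ip <-] := vs.
  rewrite (ofrowE _ (Ordinal ip)); have := h (col (Ordinal ip) D); rewrite !colE => -[].
  - by rewrite mem_cat; apply/orP; left; apply/mapP; exists (Ordinal ip) => //; rewrite mem_enum.
  - by move=> ->.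
  rewrite zD [X in _ * X]mxE /= => hp.
  have w0' := w0 _ (mem_nth 0 ip).
  rewrite leNgt; apply: contraL hp => hn; rewrite -leNgt.
  by rewrite mulr_le0_ge0 // ltW.
rewrite sumA ofrowR; apply/eqP; rewrite -subr_eq0 -mulmxA -[X in X - _]mulmx1 -mulmxBr.
by apply/eqP.
Qed.

Lemma all_coords : exists (L : seq 'cV[R]_(m + 1)),
  (forall z : 'rV[R]_(m + 1), (forall l, l \in L -> (z *m l) 0 0 = 0) -> z = 0) /\
  (forall s, s \in K -> forall z z', kone s z ->
      (forall l, l \in L -> (z' *m l) 0 0 = 0 \/ 0 < (z' *m l) 0 0 * (z *m l) 0 0) ->
      kone s z').
Proof.
have main (T : seq {fset 'rV[R]_n}) : {subset T <= K} ->
  exists (L : seq 'cV[R]_(m + 1)), forall s, s \in T -> forall z z', kone s z ->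
      (forall l, l \in L -> (z' *m l) 0 0 = 0 \/ 0 < (z' *m l) 0 0 * (z *m l) 0 0) ->
      kone s z'.
  elim: T => [|s T IH] TK; first by exists [::].
  have [|L hL] := IH; first by move=> t tT; apply: TK; rewrite inE tT orbT.
  have [L' [B [hL' _]]] := simplex_coords (TK s (mem_head s T)).
  exists (L' ++ L) => t; rewrite inE => /predU1P[->|tT] z z' zk h.
    by apply: (hL' z) => // l lL; apply: h; rewrite mem_cat lL.
  by apply: (hL t tT z) => // l lL; apply: h; rewrite mem_cat lL orbT.
have [L hL] := main K (fun s sK => sK).
(* The standard coordinates are added so that the functionals separate points, as [fun_inj]
   demands. *)
exists ([seq col i 1%:M | i <- enum 'I_(m + 1)] ++ L); split.
  move=> z h; apply/rowP => i; rewrite -[z]mulmx1.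
  have -> : (z *m 1%:M) 0 i = (z *m col i 1%:M) 0 0.
    by rewrite !mxE; apply: eq_bigr => j _; rewrite !mxE.
  rewrite h; first by rewrite mxE.
  by rewrite mem_cat; apply/orP; left; apply/mapP; exists i => //; rewrite mem_enum.
move=> s sK z z' zk h; apply: (hL s sK z) => // l lL; apply: h.
by rewrite mem_cat lL orbT.
Qed.

Lemma lam_kone s z : kone s z -> z != 0 -> 0 < hlam z.
Proof.
move=> [w [w0 zE]] z0; rewrite zE hlam_sum big_seq lt_neqAle sumr_ge0 ?andbT //.
rewrite eq_sym; apply: contra z0; rewrite psumr_eq0 // => /allP h.
rewrite zE big_seq big1 // => v vs; have := h v vs; rewrite vs /= => /eqP ->.
by rewrite scale0r.
Qed.

Lemma kone_hull s x : s \in K -> convex_hull s x -> kone s (Fh x).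
Proof. by move=> sK [w [w0 w1 ->]]; exists w; split => //; rewrite Fh_comb. Qed.

Lemma hlam_Fh x : hlam (Fh x) = 1.
Proof. exact: hlam_hom. Qed.

(** * Lifts through individual simplices *)

Section Lift.
Variable B : {fset 'rV[R]_n} -> 'M[R]_(m + 1, n).
Hypothesis BP : forall s, s \in K -> forall w,
  (\sum_(v <- s) w v *: Fh v) *m B s = \sum_(v <- s) w v *: v.

Lemma lift_hull s x : s \in K -> convex_hull s x -> Fh x *m B s = x.
Proof. by move=> sK [w [w0 w1 ->]]; rewrite Fh_comb // BP. Qed.

Lemma hull_lift s z : s \in K -> kone s z -> hlam z = 1 ->
  convex_hull s (z *m B s) /\ Fh (z *m B s) = z.
Proof.
move=> sK [w [w0 ->]]; rewrite hlam_sum => w1; rewrite BP //; split; first by exists w.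
by rewrite Fh_comb.
Qed.

Lemma lift_face (s t : {fset 'rV[R]_n}) (w : 'rV[R]_n -> R) : s \in K -> (t `<=` s)%fset ->
  (\sum_(v <- t) w v *: Fh v) *m B s = \sum_(v <- t) w v *: v.
Proof.
move=> sK ts; pose u v := if v \in t then w v else 0.
have uE (V : lmodType R) (G : 'rV[R]_n -> V) :
    \sum_(v <- t) w v *: G v = \sum_(v <- s) u v *: G v.
  rewrite (eq_big_seq (fun v => u v *: G v)); last by move=> v vt; rewrite /u vt.
  by apply: big_fset_incl => // v _ vt; rewrite /u (negPf vt) scale0r.
by rewrite (uE _ id) (uE _ Fh) BP.
Qed.

(** Both simplices contain [x], so their intersection is a common face in K containing [x]; the cone
    over this face contains [z], and on it both lifts are given by the vertices. *)
Lemma lift_indep s s' x z : s \in K -> s' \in K -> convex_hull s x -> convex_hull s' x ->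
  (forall t, t \in K -> convex_hull t x -> kone t z) -> z *m B s = z *m B s'.
Proof.
move=> sK s'K xs xs' kz; have [_ K2 K3] := KS.
have xt : convex_hull (s `&` s')%fset x by rewrite -K3.
have t0 : (s `&` s')%fset != fset0.
  apply: contraPneq xt => -> -[w [_ + _]]; rewrite big_seq_fset0 => /eqP.
  by rewrite eq_sym oner_eq0.
have tK : (s `&` s')%fset \in K by apply: (K2 s) => //; exact: fsubsetIl.
have [w [_ ->]] := kz _ tK xt.
by rewrite !lift_face ?fsubsetIl ?fsubsetIr.
Qed.

End Lift.

(** The hull is the linear image of the standard simplex of weights, a closed subset of a cube. *)
Lemma hull_compact (s : {fset 'rV[R]_n}) : compact (convex_hull s).
Proof.
pose S := [set u : 'rV[R]_(size s) | forall i, `[0, 1]%classic (u ord0 i)] `&`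
  [set u | \sum_i u ord0 i = 1].
pose Vs : 'M[R]_(size s, n) := \matrix_(i < size s) (nth 0 s i).
have <- : (fun u => u *m Vs) @` S = convex_hull s.
  apply/seteqP; split => [_ [u [u01 u1] <-]|x [w [w0 w1 ->]]].
    pose w v := \sum_(i < size s | nth 0 s i == v) u ord0 i.
    have wE (i : 'I_(size s)) : w (nth 0 s i) = u ord0 i.
      by rewrite /w (big_pred1 i) // => j; rewrite nth_uniq ?fset_uniq.
    exists w; split.
    - by move=> v _; apply: sumr_ge0 => i _; have := u01 i; rewrite /= in_itv /= => /andP[].
    - by rewrite (big_nth 0) big_mkord -[RHS]u1; apply: eq_bigr => i _; rewrite wE.
    - rewrite mulmx_sum_row (big_nth 0) big_mkord; apply: eq_bigr => i _.
      by rewrite wE rowK.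
  exists (\row_i w (nth 0 s i)); last first.
    rewrite mulmx_sum_row (big_nth 0) big_mkord; apply: eq_bigr => i _.
    by rewrite mxE rowK.
  split; last by rewrite /= -w1 (big_nth 0) big_mkord; apply: eq_bigr => i _; rewrite mxE.
  move=> i /=; rewrite mxE in_itv /= w0 ?mem_nth //= -w1.
  rewrite (big_fsetD1 (nth 0 s i)) ?mem_nth //= lerDl big_seq sumr_ge0 // => v.
  by rewrite !inE => /andP[_ /w0].
apply: continuous_compact; first exact/continuous_subspaceT/continuous_mulmx.
apply: compact_closedI;
  first by apply: (@rV_compact R _ (fun=> `[0, 1]%classic)) => i; exact: segment_compact.
apply: (@preimage_closed _ _ (fun u : 'rV[R]_(size s) => \sum_i u ord0 i) [set 1]).
  move=> u _; apply: (@continuous_bigsum R _ R^o) => i.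
  exact: coord_continuous.
exact: closed_eq.
Qed.

(** The base X is the slice at height 1 of the union of the cones, cut out by the signs of the
    functionals of all simplices; the sheets are the simplices of K, lifted by the matrices of
    [simplex_coords]. *)
Lemma simplicial_ray_structure : cont_on N fe -> exists L a P,
  ray_structure N (fun x y => [/\ N x, N y & fe x = fe y]) L a P.
Proof.
move=> fc; have [D [Dinj Dface]] := all_coords.
pose c (q : 'I_(size D)) (z : 'rV[R]_(m + 1)) := (z *m nth 0 D q) ord0 (ord0 : 'I_1).
pose X := [set z : 'rV[R]_(m + 1) | (exists2 s, s \in K & kone s z) /\ hlam z = 1].
have kface s z z' : s \in K -> kone s z -> below c z' z -> kone s z'.
  move=> sK sz b; apply: (Dface s sK z z' sz) => l lD.
  have il : (index l D < size D)%N by rewrite index_mem.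
  by have := b (Ordinal il); rewrite /c /= nth_index.
have hB (s : {fset 'rV[R]_n}) : exists C : 'M[R]_(m + 1, n), s \in K -> forall w,
    (\sum_(v <- s) w v *: Fh v) *m C = \sum_(v <- s) w v *: v.
  have [sK|] := boolP (s \in K); last by exists 0.
  by have [_ [C [_ CP]]] := simplex_coords sK; exists C.
have [B BP] := choice hB.
have FD : flag_data c (@hlam R m) X.
  split.
  - by move=> q k x y; rewrite /c mulmxDl -scalemxAl !mxE.
  - exact: hlamL.
  - move=> q z; apply: (@continuous_comp _ _ _ (fun z : 'rV[R]_(m + 1) => z *m nth 0 D q)
      (fun z : 'rV[R]_1 => z ord0 ord0)); [exact: continuous_mulmx|exact: coord_continuous].
  - exact: hlam_cont.
  - move=> z h; apply: Dinj => l lD; have il : (index l D < size D)%N by rewrite index_mem.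
    by have := h (Ordinal il); rewrite /c /= nth_index.
  - by move=> z [].
  - by move=> z y [[s sK sz] _] yz l1; split => //; exists s => //; exact: kface yz.
  - by move=> z y [[s sK sz] _] yz y0; apply: (@lam_kone s) => //; exact: kface yz.
have SH : sheeted c (@hlam R m) X N Fh (fun s : K => convex_hull (val s))
    (fun (s : K) z => z *m B (val s)).
  split.
  - move=> x; rewrite -KN; split => [[s sK sx]|[s sx]]; first by exists [` sK]%fset.
    by exists (val s) => //; exact: fsvalP.
  - by move=> s; exact: hull_compact.
  - move=> x; rewrite -KN => -[s sK sx]; split; last exact: hlam_Fh.
    by exists s => //; exact: kone_hull.
  - move=> x Nx; apply: (@cvg_comp _ _ _ fe (@hom R m) _ (nbhs (fe x))); last exact: hom_cont.
    by move/subspace_continuousP : fc; exact.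
  - by move=> s k x y; rewrite mulmxDl scalemxAl.
  - by move=> s; exact: continuous_mulmx.
  - by move=> s x sx; apply: (lift_hull BP) => //; exact: fsvalP.
  - move=> s x z sx zx l1; have sK := fsvalP s.
    by have [] := @hull_lift B BP (val s) z sK (kface _ _ _ sK (kone_hull sK sx) zx) l1.
  - move=> s x z sx zx l1; have sK := fsvalP s.
    by have [] := @hull_lift B BP (val s) z sK (kface _ _ _ sK (kone_hull sK sx) zx) l1.
  - move=> s t x z sx tx zx; apply: (lift_indep BP (fsvalP s) (fsvalP t) sx tx) => u uK ux.
    exact: (kface _ _ _ uK (kone_hull uK ux) zx).
have RS := sheeted_ray_structure FD SH.
exists (size D), (sheet_lev c (@hlam R m) X Fh), (sheet_apex c (@hlam R m) X Fh
  (fun s : K => convex_hull (val s)) (fun (s : K) z => z *m B (val s))).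
rewrite (_ : (fun x y => _) = same_fibre N Fh) //.
apply/funext => x; apply/funext => y; apply/propext; rewrite /same_fibre /Fh.
by split => -[Nx Ny]; [move=> ->|move=> /hom_inj].
Qed.

End Simplices.

(** * The space of lifts *)

Lemma nbhs_set_typeE (T : topologicalType) (A : set T) (x : A) (U : set A) :
  nbhs x U <-> exists2 Q, nbhs (\val x) Q & \val @^-1` Q `<=` U.
Proof.
split => [|[Q hQ QU]].
  move=> hU; have : [set A' | exists2 B, open_nbhs x B & B `<=` A'] U by rewrite -nbhsE.
  move=> [W [[Q Qo QW] Wx] WU]; exists Q.
    by apply: open_nbhs_nbhs; split => //; move: Wx; rewrite -QW.
  by move=> y Qy; apply: WU; rewrite -QW.
apply: (@filterS _ (nbhs x) _ _ _ QU).
exact: (@initial_continuous _ _ (\val : A -> T) x Q hQ).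
Qed.

Lemma continuous_to_set_type (S T : topologicalType) (A : set T) (h : S -> A) :
  continuous (fun x => \val (h x)) -> continuous h.
Proof.
move=> ch x U /nbhs_set_typeE [Q hQ QU].
by apply: (@filterS _ (nbhs x) _ _ _ _ (ch x Q hQ)) => y; exact: QU.
Qed.

Lemma continuous_val (T : topologicalType) (A : set T) : continuous (\val : A -> T).
Proof. by move=> x; exact: initial_continuous. Qed.

Lemma set_type_compact (T : topologicalType) (A : set T) :
  compact A -> compact [set: set_type A].
Proof.
move=> cA G PG _.
have [|p [Ap cp]] := cA (\val @ G) _;
  first by apply: (@filterS _ G _ setT) => // [x _|]; [exact: set_valP|exact: filterT].
exists (exist _ p (mem_set Ap)); split => // P U GP /nbhs_set_typeE [Q hQ QU].
have [|y [[x Px <-] Qy]] := cp (\val @` P) Q _ hQ.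
  by apply: (@filterS _ G _ P _ _ GP) => x Px; exists x.
by exists x; split => //; exact: QU.
Qed.

Lemma compact_embedding (X Y : topologicalType) (h : X -> Y) :
  compact [set: X] -> hausdorff_space Y -> continuous h -> injective h ->
  topological_embedding h.
Proof.
move=> cX hY ch ih; split => //; split.
  by apply: continuous_to_set_type; exact: ch.
have inv (y : range h) : exists x, h x = \val y.
  by case: (set_valP y) => x _ <-; exists x.
have [g gP] := choice inv.
exists g; split.
- move=> y O; rewrite nbhsE => -[W [Wo Wy] WO].
  have cC : closed (h @` (~` W)).
    apply: compact_closed => //; apply: continuous_compact.
      exact: continuous_subspaceT.
    by apply: subclosed_compact cX _ => //; exact: open_closedC.
  apply/nbhs_set_typeE; exists (~` (h @` (~` W))).
    apply: open_nbhs_nbhs; split; first exact: closed_openC.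
    by rewrite -gP => -[x nW /ih xy]; apply: nW; rewrite xy.
  move=> z nz; apply: WO; apply: contrapT => nW; apply: nz.
  by exists (g z); [|exact: gP].
- by move=> x; apply: ih; rewrite gP.
- by move=> y; apply: val_inj; rewrite /= gP.
Qed.

Lemma hausdorff_injective (X Y : topologicalType) (j : X -> Y) :
  hausdorff_space Y -> continuous j -> injective j -> hausdorff_space X.
Proof.
move=> hY cj ij p q pq; apply: ij; apply: hY => A B hA hB.
by have [x [? ?]] := pq _ _ (cj p A hA) (cj q B hB); exists (j x).
Qed.

Section Extension.
Variables (V : choiceType) (N : set V).

(* The value 0 outside N is irrelevant. *)
Definition extend (W : zmodType) (h : N -> W) (v : V) : W := oapp h 0 (insub v).

Lemma extendE (W : zmodType) (h : N -> W) (u : N) : extend h (\val u) = h u.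
Proof. by rewrite /extend valK. Qed.

Lemma set_lift x : N x -> exists u : N, \val u = x.
Proof. by move=> Nx; exists (exist _ x (mem_set Nx)). Qed.

End Extension.

Lemma extend_cont (R : realType) (V W : normedModType R) (N : set V) (h : N -> W) :
  continuous h -> cont_on N (extend h).
Proof.
move=> ch; apply/subspace_sigL_continuousP.
by rewrite (_ : sigL _ _ = h) //; apply/funext => u; rewrite /sigL /= extendE.
Qed.

(** * Non-degeneracy and injectivity on simplices *)

Section Simplicial.
Variables (R : realType) (n m : nat) (N : set 'rV[R]_n) (M : set 'rV[R]_m) (f : N -> M).

(** The fibre relation is moved to ambient vectors, where levels and apices live. *)
Definition feq (x y : 'rV[R]_n) := [/\ N x, N y &
  extend (fun u => \val (f u)) x = extend (fun u => \val (f u)) y].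

Lemma segment_simplex (x y : 'rV[R]_n) : x != y -> simplex_vertices [fset x; y]%fset.
Proof.
move=> xy; split; first by apply/fset0Pn; exists x; rewrite !inE eqxx.
have sE (W : zmodType) (F : 'rV[R]_n -> W) : \sum_(v <- [fset x; y]%fset) F v = F x + F y.
  by rewrite big_fsetU1 ?inE // big_seq_fset1.
move=> w; rewrite !sE => w1 w2.
have wy : w y = - w x by apply/eqP; rewrite -addr_eq0 addrC w1.
have wx : w x = 0.
  move/eqP: w2; rewrite wy scaleNr -scalerBr scaler_eq0 subr_eq0 (negPf xy) orbF.
  by move/eqP.
by move=> v; rewrite !inE => /orP[] /eqP ->; rewrite ?wy wx ?oppr0.
Qed.

(** If two distinct points of a simplex had the same image, the segment between them would lie in
    one fibre by affinity: a 1-simplex, contrary to non-degeneracy. *)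
Lemma non_degenerate_inj (K : {fset {fset 'rV[R]_n}}) : triangulates K N ->
  non_degenerate f ->
  (forall s, s \in K -> exists (A : 'M[R]_(n, m)) (b : 'rV[R]_m),
      forall x : N, convex_hull s (\val x) -> \val (f x) = \val x *m A + b) ->
  forall s, s \in K -> forall x y, convex_hull s x -> convex_hull s y ->
    extend (fun u => \val (f u)) x = extend (fun u => \val (f u)) y -> x = y.
Proof.
move=> [_ KN] nd aff s sK x y sx sy; have [A [b Ab]] := aff s sK.
have sN z : convex_hull s z -> N z by move=> sz; rewrite -KN; exists s.
have [u ux] := set_lift (sN x sx); have [v vy] := set_lift (sN y sy).
rewrite -ux -vy !extendE => uv; apply/eqP; apply: contrapT => /negP nxy.
rewrite ux vy in nxy.
apply: (nd (f u)); apply: (@lt_le_trans _ _ 1%:E); first by rewrite lte_fin ltr01.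
apply: ereal_sup_ubound; exists [fset x; y]%fset; last by rewrite cardfs2 nxy.
split; first exact: segment_simplex.
have sE (W : zmodType) (F : 'rV[R]_n -> W) : \sum_(v <- [fset x; y]%fset) F v = F x + F y.
  by rewrite big_fsetU1 ?inE // big_seq_fset1.
move=> z [w [w0 w1 zE]]; rewrite !sE in w1 zE.
have a0 : 0 <= w x by rewrite w0 // !inE eqxx.
have b0 : 0 <= w y by rewrite w0 // !inE eqxx orbT.
move: (w x) (w y) w1 zE a0 b0 => {w w0} wx wy w1 zE a0 b0.
have sz : convex_hull s z.
  move: sx sy => [p [p0 p1 xE]] [q [q0 q1 yE]].
  exists (fun c => wx * p c + wy * q c); split.
  - by move=> c cs; rewrite addr_ge0 // mulr_ge0 ?p0 ?q0.
  - by rewrite big_split /= -!mulr_sumr p1 q1 !mulr1.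
  - rewrite zE [in wx *: x]xE [in wy *: y]yE !scaler_sumr -big_split /=.
    by apply: eq_bigr => c _; rewrite scalerDl !scalerA.
have [t tz] := set_lift (sN z sz); exists t; last by rewrite tz.
apply: val_inj; rewrite /= Ab ?tz // zE.
rewrite mulmxDl -!scalemxAl.
have fx : \val (f u) = x *m A + b by rewrite Ab ux.
have fy : \val (f u) = y *m A + b by rewrite uv Ab vy.
have bE : b = wx *: b + wy *: b by rewrite -scalerDl w1 scale1r.
by rewrite {1}bE addrACA -!scalerDr -fx -fy -scalerDl w1 scale1r.
Qed.

Lemma fibre_ray_structure : pl_map f -> non_degenerate f -> continuous f ->
  exists L a P, ray_structure N feq L a P.
Proof.
move=> [K KN aff] nd cf; apply: (@simplicial_ray_structure R n m K N).
- by case: KN.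
- by case: KN.
- move=> s sK; have [A [b Ab]] := aff s sK; exists A, b => x sx.
  have [|u ux] := @set_lift _ N x; first by case: KN => _ <-; exists s.
  by rewrite -ux extendE Ab ux.
- by move=> s sK x y; exact: (non_degenerate_inj KN nd aff sK).
- have cvf : continuous (fun u : N => \val (f u) : 'rV[R]_m).
    move=> u; apply: (@continuous_comp _ _ _ f (\val : M -> 'rV[R]_m)); first exact: cf.
    exact: continuous_val.
  exact: (extend_cont cvf).
Qed.

End Simplicial.

(** * Lifts and their second components *)

Section Lifts.
Variables (R : realType) (n m k : nat) (N : set 'rV[R]_n) (M : set 'rV[R]_m) (f : N -> M).

Local Notation E := (set_type (lifting_embeddings f k)).

Definition fibre_comp (e : E) : 'rV[R]_n -> 'rV[R]_k := extend (fun u => (\val e u).2).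

Definition glue (g : 'rV[R]_n -> 'rV[R]_k) : {uniform N -> (M * 'rV[R]_k)%type} :=
  fun u => (f u, g (\val u)).

Lemma embE (e : E) u : \val e u = (f u, fibre_comp e (\val u)).
Proof.
have [_ /(congr1 (fun h => h u))] := set_valP e; rewrite /fibre_comp extendE.
by rewrite /= => <-; case: (\val e u).
Qed.

(** All lifts have first component [f], so only the second one matters for uniform closeness. *)
Lemma nbhs_liftP (e : E) (U : set E) : nbhs e U <->
  exists2 d : R, 0 < d & forall e' : E, close N d (fibre_comp e') (fibre_comp e) -> U e'.
Proof.
split => [/nbhs_set_typeE [Q hQ QU]|[d d0 dU]].
  move: hQ => /uniform_nbhs [S [[[A B] [/= eA eB] ABS] SQ]].
  move: eB; rewrite -entourage_from_ballE => -[d /= d0 dB].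
  (* Halving passes from the non-strict bound of [close] to an open ball. *)
  exists (d / 2); first exact: divr_gt0.
  move=> e' ee'; apply: QU; apply: SQ => u _.
  have [|[[p1 p2] [q1 q2]] /= Spq] := ABS ((f u, f u), (fibre_comp e (\val u), fibre_comp e' (\val u))).
    split => /=; first exact: entourage_refl.
    apply: dB; rewrite /= -ball_normE /= distrC.
    apply: le_lt_trans (ee' _ (set_valP u)) _.
    by rewrite ltr_pdivrMr // mulr_natr mulr2n ltrDl.
  rewrite !embE => -[e1 e2 e3 e4]; move: Spq.
  by rewrite e1 e2 e3 e4.
apply/nbhs_set_typeE; exists [set h | forall u : N, ball (\val e u).2 d (h u).2].
  apply/uniform_nbhs; exists [set xy | ball xy.1.2 d xy.2.2]; split.
    apply: (@filterS _ entourage _ [set xy | setT (xy.1.1, xy.2.1) /\ ball xy.1.2 d xy.2.2]).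
      by move=> xy [].
    have eB : entourage [set xy : 'rV[R]_k * 'rV[R]_k | ball xy.1 d xy.2].
      by rewrite -entourage_from_ballE; exists d.
    exact: (prod_entP (@entourageT M) eB).
  by move=> h hh u; exact: hh.
move=> e' ee'; apply: dU => x Nx; have [u <-] := set_lift Nx.
have := ee' u; rewrite /= !embE -ball_normE /= distrC; exact: ltW.
Qed.

Hypothesis cN : compact N.

Lemma glue_embedding g : continuous f -> cont_on N g -> sim_injective (feq f) g ->
  lifting_embeddings f k (glue g).
Proof.
move=> cf cg ig; split => //; apply: compact_embedding.
- exact: set_type_compact.
- pose j (p : M * 'rV[R]_k) : 'rV[R]_m * 'rV[R]_k := (\val p.1, p.2).
  apply: (@hausdorff_injective _ _ j); first exact: norm_hausdorff.
    move=> p; have h1 : \val q.1 @[q --> p] --> (\val p.1 : 'rV[R]_m).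
      apply: (@cvg_comp _ _ _ fst (\val : M -> 'rV[R]_m) _ (nbhs p.1)); first exact: cvg_fst.
      exact: continuous_val.
    exact: (cvg_pair h1 cvg_snd).
  by move=> [a b] [a' b'] [/val_inj -> ->].
- move=> u; have gu : g (\val v) @[v --> u] --> g (\val u).
    by move/subspace_sigL_continuousP : cg; exact.
  exact: (cvg_pair (cf u) gu).
- move=> u v [fuv guv]; apply: val_inj; apply/eqP; apply: contra_eqT guv => uv.
  by apply: ig => //; split; rewrite ?extendE ?fuv //; exact: set_valP.
Qed.

Lemma fibre_comp_cont e : cont_on N (fibre_comp e).
Proof.
have [[ce _] _] := set_valP e; apply: extend_cont => u.
exact: (cvg_comp _ _ (ce u) (cvg_snd (F := nbhs (\val e u).1) (G := nbhs (\val e u).2))).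
Qed.

(** [f] is the first component of the continuous map [e]. *)
Lemma lift_base_cont (e : E) : continuous f.
Proof.
have [[ce _] le] := set_valP e; rewrite -le => u.
exact: (cvg_comp _ _ (ce u) (cvg_fst (F := nbhs (\val e u).1) (G := nbhs (\val e u).2))).
Qed.

Lemma fibre_comp_inj e : sim_injective (feq f) (fibre_comp e).
Proof.
have [[_ [_ [g [_ gK _]]]] _] := set_valP e.
have ei : injective (\val e) by move=> u v uv; apply: (can_inj gK); apply: val_inj.
move=> x y [Nx Ny]; have [u <-] := set_lift Nx; have [v <-] := set_lift Ny.
rewrite !extendE => /val_inj fuv; apply: contra_neq => guv.
by congr (\val _); apply: ei; rewrite !embE fuv guv.
Qed.

End Lifts.

Lemma polyhedron_compact (R : realType) (n : nat) (N : set 'rV[R]_n) :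
  compact_polyhedron N -> compact N.
Proof. by move=> [K [_ <-]]; apply: bigcup_compact => s; exact: hull_compact. Qed.

Lemma glueK (R : realType) (n m k : nat) (N : set 'rV[R]_n) (M : set 'rV[R]_m)
    (f : N -> M) (e : lifting_embeddings f k) g x : \val e = glue f g -> N x ->
  fibre_comp e x = g x.
Proof. by move=> eg Nx; have [u <-] := set_lift Nx; rewrite /fibre_comp extendE eg. Qed.

Theorem theorem1p1 (R : realType) (n m k : nat)
    (N : set 'rV[R]_n) (M : set 'rV[R]_m) (f : N -> M)
    (hN : compact_polyhedron N) (hM : compact_polyhedron M)
    (hf : pl_map f) (hnd : non_degenerate f) :
  locally_contractible R (set_type (lifting_embeddings f k)).
Proof.
move=> e0 U hU; have [r r0 rU] := (nbhs_liftP e0 U).1 hU.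
have cN := polyhedron_compact hN; have cf := lift_base_cont e0.
have [L [a [P RS]]] := fibre_ray_structure hf hnd cf.
(* At stage 0 no level has to be conical, so the scale [2^-1] is arbitrary. *)
have good_comp (e : lifting_embeddings f k) : good N (feq f) a P 0 (fun=> 2^-1) (fibre_comp e).
  by split => //; [exact: fibre_comp_cont|exact: fibre_comp_inj].
have [d [H [d0 Hc H0 Hq Hg]]] := contraction RS (add0n L)
  (fun l (l0 : (l < 0)%N) => False_ind _ (Bool.diff_false_true l0)) (good_comp e0) r0.
pose c := Num.min d r.
have c0 : 0 < c by rewrite lt_min d0 r0.
pose V := [set e : lifting_embeddings f k | close N c (fibre_comp e) (fibre_comp e0)].
have Vd e : V e -> close N d (fibre_comp e) (fibre_comp e0).
  by move=> Ve x Nx; apply: le_trans (Ve x Nx) _; rewrite ge_min lexx.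
have Ve0 : V e0 by move=> x Nx; rewrite subrr normr0 ltW.
have emb t e : 0 <= t <= 1 -> V e -> lifting_embeddings f k (glue f (H t (fibre_comp e))).
  move=> t01 Ve; apply: glue_embedding => //; first by apply: Hc => //; exact: fibre_comp_cont.
  by have [/(_ t t01)[]] := Hg _ (good_comp e) (Vd e Ve).
(* The default [e0] is taken only where the glued map is not a lifting embedding, which does not
   occur over [[0, 1]] and V. *)
pose G (p : R * lifting_embeddings f k) : lifting_embeddings f k :=
  insubd e0 (glue f (H p.1 (fibre_comp p.2))).
have GE t e : 0 <= t <= 1 -> V e -> \val (G (t, e)) = glue f (H t (fibre_comp e)).
  by move=> t01 Ve; rewrite /G val_insubd mem_set //; exact: emb.
have t0 : 0 <= (0 : R) <= 1 by rewrite lexx ler01.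
have t1 : 0 <= (1 : R) <= 1 by rewrite lexx ler01.
have GU t e : 0 <= t <= 1 -> V e -> U (G (t, e)).
  move=> t01 Ve; apply: rU => x Nx; rewrite (glueK (GE t e t01 Ve) Nx).
  by have [/(_ t t01)[_ h] _] := Hg _ (good_comp e) (Vd e Ve); exact: h.
have gval (e e' : lifting_embeddings f k) :
    (forall x, N x -> fibre_comp e x = fibre_comp e' x) -> e = e'.
  by move=> h; apply: val_inj; apply/funext => u; rewrite !embE h //; exact: set_valP.
have G0 e : V e -> G (0, e) = e.
  by move=> Ve; apply: gval => x Nx; rewrite (glueK (GE _ _ t0 Ve) Nx) H0.
exists V; split.
- by apply/nbhs_liftP; exists c.
(* V lies in U because the homotopy starts at the identity and stays in U. *)
- by move=> e Ve; rewrite -(G0 e Ve); exact: GU.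
(* The common end point is that of the path of [e0], which coning has moved away from [e0] in
   general. *)
exists (G (1, e0)), G; split => //.
- exact: GU.
- apply/subspace_continuousP => -[t e] [/= t01 Ve] Q /nbhs_liftP [s s0 sQ].
  have [q q0 qH] := Hq t _ t01 (@fibre_comp_cont _ _ _ _ _ _ _ e) s s0.
  exists (ball t q, [set e' | close N q (fibre_comp e') (fibre_comp e)]).
    by split => /=; [exact: nbhsx_ballx|apply/nbhs_liftP; exists q].
  move=> [t' e'] /= [tt' ee'] [t'01 Ve']; apply: sQ => x Nx.
  rewrite (glueK (GE _ _ t'01 Ve') Nx) (glueK (GE _ _ t01 Ve) Nx).
  apply: qH => //; first exact: fibre_comp_cont.
  by rewrite distrC; move: tt'; rewrite -ball_normE.
- move=> e Ve; apply: gval => x Nx.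
  rewrite (glueK (GE _ _ t1 Ve) Nx) (glueK (GE _ _ t1 Ve0) Nx).
  by have [_ ->] := Hg _ (good_comp e) (Vd e Ve).
Qed.
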